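(* There is an absolute constant $C>0$ such that the following holds. Let $X\in\mathbb{R}^{n\times n}$ be a rank $r$ matrix with condition number $\kappa=\sigma_{\max}(X)/\sigma_{\min}(X)$ satisfying assumptions A0 (with parameter $\mu_0$) and A1 (with parameter $\mu_1$). Suppose $\Omega$ with $|\Omega|=m$ is a set of indices sampled independently and uniformly with replacement from $\{1,\dots,n\}^2$. Consider either the Riemannian gradient descent algorithm (RGrad), or the restarted Riemannian conjugate gradient algorithm (restarted RCG) with parameters $\kappa_1,\kappa_2\ge0$ satisfying $\kappa_1\kappa_2<1/3$, run with the full sampling set $\Omega$, and let $\varepsilon_0$ be an admissible constant for the algorithm considered (see context). Let $\beta>1$ and let $X_0$ be the output of the initialization procedure via resampled Riemannian gradient descent and trimming applied to $\Omega$ with $L=\left\lceil 6\log\left(\frac{\beta n\log(n)}{24\varepsilon_0}\right)\right\rceil$. Then the iterates of the algorithm started from $X_0$ converge to $X$ with probability at least $$1-2n^{1-\beta}-\left(24\log\left(\frac{\beta n\log(n)}{24\varepsilon_0}\right)+3\right)n^{2-2\beta}$$ provided $$m\ge C\beta\max\left\{\frac{\mu_0}{\varepsilon_0^2},\mu_1^2\right\}\kappa^6nr^2\log(n)\log\left(\frac{\beta n\log(n)}{24\varepsilon_0}\right).$$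
   Context: Here $n\ge 9$, $1\le r\le n$, $m\le n^2$, and $L+1$ divides $m$. $\|\cdot\|$ is the spectral norm of a matrix (Euclidean norm of a vector), $\|\cdot\|_F$ the Frobenius norm, $\|\cdot\|_\infty$ the maximum magnitude of the entries; $\langle\cdot,\cdot\rangle$ is the Frobenius inner product; $\sigma_{\min}(X),\sigma_{\max}(X)$ are the smallest nonzero and the largest singular values of $X$. $Z^{(i)}$ is the $i$-th row of $Z$. Assumption A0: with reduced SVD $X=U\Sigma V^*$, $\|\mathcal{P}_U(e_i)\|\le\sqrt{\mu_0r/n}$ and $\|\mathcal{P}_V(e_j)\|\le\sqrt{\mu_0r/n}$ for $1\le i,j\le n$, where $\mathcal{P}_U,\mathcal{P}_V$ are the orthogonal projections onto the column and row spaces of $X$ and $e_\ell$ are the canonical basis vectors. Assumption A1: $\|X\|_\infty\le\mu_1\sqrt{r/n^2}\,\|X\|$. Sampling operator: for a collection of indices $\Omega$, $\mathcal{P}_\Omega(Z)$ is the entrywise product of $Z$ with $\sum_{(i,j)\in\Omega}e_ie_j^*$, repeated indices being counted with multiplicity. Tangent space: for a rank $r$ matrix $Y$ with reduced SVD $Y=U_Y\Sigma_YV_Y^*$, the tangent space of the rank $r$ matrix manifold at $Y$ is $\{U_YZ_1^*+Z_2V_Y^*: Z_1,Z_2\in\mathbb{R}^{n\times r}\}$, and $\mathcal{P}_{T}$ denotes the orthogonal projection onto a tangent space $T$. Hard thresholding: $\mathcal{H}_r(Z)$ keeps the $r$ largest singular values in an SVD of $Z$ and sets the others to zero (any fixed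 deterministic rule for choosing the SVD). Initialization via resampled Riemannian gradient descent and trimming: partition the i.i.d. sampled indices $\Omega$ (by a rule fixed in advance, e.g. by sampling order) into $L+1$ groups $\Omega_0,\dots,\Omega_L$ of equal size $\widehat m$. Set $Z_0=\mathcal{H}_r\left(\frac{n^2}{\widehat m}\mathcal{P}_{\Omega_0}(X)\right)$. For $l=0,\dots,L-1$: $\widehat Z_l=\mathrm{trim}(Z_l)$ and $Z_{l+1}=\mathcal{H}_r\left(\widehat Z_l+\frac{n^2}{\widehat m}\mathcal{P}_{\widehat T_l}\mathcal{P}_{\Omega_{l+1}}(X-\widehat Z_l)\right)$, where $\widehat T_l$ is the tangent space at $\widehat Z_l$. Output $X_0=Z_L$. Here, for $Z_l=U_l\Sigma_lV_l^*$ (SVD), $\mathrm{trim}(Z_l)=A_l\Sigma_lB_l^*$ with $$A_l^{(i)}=\frac{U_l^{(i)}}{\|U_l^{(i)}\|}\min\left(\|U_l^{(i)}\|,\sqrt{\frac{\mu_0r}{n}}\right),\qquad B_l^{(i)}=\frac{V_l^{(i)}}{\|V_l^{(i)}\|}\min\left(\|V_l^{(i)}\|,\sqrt{\frac{\mu_0r}{n}}\right)$$ (zero rows stay zero). RGrad: given $X_0$, for $l=0,1,\dots$ let $T_l$ be the tangent space at $X_l$ and set $G_l=\mathcal{P}_\Omega(X-X_l)$, $\alpha_l=\dfrac{\|\mathcal{P}_{T_l}(G_l)\|_F^2}{\langle\mathcal{P}_{T_l}(G_l),\mathcal{P}_\Omega\mathcal{P}_{T_l}(G_l)\rangle}$,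 $W_l=X_l+\alpha_l\mathcal{P}_{T_l}(G_l)$, $X_{l+1}=\mathcal{H}_r(W_l)$. If $\mathcal{P}_{T_l}(G_l)=0$, then $X_{l+1}=X_l$. Restarted RCG: given $X_0$, set $\beta_0=0$, $P_{-1}=0$. For $l=0,1,\dots$ let $T_l$ be the tangent space at $X_l$ and set 1. $G_l=\mathcal{P}_\Omega(X-X_l)$; 2. for $l\ge1$: if both restarting conditions $$\frac{|\langle\mathcal{P}_{T_l}(G_l),\mathcal{P}_{T_l}(P_{l-1})\rangle|}{\|\mathcal{P}_{T_l}(G_l)\|_F\|\mathcal{P}_{T_l}(P_{l-1})\|_F}\le\kappa_1,\qquad \|\mathcal{P}_{T_l}(G_l)\|_F\le\kappa_2\|\mathcal{P}_{T_l}(P_{l-1})\|_F$$ hold, then $\beta_l=-\dfrac{\langle\mathcal{P}_{T_l}(G_l),\mathcal{P}_\Omega\mathcal{P}_{T_l}(P_{l-1})\rangle}{\langle\mathcal{P}_{T_l}(P_{l-1}),\mathcal{P}_\Omega\mathcal{P}_{T_l}(P_{l-1})\rangle}$; if either is violated, or if $\mathcal{P}_{T_l}(G_l)=0$ or $\mathcal{P}_{T_l}(P_{l-1})=0$, then $\beta_l=0$; 3. $P_l=\mathcal{P}_{T_l}(G_l)+\beta_l\mathcal{P}_{T_l}(P_{l-1})$; 4. $\alpha_l=\dfrac{\langle\mathcal{P}_{T_l}(G_l),\mathcal{P}_{T_l}(P_l)\rangle}{\langle\mathcal{P}_{T_l}(P_l),\mathcal{P}_\Omega\mathcal{P}_{T_l}(P_l)\rangle}$;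 5. $X_{l+1}=\mathcal{H}_r(X_l+\alpha_lP_l)$. If $P_l=0$, then $X_{l+1}=X_l$. (The weights $\beta_l$ are unrelated to the parameter $\beta>1$ in the claim.) Admissible $\varepsilon_0$: for RGrad, a constant $0<\varepsilon_0<1/4$ with $\frac{18\varepsilon_0}{1-4\varepsilon_0}<1$. For restarted RCG, a constant $\varepsilon_0>0$ with $(1-4\varepsilon_0)-\kappa_1(1+4\varepsilon_0)>0$ and $\tau_1+\tau_2<1$, where $$\tau_1=\frac{18\varepsilon_0-10\kappa_1\varepsilon_0(1+4\varepsilon_0)}{(1-4\varepsilon_0)-\kappa_1(1+4\varepsilon_0)}+\frac{4\kappa_2\varepsilon_0+\kappa_1\kappa_2}{1-4\varepsilon_0},\qquad \tau_2=\frac{8\kappa_2\varepsilon_0+2\kappa_1\kappa_2}{1-4\varepsilon_0}.$$ *)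

(* Defs.v *)
From HB Require Import structures.
From mathcomp Require Import all_boot all_order all_algebra.
From mathcomp Require Import all_classical all_reals all_analysis.

Set Implicit Arguments.
Unset Strict Implicit.
Unset Printing Implicit Defensive.

Import Order.TTheory GRing.Theory Num.Theory.
Import numFieldNormedType.Exports.

Local Open Scope classical_set_scope.
Local Open Scope ring_scope.

Section Matrices.
Context {R : realType}.

Definition frob_dot p q (A B : 'M[R]_(p, q)) : R := \sum_i \sum_j A i j * B i j.

(* On row and column vectors this is the Euclidean norm. *)
Definition frob_norm p q (A : 'M[R]_(p, q)) : R := Num.sqrt (frob_dot A A).

(* Orthogonal projection of Z onto the linear subspace S, for the Frobenius
   inner product.  The default value 0 is only used when S is empty. *)
Definition orth_proj p q (S : set 'M[R]_(p, q)) (Z : 'M[R]_(p, q)) :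
    'M[R]_(p, q) :=
  xget 0 [set W | S W /\ forall V, S V -> frob_dot (Z - W) V = 0].

Definition column_space p q (A : 'M[R]_(p, q)) : set 'cV[R]_p :=
  range (fun w : 'cV[R]_q => A *m w).

Definition row_space p q (A : 'M[R]_(p, q)) : set 'cV[R]_q :=
  column_space A^T.

Definition singular_value p q (A : 'M[R]_(p, q)) (s : R) : Prop :=
  0 <= s /\ eigenvalue (A^T *m A) (s ^+ 2).

(* Matrices have finitely many singular values, so the supremum and the
   infimum below are attained (for a nonzero matrix). *)
Definition sigma_max p q (A : 'M[R]_(p, q)) : R :=
  sup [set s | singular_value A s].

Definition sigma_min p q (A : 'M[R]_(p, q)) : R :=
  inf [set s | singular_value A s /\ 0 < s].

Definition spectral_norm p q (A : 'M[R]_(p, q)) : R := sigma_max A.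

Definition condition_number p q (A : 'M[R]_(p, q)) : R :=
  sigma_max A / sigma_min A.

(* With k = n this is a full singular value decomposition. *)
Definition is_svd n k (Z : 'M[R]_n) (U : 'M[R]_(n, k)) (s : 'rV[R]_k)
    (V : 'M[R]_(n, k)) : Prop :=
  [/\ U^T *m U = 1%:M, V^T *m V = 1%:M, forall i, 0 <= s 0 i,
      forall i j : 'I_k, (i <= j)%N -> s 0 j <= s 0 i
    & Z = U *m diag_mx s *m V^T].

(* Positivity of the singular values forces k to be the rank of Z. *)
Definition is_reduced_svd n k (Z : 'M[R]_n) (U : 'M[R]_(n, k)) (s : 'rV[R]_k)
    (V : 'M[R]_(n, k)) : Prop :=
  is_svd Z U s V /\ forall i, 0 < s 0 i.

(* The set does not depend on the choice of the reduced SVD of Y. *)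
Definition tangent_space n (Y : 'M[R]_n) : set 'M[R]_n :=
  [set W | exists k (U : 'M[R]_(n, k)) (s : 'rV[R]_k) (V : 'M[R]_(n, k)),
    is_reduced_svd Y U s V /\
    exists Z1 Z2 : 'M[R]_(n, k), W = U *m Z1^T + Z2 *m V^T].

Definition proj_tangent n (Y Z : 'M[R]_n) : 'M[R]_n :=
  orth_proj (tangent_space Y) Z.

Definition is_hard_threshold n (r : nat) (Z W : 'M[R]_n) : Prop :=
  exists (U : 'M[R]_n) (s : 'rV[R]_n) (V : 'M[R]_n), is_svd Z U s V /\
    W = U *m diag_mx (\row_i (if (i < r)%N then s 0 i else 0)) *m V^T.

Definition assumption_A0 n (r : nat) (mu0 : R) (X : 'M[R]_n) : Prop :=
  forall i : 'I_n,
    frob_norm (orth_proj (column_space X) (delta_mx i 0))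
      <= Num.sqrt (mu0 * r%:R / n%:R) /\
    frob_norm (orth_proj (row_space X) (delta_mx i 0))
      <= Num.sqrt (mu0 * r%:R / n%:R).

(* mx_norm is the maximum magnitude of the entries. *)
Definition assumption_A1 n (r : nat) (mu1 : R) (X : 'M[R]_n) : Prop :=
  mx_norm X <= mu1 * Num.sqrt (r%:R / n%:R ^+ 2) * spectral_norm X.

(* Omega is a sequence, so that repeated indices count with multiplicity. *)
Definition sampling_op n (Omega : seq ('I_n * 'I_n)) (Z : 'M[R]_n) : 'M[R]_n :=
  map2_mx *%R Z (\sum_(p <- Omega) delta_mx p.1 p.2).

(* Zero rows stay zero since 0 / 0 = 0. *)
Definition trim_rows n k (c : R) (U : 'M[R]_(n, k)) : 'M[R]_(n, k) :=
  \matrix_(i, j) (U i j / frob_norm (row i U) * Num.min (frob_norm (row i U)) c).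

(* The value does not depend on the choice of the reduced SVD of Z, because
   the row norms of U and V are those of the projections onto the column and
   row spaces of Z. *)
Definition trim n (r : nat) (mu0 : R) (Z : 'M[R]_n) : 'M[R]_n :=
  let c := Num.sqrt (mu0 * r%:R / n%:R) in
  xget 0 [set W |
    exists k (U : 'M[R]_(n, k)) (s : 'rV[R]_k) (V : 'M[R]_(n, k)),
      is_reduced_svd Z U s V /\
      W = trim_rows c U *m diag_mx s *m (trim_rows c V)^T].

End Matrices.

Section Initialization.
Context {R : realType} (n m L : nat).

(* A rule, fixed in advance, which sends the k-th sample to one of the L + 1
   groups. *)
Definition equal_groups (grp : 'I_m -> 'I_L.+1) : Prop :=
  forall j, #|[set k | grp k == j]%SET| = (m %/ L.+1)%N.

Definition sample_group (grp : 'I_m -> 'I_L.+1)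
    (w : m.-tuple ('I_n * 'I_n)) (l : nat) : seq ('I_n * 'I_n) :=
  [seq tnth w k | k <- enum 'I_m & grp k == l :> nat].

Variables (r : nat) (mu0 : R) (H : 'M[R]_n -> 'M[R]_n) (X : 'M[R]_n).
Variables (grp : 'I_m -> 'I_L.+1) (w : m.-tuple ('I_n * 'I_n)).

Let scaling : R := n%:R ^+ 2 / (m %/ L.+1)%:R.

Fixpoint init_iter (l : nat) : 'M[R]_n :=
  if l is l'.+1 then
    let Zhat := trim r mu0 (init_iter l') in
    H (Zhat + scaling *: proj_tangent Zhat
                (sampling_op (sample_group grp w l) (X - Zhat)))
  else H (scaling *: sampling_op (sample_group grp w 0) X).

Definition initialization : 'M[R]_n := init_iter L.

End Initialization.

Section Algorithms.
Context {R : realType} (n : nat).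
Variables (H : 'M[R]_n -> 'M[R]_n) (Omega : seq ('I_n * 'I_n)).
Variables (X X0 : 'M[R]_n).

Definition rgrad_step (Xl : 'M[R]_n) : 'M[R]_n :=
  let D := proj_tangent Xl (sampling_op Omega (X - Xl)) in
  let alpha := frob_norm D ^+ 2 / frob_dot D (sampling_op Omega D) in
  if D == 0 then Xl else H (Xl + alpha *: D).

Definition rgrad_iter (l : nat) : 'M[R]_n := iter l rgrad_step X0.

Variables kappa1 kappa2 : R.

(* Here D = P_T(G_l) and Q = P_T(P_{l-1}). *)
Definition rcg_weight (D Q : 'M[R]_n) : R :=
  if [&& D != 0, Q != 0,
         `|frob_dot D Q| / (frob_norm D * frob_norm Q) <= kappa1
       & frob_norm D <= kappa2 * frob_norm Q]
  then - (frob_dot D (sampling_op Omega Q) / frob_dot Q (sampling_op Omega Q))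
  else 0.

(* (X_l, P_{l-1}) |-> (X_{l+1}, P_l) *)
Definition rcg_step (l : nat) (state : 'M[R]_n * 'M[R]_n) :
    'M[R]_n * 'M[R]_n :=
  let: (Xl, Pprev) := state in
  let D := proj_tangent Xl (sampling_op Omega (X - Xl)) in
  let Q := proj_tangent Xl Pprev in
  let beta := if l == 0 then 0 else rcg_weight D Q in
  let P := D + beta *: Q in
  let TP := proj_tangent Xl P in
  let alpha := frob_dot D TP / frob_dot TP (sampling_op Omega TP) in
  (if P == 0 then Xl else H (Xl + alpha *: P), P).

Fixpoint rcg_state (l : nat) : 'M[R]_n * 'M[R]_n :=
  if l is l'.+1 then rcg_step l' (rcg_state l') else (X0, 0).

Definition rcg_iter (l : nat) : 'M[R]_n := (rcg_state l).1.

End Algorithms.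

Inductive algorithm (R : Type) : Type :=
| RGrad
| RestartedRCG of R & R.

Arguments RGrad {R}.

Definition alg_iter (R : realType) n (alg : algorithm R)
    (H : 'M[R]_n -> 'M[R]_n) (Omega : seq ('I_n * 'I_n)) (X X0 : 'M[R]_n) :
    nat -> 'M[R]_n :=
  match alg with
  | RGrad => rgrad_iter H Omega X X0
  | RestartedRCG kappa1 kappa2 => rcg_iter H Omega X X0 kappa1 kappa2
  end.

Definition valid_parameters (R : realType) (alg : algorithm R) : Prop :=
  match alg with
  | RGrad => True
  | RestartedRCG kappa1 kappa2 =>
      [/\ 0 <= kappa1, 0 <= kappa2 & kappa1 * kappa2 < 3^-1]
  end.

Definition rcg_tau1 (R : realType) (kappa1 kappa2 eps0 : R) : R :=
  (18 * eps0 - 10 * kappa1 * eps0 * (1 + 4 * eps0))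
    / ((1 - 4 * eps0) - kappa1 * (1 + 4 * eps0))
  + (4 * kappa2 * eps0 + kappa1 * kappa2) / (1 - 4 * eps0).

Definition rcg_tau2 (R : realType) (kappa1 kappa2 eps0 : R) : R :=
  (8 * kappa2 * eps0 + 2 * kappa1 * kappa2) / (1 - 4 * eps0).

Definition admissible (R : realType) (alg : algorithm R) (eps0 : R) : Prop :=
  match alg with
  | RGrad => [/\ 0 < eps0, eps0 < 4^-1 & 18 * eps0 / (1 - 4 * eps0) < 1]
  | RestartedRCG kappa1 kappa2 =>
      [/\ 0 < eps0, 0 < (1 - 4 * eps0) - kappa1 * (1 + 4 * eps0)
        & rcg_tau1 kappa1 kappa2 eps0 + rcg_tau2 kappa1 kappa2 eps0 < 1]
  end.

(* Probability of E when the m indices are independent and uniformly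
   distributed on {1, ..., n}^2: product of m uniform laws. *)
Definition iid_uniform_prob (R : realType) n m
    (E : set (m.-tuple ('I_n * 'I_n))) : R :=
  \sum_(w : m.-tuple ('I_n * 'I_n) | `[< E w >])
    \prod_(k < m) (#|{: 'I_n * 'I_n}|%:R)^-1.

(* Main.v *)
(* Each of the three random ingredients (the spectral error of the first group,
   the gradient error of each resampled step on the tangent space, and the
   restricted isometry property of the whole sample on the tangent space at X)
   is a sum of independent rank-one positive semidefinite matrices, to which one
   matrix Chernoff bound applies.  It is proved by bounding trace moments with
   exchangeable pairs: replacing one sample by an independent copy and applying
   the mean value inequality
   tr((A - B)(A^(2q+1) - B^(2q+1))) <= (2q+1)/2 tr((A - B)^2 (A^(2q) + B^(2q)))
   gives a recursion in the order of the moment.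

   The thresholded first estimate is within sigma_min / (2048 kappa^2) of X and
   each trimmed resampled step divides the error by 8, so after L steps the error
   is so small that the trivial bound |P_Omega| <= m carries the restricted
   isometry from the tangent space at X to the one at the current iterate.
   There the steplength formulas give a step close to the tangent part of the
   error, up to a factor kappa1 + O(eps0) < 1, and hard thresholding, by
   Eckart-Young and an explicit rank-r retraction, only adds a second-order
   error, so the iterates converge linearly. *)
Require Import Defs.
From HB Require Import structures.
From mathcomp Require Import all_boot all_order all_algebra.
From mathcomp Require Import all_classical all_reals all_analysis.
From mathcomp Require Import perm complex ring lra.

Set Implicit Arguments.
Unset Strict Implicit.
Unset Printing Implicit Defensive.

Import Order.TTheory GRing.Theory Num.Theory.
Import numFieldNormedType.Exports.

Local Open Scope classical_set_scope.
Local Open Scope ring_scope.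

(** Probabilities are handled as counts of tuples: each bad event is bounded by the number of all
    tuples times a small number, and the division is done once, at the end. The errors to control
    need not be symmetric forms; where necessary, extra coordinates are appended to the vectors a so
    that the error becomes an off-diagonal block of the sum of a a^T. The inputs of the
    concentration bound are then a uniform bound K on |a|^2 and a bound B on the mean form. Trimming
    exists for the sake of K: it keeps the factors of an iterate incoherent, hence the entries of
    the error E of order c |E| with c = sqrt(mu0 r / n). Its price is a factor 8 kappa in the error,
    which each step has to win back; this is why the accuracy demanded of a resampled step is
    proportional to 1 / kappa. Second-order smallness always has one source: if Y is near X, the
    component of X normal to the tangent space at Y contains a subspace gap of size |X - Y| /
    sigma_min multiplied by another factor of size |X - Y|. *)

HB.lock Definition ker_proj {R : realType} p k (U : 'M[R]_(p, k)) : 'M[R]_p :=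
  1%:M - U *m U^T.
Arguments ker_proj {R p k} U : rename.

(** * Frobenius inner product *)

Section Frobenius.
Context {R : realType}.

Lemma frob_dotE p q (A B : 'M[R]_(p, q)) : frob_dot A B = \tr (A^T *m B).
Proof.
rewrite /frob_dot /mxtrace exchange_big; apply: eq_bigr => j _.
by rewrite !mxE; apply: eq_bigr => i _; rewrite !mxE.
Qed.

Lemma frob_dotC p q (A B : 'M[R]_(p, q)) : frob_dot A B = frob_dot B A.
Proof. by rewrite !frob_dotE -mxtrace_tr trmx_mul trmxK. Qed.

Lemma frob_dotDl p q (A B C : 'M[R]_(p, q)) :
  frob_dot (A + B) C = frob_dot A C + frob_dot B C.
Proof. by rewrite !frob_dotE linearD mulmxDl linearD. Qed.

Lemma frob_dotZl p q a (A C : 'M[R]_(p, q)) :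
  frob_dot (a *: A) C = a * frob_dot A C.
Proof. by rewrite !frob_dotE linearZ -scalemxAl linearZ. Qed.

Lemma frob_dotNl p q (A C : 'M[R]_(p, q)) : frob_dot (- A) C = - frob_dot A C.
Proof. by rewrite -scaleN1r frob_dotZl mulN1r. Qed.

Lemma frob_dotBl p q (A B C : 'M[R]_(p, q)) :
  frob_dot (A - B) C = frob_dot A C - frob_dot B C.
Proof. by rewrite frob_dotDl frob_dotNl. Qed.

Lemma frob_dot0l p q (C : 'M[R]_(p, q)) : frob_dot 0 C = 0.
Proof. by rewrite -(subrr C) frob_dotBl subrr. Qed.

Lemma frob_dotDr p q (A B C : 'M[R]_(p, q)) :
  frob_dot C (A + B) = frob_dot C A + frob_dot C B.
Proof. by rewrite ![frob_dot C _]frob_dotC frob_dotDl. Qed.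

Lemma frob_dotZr p q a (A C : 'M[R]_(p, q)) :
  frob_dot C (a *: A) = a * frob_dot C A.
Proof. by rewrite ![frob_dot C _]frob_dotC frob_dotZl. Qed.

Lemma frob_dotNr p q (A C : 'M[R]_(p, q)) : frob_dot C (- A) = - frob_dot C A.
Proof. by rewrite ![frob_dot C _]frob_dotC frob_dotNl. Qed.

Lemma frob_dotBr p q (A B C : 'M[R]_(p, q)) :
  frob_dot C (A - B) = frob_dot C A - frob_dot C B.
Proof. by rewrite ![frob_dot C _]frob_dotC frob_dotBl. Qed.

Lemma frob_dot0r p q (C : 'M[R]_(p, q)) : frob_dot C 0 = 0.
Proof. by rewrite frob_dotC frob_dot0l. Qed.

Lemma frob_dot_suml p q (I : Type) (s : seq I) (P : pred I)
    (F : I -> 'M[R]_(p, q)) C :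
  frob_dot (\sum_(i <- s | P i) F i) C = \sum_(i <- s | P i) frob_dot (F i) C.
Proof.
apply: (big_morph (fun A => frob_dot A C)) => [A B|];
  by rewrite (frob_dotDl, frob_dot0l).
Qed.

Lemma frob_dot_sumr p q (I : Type) (s : seq I) (P : pred I)
    (F : I -> 'M[R]_(p, q)) C :
  frob_dot C (\sum_(i <- s | P i) F i) = \sum_(i <- s | P i) frob_dot C (F i).
Proof. by rewrite frob_dotC frob_dot_suml; apply: eq_bigr => i _; rewrite frob_dotC. Qed.

Lemma frob_dot_mull p q k (A : 'M[R]_(p, k)) (B : 'M[R]_(k, q)) C :
  frob_dot (A *m B) C = frob_dot B (A^T *m C).
Proof. by rewrite !frob_dotE trmx_mul mulmxA. Qed.

Lemma frob_dot_mulr p q k (A : 'M[R]_(p, k)) (B : 'M[R]_(k, q)) C :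
  frob_dot (A *m B) C = frob_dot A (C *m B^T).
Proof. by rewrite !frob_dotE trmx_mul -mulmxA mxtrace_mulC mulmxA. Qed.

Lemma frob_dot_tr p q (A B : 'M[R]_(p, q)) : frob_dot A^T B^T = frob_dot A B.
Proof. by rewrite !frob_dotE trmxK mxtrace_mulC -mxtrace_tr trmx_mul trmxK. Qed.

Lemma frob_dot_ge0 p q (A : 'M[R]_(p, q)) : 0 <= frob_dot A A.
Proof. by apply: sumr_ge0 => i _; apply: sumr_ge0 => j _; rewrite -expr2 sqr_ge0. Qed.

Lemma frob_dot_eq0 p q (A : 'M[R]_(p, q)) : (frob_dot A A == 0) = (A == 0).
Proof.
apply/eqP/eqP => [|->]; last exact: frob_dot0l.
move=> /psumr_eq0P/= h; apply/matrixP => i j; rewrite mxE.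
have /psumr_eq0P/= := h (fun i _ => sumr_ge0 _ (fun j _ => sqr_ge0 _)) i isT.
move=> /(_ (fun j _ => sqr_ge0 _) j isT) /eqP.
by rewrite mulf_eq0 orbb => /eqP.
Qed.

Lemma frob_norm_ge0 p q (A : 'M[R]_(p, q)) : 0 <= frob_norm A.
Proof. exact: sqrtr_ge0. Qed.

Lemma frob_norm_sqr p q (A : 'M[R]_(p, q)) : frob_norm A ^+ 2 = frob_dot A A.
Proof. by rewrite sqr_sqrtr // frob_dot_ge0. Qed.

Lemma frob_norm_eq0 p q (A : 'M[R]_(p, q)) : (frob_norm A == 0) = (A == 0).
Proof. by rewrite -frob_dot_eq0 -frob_norm_sqr sqrf_eq0. Qed.

Lemma frob_norm0 p q : frob_norm (0 : 'M[R]_(p, q)) = 0.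
Proof. by apply/eqP; rewrite frob_norm_eq0. Qed.

Lemma frob_norm_gt0 p q (A : 'M[R]_(p, q)) : (0 < frob_norm A) = (A != 0).
Proof. by rewrite lt0r frob_norm_ge0 andbT frob_norm_eq0. Qed.

Lemma frob_norm_le p q (A : 'M[R]_(p, q)) c : 0 <= c ->
  (frob_norm A <= c) = (frob_dot A A <= c ^+ 2).
Proof. by move=> c0; rewrite -frob_norm_sqr ler_pXn2r // nnegrE frob_norm_ge0. Qed.

Lemma frob_norm_ler p q p' q' (A : 'M[R]_(p, q)) (B : 'M[R]_(p', q')) :
  (frob_norm A <= frob_norm B) = (frob_dot A A <= frob_dot B B).
Proof. by rewrite frob_norm_le ?frob_norm_ge0 // frob_norm_sqr. Qed.

Lemma frob_normZ p q a (A : 'M[R]_(p, q)) : frob_norm (a *: A) = `|a| * frob_norm A.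
Proof.
by rewrite /frob_norm frob_dotZl frob_dotZr mulrA -expr2 sqrtrM ?sqr_ge0 // sqrtr_sqr.
Qed.

Lemma frob_normN p q (A : 'M[R]_(p, q)) : frob_norm (- A) = frob_norm A.
Proof. by rewrite -scaleN1r frob_normZ normrN normr1 mul1r. Qed.

Lemma frob_norm_tr p q (A : 'M[R]_(p, q)) : frob_norm A^T = frob_norm A.
Proof. by rewrite /frob_norm frob_dot_tr. Qed.

Lemma frob_CS p q (A B : 'M[R]_(p, q)) : `|frob_dot A B| <= frob_norm A * frob_norm B.
Proof.
have [->|B0] := eqVneq B 0; first by rewrite frob_dot0r normr0 frob_norm0 mulr0.
have b0 : 0 < frob_dot B B by rewrite lt0r frob_dot_eq0 B0 frob_dot_ge0.
rewrite -(@ler_pXn2r _ 2) ?nnegrE ?mulr_ge0 ?frob_norm_ge0 //.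
rewrite exprMn !frob_norm_sqr real_normK ?num_real //.
have := frob_dot_ge0 (frob_dot B B *: A - frob_dot A B *: B).
rewrite !(frob_dotBl, frob_dotBr, frob_dotZl, frob_dotZr) (frob_dotC B A).
set x := frob_dot A B; set a := frob_dot A A; move: b0; set b := frob_dot B B.
move=> b0; have -> : b * (b * a - x * x) - x * (b * x - x * b) = b * (a * b - x ^+ 2) by ring.
by rewrite pmulr_rge0 // subr_ge0.
Qed.

Lemma frob_dot_le p q (A B : 'M[R]_(p, q)) : frob_dot A B <= frob_norm A * frob_norm B.
Proof. exact: le_trans (ler_norm _) (frob_CS A B). Qed.

Lemma frob_normD p q (A B : 'M[R]_(p, q)) : frob_norm (A + B) <= frob_norm A + frob_norm B.
Proof.
rewrite frob_norm_le ?addr_ge0 ?frob_norm_ge0 // sqrrD !frob_norm_sqr.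
rewrite frob_dotDl !frob_dotDr (frob_dotC B A).
have := frob_dot_le A B; lra.
Qed.

Lemma frob_normB p q (A B : 'M[R]_(p, q)) : frob_norm (A - B) <= frob_norm A + frob_norm B.
Proof. by rewrite -(frob_normN B) frob_normD. Qed.

Lemma frob_norm_distC p q (A B : 'M[R]_(p, q)) : frob_norm (A - B) = frob_norm (B - A).
Proof. by rewrite -frob_normN opprB. Qed.

(** Converts a bound on a bilinear form into a bound on a norm; the decisive test matrix is A
    itself. *)
Lemma frob_norm_dual p q (A : 'M[R]_(p, q)) c : 0 <= c ->
  (forall B, frob_dot A B <= c * frob_norm B) -> frob_norm A <= c.
Proof.
move=> c0 /(_ A); rewrite -frob_norm_sqr expr2.
have [->|A0] := eqVneq A 0; first by rewrite frob_norm0.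
by rewrite ler_pM2r // frob_norm_gt0.
Qed.

Lemma frob_norm_row p q (A : 'M[R]_(p, q)) i :
  frob_norm (row i A) = frob_norm (A^T *m delta_mx i 0 : 'cV_q).
Proof. by rewrite -colE -tr_row frob_norm_tr. Qed.

Lemma frob_norm_delta p q i j : frob_norm (delta_mx i j : 'M[R]_(p, q)) = 1.
Proof.
rewrite -[RHS](sqrtr1 R); congr Num.sqrt; rewrite /frob_dot (bigD1 i) //= (bigD1 j) //=.
rewrite !mxE !eqxx mulr1 !big1 ?addr0 // => [l li|l li].
  by apply: big1 => l' _; rewrite !mxE (negbTE li) mul0r.
by rewrite !mxE (negbTE li) andbF mul0r.
Qed.

Lemma frob_dot_delta p q (A : 'M[R]_(p, q)) i j : frob_dot A (delta_mx i j) = A i j.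
Proof.
rewrite /frob_dot (bigD1 i) //= (bigD1 j) //= !mxE !eqxx mulr1 !big1 ?addr0 // => k ki.
  by apply: big1 => l _; rewrite !mxE (negbTE ki) mulr0.
by rewrite !mxE (negbTE ki) andbF mulr0.
Qed.

Lemma entry_le p q (A : 'M[R]_(p, q)) i j : `|A i j| <= frob_norm A.
Proof.
rewrite -frob_dot_delta; apply: le_trans (frob_CS _ _) _.
by rewrite frob_norm_delta mulr1.
Qed.

Lemma frob_dot_rows p q (A B : 'M[R]_(p, q)) :
  frob_dot A B = \sum_i frob_dot (row i A) (row i B).
Proof.
apply: eq_bigr => i _; rewrite /frob_dot big_ord1.
by apply: eq_bigr => j _; rewrite !mxE.
Qed.

Lemma isometry_dot p k q (U : 'M[R]_(p, k)) (A B : 'M[R]_(k, q)) :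
  U^T *m U = 1%:M -> frob_dot (U *m A) (U *m B) = frob_dot A B.
Proof. by move=> UU; rewrite frob_dot_mull mulmxA UU mul1mx. Qed.

Lemma isometry_norm p k q (U : 'M[R]_(p, k)) (A : 'M[R]_(k, q)) :
  U^T *m U = 1%:M -> frob_norm (U *m A) = frob_norm A.
Proof. by move=> UU; rewrite /frob_norm isometry_dot. Qed.

Lemma isometryr_norm p k q (U : 'M[R]_(p, k)) (A : 'M[R]_(q, k)) :
  U^T *m U = 1%:M -> frob_norm (A *m U^T) = frob_norm A.
Proof. by move=> UU; rewrite -frob_norm_tr trmx_mul trmxK isometry_norm // frob_norm_tr. Qed.

Lemma proj_norm_le p q (P : 'M[R]_p) (A : 'M[R]_(p, q)) :
  P^T = P -> P *m P = P -> frob_norm (P *m A) <= frob_norm A.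
Proof.
move=> Pt PP; rewrite frob_norm_ler.
have := frob_dot_ge0 (A - P *m A).
rewrite frob_dotBl !frob_dotBr (frob_dotC A (P *m A)).
have -> : frob_dot (P *m A) (P *m A) = frob_dot (P *m A) A.
  by rewrite frob_dot_mull Pt mulmxA PP frob_dotC.
lra.
Qed.

Lemma projr_norm_le p q (P : 'M[R]_p) (A : 'M[R]_(q, p)) :
  P^T = P -> P *m P = P -> frob_norm (A *m P) <= frob_norm A.
Proof.
by move=> Pt PP; rewrite -frob_norm_tr trmx_mul Pt -(frob_norm_tr A) proj_norm_le.
Qed.

Definition ran_proj p k (U : 'M[R]_(p, k)) : 'M[R]_p := U *m U^T.

Lemma ker_projE p k (U : 'M[R]_(p, k)) : ker_proj U = 1%:M - ran_proj U.
Proof. by rewrite ker_proj.unlock. Qed.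

Lemma ran_proj_tr p k (U : 'M[R]_(p, k)) : (ran_proj U)^T = ran_proj U.
Proof. by rewrite /ran_proj trmx_mul trmxK. Qed.

Lemma ker_proj_tr p k (U : 'M[R]_(p, k)) : (ker_proj U)^T = ker_proj U.
Proof. by rewrite ker_projE linearB /= ran_proj_tr trmx1. Qed.

Section Orthonormal.
Variables (p k : nat) (U : 'M[R]_(p, k)).
Hypothesis UU : U^T *m U = 1%:M.

Lemma ran_projK : ran_proj U *m U = U.
Proof. by rewrite /ran_proj -mulmxA UU mulmx1. Qed.

Lemma ran_proj_idem : ran_proj U *m ran_proj U = ran_proj U.
Proof. by rewrite {2}/ran_proj mulmxA ran_projK. Qed.

Lemma ker_proj0 : ker_proj U *m U = 0.
Proof. by rewrite ker_projE mulmxBl mul1mx ran_projK subrr. Qed.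

Lemma ker_proj_idem : ker_proj U *m ker_proj U = ker_proj U.
Proof. by rewrite {2}ker_projE mulmxBr mulmx1 mulmxA ker_proj0 mul0mx subr0. Qed.

Lemma tr_ker_proj0 : U^T *m ker_proj U = 0.
Proof. by rewrite -[LHS]trmxK trmx_mul trmxK ker_proj_tr ker_proj0 trmx0. Qed.

Lemma ran_proj_norm q (A : 'M[R]_(p, q)) : frob_norm (ran_proj U *m A) <= frob_norm A.
Proof. exact: proj_norm_le (ran_proj_tr U) ran_proj_idem. Qed.

Lemma ker_proj_norm q (A : 'M[R]_(p, q)) : frob_norm (ker_proj U *m A) <= frob_norm A.
Proof. exact: proj_norm_le (ker_proj_tr U) ker_proj_idem. Qed.

Lemma ran_projr_norm q (A : 'M[R]_(q, p)) : frob_norm (A *m ran_proj U) <= frob_norm A.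
Proof. exact: projr_norm_le (ran_proj_tr U) ran_proj_idem. Qed.

Lemma ker_projr_norm q (A : 'M[R]_(q, p)) : frob_norm (A *m ker_proj U) <= frob_norm A.
Proof. exact: projr_norm_le (ker_proj_tr U) ker_proj_idem. Qed.

Lemma coisometry_norm q (A : 'M[R]_(p, q)) : frob_norm (U^T *m A) <= frob_norm A.
Proof. by rewrite -(isometry_norm (U^T *m A) UU) mulmxA ran_proj_norm. Qed.

Lemma coisometryr_norm q (A : 'M[R]_(q, p)) : frob_norm (A *m U) <= frob_norm A.
Proof. by rewrite -(isometryr_norm (A *m U) UU) -mulmxA ran_projr_norm. Qed.

End Orthonormal.

Lemma frob_norm_mul p q k (A : 'M[R]_(p, q)) (B : 'M[R]_(q, k)) :
  frob_norm (A *m B) <= frob_norm A * frob_norm B.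
Proof.
rewrite frob_norm_le ?mulr_ge0 ?frob_norm_ge0 // exprMn !frob_norm_sqr.
have E i j : (A *m B) i j = frob_dot (row i A)^T (col j B).
  rewrite mxE /frob_dot; apply: eq_bigr => l _.
  by rewrite big_ord1 !mxE.
have CS i j : (A *m B) i j * (A *m B) i j <= frob_norm (row i A)^T ^+ 2 * frob_norm (col j B) ^+ 2.
  rewrite E -expr2 -(real_normK (num_real _)) -exprMn lerXn2r ?nnegrE ?mulr_ge0 ?frob_norm_ge0 //.
  exact: frob_CS.
apply: le_trans (ler_sum _ (fun i _ => ler_sum _ (fun j _ => CS i j))) _.
rewrite le_eqVlt; apply/orP; left; apply/eqP.
have -> : frob_dot A A = \sum_i frob_norm (row i A)^T ^+ 2.
  apply: eq_bigr => i _; rewrite frob_norm_sqr /frob_dot; apply: eq_bigr => j _.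
  by rewrite big_ord1 !mxE.
have -> : frob_dot B B = \sum_i frob_norm (col i B) ^+ 2.
  rewrite /frob_dot exchange_big; apply: eq_bigr => i _; rewrite frob_norm_sqr /frob_dot; apply: eq_bigr => j _.
  by rewrite big_ord1 !mxE.
rewrite mulr_suml; apply: eq_bigr => i _.
by rewrite mulr_sumr.
Qed.

End Frobenius.

(** * Symmetric matrices and trace inequalities *)

Section Spectral.
Context {R : realType}.

(** Over the complex numbers the matrix is Hermitian, so its spectrum is real; a real root of the
    complex characteristic polynomial is a root of the real one. *)
Lemma symmetric_eigenvalue n (A : 'M[R]_n.+1) : A^T = A -> exists a, eigenvalue A a.
Proof.
move=> At; pose Ac := map_mx (real_complex R) A.
have Ah : Ac \is hermsymmx.
  apply: realsym_hermsym.
    apply/is_hermitianmxP; rewrite expr0 scale1r -map_trmx.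
    by rewrite map_mx_id // /Ac map_trmx At.
  apply/mxOverP => i j; rewrite mxE.
  by apply/complex_realP; exists (A i j).
pose a := spectral_diag Ac 0 0.
have [b ab] : exists b, a = real_complex R b.
  apply/complex_realP.
  by have /mxOverP := hermitian_spectral_diag_real Ah; apply.
exists b; rewrite eigenvalue_root_char -(fmorph_root (real_complex R)) map_char_poly.
suff: eigenvalue Ac a by rewrite ab eigenvalue_root_char.
apply/eigenvalueP.
have Pu := spectral_unit Ac.
exists (row 0 (spectralmx Ac)); last first.
  apply/eqP => r0.
  have /eqP := congr1 (fun r => r *m invmx (spectralmx Ac)) r0.
  rewrite -row_mul mulmxV // mul0mx => /eqP/rowP/(_ 0).
  by rewrite !mxE => /eqP; rewrite oner_eq0.
have /hermitian_normalmx/orthomx_spectralP := Ah.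
move/(congr1 (mulmx (spectralmx Ac))).
rewrite !mulmxA mulmxV // mul1mx -row_mul => /= ->.
by rewrite row_mul row_diag_mx -scalemxAl -rowE.
Qed.

(** If v differs from the first basis vector e, the reflection 1 - 2 u u^T / |u|^2 with u = v - e
    exchanges these two unit vectors. It supplies the orthogonal change of basis that puts an
    eigenvector first. *)
Lemma householder n (v : 'cV[R]_n.+1) : frob_dot v v = 1 ->
  exists Q : 'M[R]_n.+1, Q^T *m Q = 1%:M /\ Q *m delta_mx 0 0 = v.
Proof.
move=> v1; pose e : 'cV[R]_n.+1 := delta_mx 0 0.
have [->|ve] := eqVneq v e; first by exists 1%:M; rewrite trmx1 mulmx1 mul1mx.
pose u := v - e.
have ee : frob_dot e e = 1.
  rewrite /frob_dot (bigD1 0) //= big_ord1 !mxE eqxx mulr1 big1 ?addr0 // => i i0.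
  by rewrite big_ord1 !mxE (negbTE i0) mul0r.
have uu : frob_dot u u = -2 * frob_dot u e.
  by rewrite /u !(frob_dotBl, frob_dotBr) v1 ee (frob_dotC e v); ring.
have u0 : frob_dot u u != 0 by rewrite frob_dot_eq0 subr_eq0.
have dotM (x y : 'cV[R]_n.+1) : x^T *m y = (frob_dot x y)%:M.
  by rewrite frob_dotE [LHS]mx11_scalar /mxtrace big_ord1.
pose c := 2 / frob_dot u u.
exists (1%:M - c *: (u *m u^T)); split.
  have -> : (1%:M - c *: (u *m u^T))^T = 1%:M - c *: (u *m u^T).
    by rewrite linearB /= trmx1 linearZ /= trmx_mul trmxK.
  rewrite mulmxBl mul1mx !mulmxBr mulmx1 -!scalemxAl -!scalemxAr.
  rewrite mulmxA -(mulmxA u) dotM mul_mx_scalar -scalemxAl !scalerA.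
  have -> : c * (c * frob_dot u u) = c + c by rewrite /c; field.
  rewrite scalerDl; set t := c *: _.
  have -> : t - (t + t) = - t by rewrite opprD addrA subrr sub0r.
  by rewrite opprK subrK.
rewrite -/e mulmxBl mul1mx -scalemxAl -mulmxA dotM mul_mx_scalar scalerA.
have -> : c * frob_dot u e = -1.
  by move: u0; rewrite /c uu => u0; field; move: u0; rewrite mulf_eq0 negb_or => /andP[].
by rewrite scaleN1r opprK addrC subrK.
Qed.

(** Deflation: once an eigenvector is rotated to the first basis vector, the first column is a
    multiple of that vector, symmetry clears the first row, and induction treats the remaining
    block. *)
Lemma spectral_theorem n (A : 'M[R]_n) : A^T = A ->
  exists (U : 'M[R]_n) (d : 'rV[R]_n), U^T *m U = 1%:M /\ A = U *m diag_mx d *m U^T.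
Proof.
elim: n A => [|n IH] A At.
  by exists 1%:M, 0; rewrite trmx1 mulmx1; split => //; apply/matrixP => -[].
have [a /eigenvalueP[v vA v0]] := symmetric_eigenvalue At.
pose w := (frob_norm v)^-1 *: v^T.
have w1 : frob_dot w w = 1.
  rewrite -frob_norm_sqr frob_normZ frob_norm_tr normfV ger0_norm ?frob_norm_ge0 //.
  by rewrite mulVf ?expr1n // frob_norm_eq0.
have Aw : A *m w = a *: w.
  by rewrite -scalemxAr -{1}At -trmx_mul vA linearZ /= scalerA mulrC -scalerA.
have [Q [QQ Qw]] := householder w1.
have QQ' := mulmx1C QQ.
pose B : 'M[R]_(1 + n) := Q^T *m A *m Q.
have Bt : B^T = B by rewrite /B !trmx_mul trmxK At mulmxA.
have B0 : B *m delta_mx 0 0 = a *: delta_mx 0 0 :> 'cV[R]_(1 + n).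
  by rewrite /B -!mulmxA Qw Aw -scalemxAr -Qw mulmxA QQ mul1mx.
have Bc i : B i 0 = a * (i == 0)%:R.
  have := congr1 (fun M : 'cV[R]_(1 + n) => M i 0) B0.
  by rewrite -colE !mxE eqxx andbT.
have Bul : ulsubmx B = a%:M.
  have ulE (M : 'M[R]_(1 + n)) i j : ulsubmx M i j = M (lshift n i) (lshift n j).
    by rewrite !mxE.
  apply/matrixP => i j; rewrite !ord1 ulE [RHS]mxE eqxx mulr1n.
  by have := Bc 0; rewrite eqxx mulr1 => <-; congr (B _ _); apply/val_inj.
have Bdl : dlsubmx B = 0.
  have dlE (M : 'M[R]_(1 + n)) i j : dlsubmx M i j = M (rshift 1 i) (lshift n j).
    by rewrite !mxE.
  apply/matrixP => i j; rewrite !ord1 dlE [RHS]mxE.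
  transitivity (B (rshift 1 i) 0); first by congr (B _ _); apply/val_inj.
  by rewrite Bc mulr0.
have Bur : ursubmx B = 0 by rewrite -Bt -trmx_dlsub Bdl trmx0.
have [U [d [UU BE]]] := IH (drsubmx B) (etrans (trmx_drsub B) (congr1 drsubmx Bt)).
pose V : 'M[R]_(1 + n) := block_mx 1%:M 0 0 U.
have Vt : V^T = block_mx 1%:M 0 0 U^T by rewrite tr_block_mx trmx1 !trmx0.
have VV : V^T *m V = 1%:M.
  rewrite Vt mulmx_block !mul0mx !mulmx0 !mulmx1 !addr0 !add0r UU.
  by rewrite -scalar_mx_block.
have BV : B = V *m diag_mx (row_mx a%:M d) *m V^T.
  have -> : diag_mx (row_mx a%:M d : 'rV[R]_(1 + n)) = block_mx a%:M 0 0 (diag_mx d).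
    by rewrite diag_mx_row; congr block_mx; apply/matrixP => i j; rewrite !ord1 !mxE.
  rewrite -[LHS]submxK Bul Bur Bdl BE Vt !mulmx_block.
  by rewrite !(mul0mx, mulmx0, mulmx1, mul1mx, addr0, add0r).
have AE : A = Q *m B *m Q^T by rewrite /B !mulmxA QQ' mul1mx -mulmxA QQ' mulmx1.
exists (Q *m (V : 'M[R]_n.+1)), (row_mx a%:M d); split.
  by rewrite trmx_mul mulmxA -(mulmxA _ Q^T) QQ mulmx1.
by rewrite AE BV trmx_mul !mulmxA.
Qed.

End Spectral.

Section MeanValueTrace.
Context {R : realType}.

Lemma expr_rearrangement (a b : R) i j : 0 <= a -> 0 <= b ->
  a ^+ i * b ^+ j + a ^+ j * b ^+ i <= a ^+ (i + j) + b ^+ (i + j).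
Proof.
wlog ab : a b / a <= b.
  move=> h a0 b0; have [ab|/ltW ba] := lerP a b; first exact: h.
  rewrite [leRHS]addrC; have := h _ _ ba b0 a0.
  by lra.
move=> a0 b0; rewrite !exprD -subr_ge0.
have -> : a ^+ i * a ^+ j + b ^+ i * b ^+ j - (a ^+ i * b ^+ j + a ^+ j * b ^+ i)
   = (b ^+ i - a ^+ i) * (b ^+ j - a ^+ j) by ring.
by rewrite mulr_ge0 // subr_ge0 lerXn2r // nnegrE.
Qed.

(** The geometric sum in a^(2q+1) - b^(2q+1) is paired with its own reversal, and each pair is
    bounded by the rearrangement inequality for |a| and |b|; the even exponent 2q removes the
    absolute values. *)
Lemma mean_value_expr (a b : R) q :
  (a - b) * (a ^+ q.*2.+1 - b ^+ q.*2.+1)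
    <= q.*2.+1%:R / 2 * ((a - b) ^+ 2 * (a ^+ q.*2 + b ^+ q.*2)).
Proof.
rewrite subrXX mulrA -expr2 mulrCA ler_wpM2l ?sqr_ge0 //.
set s := \sum_(i < _) _.
have ss : s = \sum_(i < q.*2.+1) a ^+ i * b ^+ (q.*2 - i).
  rewrite /s (reindex_inj rev_ord_inj) /=; apply: eq_bigr => i _.
  by rewrite subSS subKn // -ltnS.
suff : s + s <= q.*2.+1%:R * (a ^+ q.*2 + b ^+ q.*2) by lra.
rewrite {2}ss /s -big_split /=.
have -> : q.*2.+1%:R * (a ^+ q.*2 + b ^+ q.*2)
    = \sum_(i < q.*2.+1) (a ^+ q.*2 + b ^+ q.*2).
  by rewrite sumr_const card_ord mulr_natl.
apply: ler_sum => i _.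
have iq : (q.*2 - i + i = q.*2)%N by rewrite subnK // -ltnS.
have ev (x : R) : x ^+ q.*2 = `|x| ^+ q.*2.
  by rewrite -!mul2n !exprM real_normK ?num_real.
apply: le_trans (ler_norm _) _; apply: le_trans (ler_normD _ _) _.
rewrite !normrM !normrX (ev a) (ev b).
by have := expr_rearrangement (q.*2 - i) i (normr_ge0 a) (normr_ge0 b); rewrite iq.
Qed.

Lemma spectral_expr n (U : 'M[R]_n) d k : U^T *m U = 1%:M ->
  (U *m diag_mx d *m U^T) ^+ k = U *m diag_mx (map_mx (fun x => x ^+ k) d) *m U^T.
Proof.
move=> UU; elim: k => [|k IH].
  rewrite expr0; have -> : map_mx (fun x => x ^+ 0) d = const_mx 1.
    by apply/rowP => i; rewrite !mxE expr0.
  by rewrite diag_const_mx mulmx1 (mulmx1C UU).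
rewrite exprS IH -mulmxE !mulmxA -(mulmxA _ U^T) UU mulmx1 -(mulmxA U) mulmx_diag.
by congr (U *m diag_mx _ *m U^T); apply/rowP => i; rewrite !mxE exprS.
Qed.

(** The weights [(U^T *m V) i j ^+ 2] are nonnegative, so a scalar inequality in the eigenvalues a_i
    and b_j lifts to traces although the two matrices need not commute. *)
Lemma spectral_trace n (U V : 'M[R]_n) a b k l :
    U^T *m U = 1%:M -> V^T *m V = 1%:M ->
  \tr ((U *m diag_mx a *m U^T) ^+ k *m (V *m diag_mx b *m V^T) ^+ l)
    = \sum_i \sum_j (U^T *m V) i j ^+ 2 * (a 0 i ^+ k * b 0 j ^+ l).
Proof.
move=> UU VV; rewrite !spectral_expr // -!mulmxA mxtrace_mulC -!mulmxA.
set W := U^T *m V.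
have -> : V^T *m U = W^T by rewrite /W trmx_mul trmxK.
rewrite (mulmxA U^T V) -/W; apply: eq_bigr => i _.
rewrite mul_diag_mx [LHS]mxE [X in _ * X]mxE mulr_sumr; apply: eq_bigr => j _.
by rewrite mul_diag_mx !mxE; ring.
Qed.

Lemma expr_tr n (A : 'M[R]_n) k : A^T = A -> (A ^+ k)^T = A ^+ k.
Proof.
move=> At; elim: k => [|k IH]; first by rewrite expr0 trmx1.
by rewrite exprS -mulmxE trmx_mul IH At mulmxE -exprSr exprS.
Qed.

(** Both sides expand into traces of A^k B^l, since AB and BA have the same trace against a power of
    A or of B; the scalar inequality then applies to each pair of eigenvalues. *)
Lemma mean_value_trace n (A B : 'M[R]_n) q : A^T = A -> B^T = B ->
  frob_dot (A - B) (A ^+ q.*2.+1 - B ^+ q.*2.+1)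
    <= q.*2.+1%:R / 2 * frob_dot ((A - B) *m (A - B)) (A ^+ q.*2 + B ^+ q.*2).
Proof.
move=> At Bt.
have [U [a [UU AE]]] := spectral_theorem At.
have [V [b [VV BE]]] := spectral_theorem Bt.
pose t k l := \tr (A ^+ k *m B ^+ l).
have tE k l : t k l = \sum_i \sum_j (U^T *m V) i j ^+ 2 * (a 0 i ^+ k * b 0 j ^+ l).
  by rewrite /t {1}AE {1}BE spectral_trace.
have fE k l m : frob_dot (A ^+ k) (A ^+ l *m B ^+ m) = t (k + l)%N m.
  by rewrite frob_dotE expr_tr // mulmxA mulmxE -exprD.
have fE' k l m : frob_dot (B ^+ k) (A ^+ l *m B ^+ m) = t l (m + k)%N.
  rewrite frob_dotE expr_tr // mxtrace_mulC -mulmxA /t; congr (\tr (_ *m _)).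
  by rewrite mulmxE -exprD.
have gE k l m : frob_dot (A ^+ k) (B ^+ m *m A ^+ l) = t (k + l)%N m.
  by rewrite -frob_dot_tr trmx_mul !expr_tr // fE.
have gE' k l m : frob_dot (B ^+ k) (B ^+ m *m A ^+ l) = t l (m + k)%N.
  by rewrite -frob_dot_tr trmx_mul !expr_tr // fE'.
have -> : frob_dot (A - B) (A ^+ q.*2.+1 - B ^+ q.*2.+1) =
    t q.*2.+2 0 - t 1%N q.*2.+1 - t q.*2.+1 1%N + t 0 q.*2.+2.
  rewrite frob_dotC !frob_dotBl !frob_dotBr.
  have e1 := fE q.*2.+1 1 0; have e2 := fE q.*2.+1 0 1.
  have e3 := fE' q.*2.+1 1 0; have e4 := fE' q.*2.+1 0 1.
  rewrite !expr1 !expr0 mulmx1 in e1 e3.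
  rewrite !expr1 !expr0 mul1mx in e2 e4.
  by rewrite e1 e2 e3 e4 addn1 addn0 add0n add1n; ring.
have -> : frob_dot ((A - B) *m (A - B)) (A ^+ q.*2 + B ^+ q.*2) =
    (t q.*2.+2 0 - 2 * t q.*2.+1 1 + t q.*2 2)
    + (t 0 q.*2.+2 - 2 * t 1 q.*2.+1 + t 2 q.*2).
  have -> : (A - B) *m (A - B) = A ^+ 2 - A *m B - B *m A + B ^+ 2.
    by rewrite mulmxBl !mulmxBr !expr2 !mulmxE opprB addrA addrAC.
  rewrite frob_dotC !(frob_dotDl, frob_dotDr, frob_dotNr).
  have e1 := fE q.*2 2 0; have e2 := fE q.*2 1 1.
  have e3 := gE q.*2 1 1; have e4 := fE q.*2 0 2.
  have e5 := fE' q.*2 2 0; have e6 := fE' q.*2 1 1.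
  have e7 := gE' q.*2 1 1; have e8 := fE' q.*2 0 2.
  rewrite !expr0 mulmx1 in e1 e5.
  rewrite !expr0 mul1mx in e4 e8.
  rewrite !expr1 in e2 e3 e6 e7.
  by rewrite e1 e2 e3 e4 e5 e6 e7 e8 !addn0 !add0n !addn2 !addn1 !add2n !add1n; ring.
rewrite !tE !mulr_sumr -!sumrN -!big_split /= mulr_sumr.
apply: ler_sum => i _; rewrite !mulr_sumr -!sumrN -!big_split /= mulr_sumr.
apply: ler_sum => j _.
have := mean_value_expr (a 0 i) (b 0 j) q.
have := sqr_ge0 ((U^T *m V) i j).
set w := _ ^+ 2; set x := a 0 i; set y := b 0 j; move=> w0 h.
rewrite !expr0 !expr1 !mulr1 !mul1r.
have := ler_wpM2l w0 h.
rewrite !exprS; set u := x ^+ _; set v := y ^+ _; set c := _ / 2.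
rewrite !expr0; nra.
Qed.

End MeanValueTrace.

(** * Matrix Chernoff bound *)

Section Resampling.
Context {R : realType} (I : finType) (m : nat).
Implicit Types (w : m.-tuple I) (J : {set 'I_m}).

(** The coordinates in J come from w', the others from w. Sending (w, w') to (mix w w', mix w' w) is
    an involution, and this exchangeability expresses independence in the counting arguments. *)
Definition mix J w w' : m.-tuple I :=
  [tuple if k \in J then tnth w' k else tnth w k | k < m].

Lemma mixK J w w' : mix J (mix J w w') (mix J w' w) = w.
Proof.
by apply: eq_from_tnth => k; rewrite !tnth_mktuple; case: (k \in J).
Qed.

Lemma sum_mix (V : nmodType) J (F : m.-tuple I -> m.-tuple I -> V) :
  \sum_w \sum_w' F w w' = \sum_w \sum_w' F (mix J w w') (mix J w' w).
Proof.
rewrite !pair_bigA /= (reindex_inj (h := fun u => (mix J u.1 u.2, mix J u.2 u.1))) //=.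
by apply: (can_inj (g := fun u => (mix J u.1 u.2, mix J u.2 u.1))) => -[w w'] /=; rewrite !mixK.
Qed.

(** Each coordinate of a uniform tuple is uniform: transpositions of I, acting on tuples, make all
    fibres of the k-th coordinate equally large. *)
Lemma sum_tnth (f : I -> R) (k : 'I_m) :
  #|I|%:R * \sum_w f (tnth w k) = #|{: m.-tuple I}|%:R * \sum_x f x.
Proof.
pose c x : R := \sum_(w : m.-tuple I | tnth w k == x) 1.
have cE x y : c x = c y.
  rewrite /c (reindex_inj (h := map_tuple (tperm x y))); last first.
    move=> w w' /(congr1 val)/= /inj_map h; apply: val_inj; apply: h; exact: perm_inj.
  by apply: eq_bigl => w; rewrite tnth_map -(inj_eq (@perm_inj _ (tperm x y))) tpermK tpermL.
have sE (g : I -> R) : \sum_w g (tnth w k) = \sum_x c x * g x.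
  rewrite (partition_big (fun w => tnth w k) xpredT) //=.
  apply: eq_bigr => x _; rewrite mulr_suml; apply: eq_bigr => w /eqP ->.
  by rewrite mul1r.
have := sE (fun=> 1); rewrite sumr_const.
have -> : #|[eta xpredT : pred (m.-tuple I)]| = #|{: m.-tuple I}| by apply: eq_card.
move=> ->; rewrite sE; have [x0 _|I0] := pickP (@predT I); last first.
  by rewrite !big_pred0 ?mulr0 // => x; have := I0 x.
under eq_bigr => x _ do rewrite (cE x x0).
under [in RHS]eq_bigr => x _ do rewrite (cE x x0) mulr1.
by rewrite -mulr_sumr sumr_const cardT -cardE -[c x0 *+ _]mulr_natl mulrA.
Qed.

End Resampling.

(** [frob_dot (S ^+ p) (S ^+ p)] is the sum of the 2p-th powers of the eigenvalues of S and so
    bounds each of them; this is how a trace moment controls the bilinear form. *)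
Lemma sym_op_le (R : realType) n (S : 'M[R]_n) p t (x y : 'cV[R]_n) :
  S^T = S -> 0 <= t -> (0 < p)%N ->
  frob_dot (S ^+ p) (S ^+ p) <= (t ^+ p) ^+ 2 ->
  `|frob_dot x (S *m y)| <= t * frob_norm x * frob_norm y.
Proof.
move=> St t0 p0; have [U [d [UU SE]]] := spectral_theorem St.
have Ud : frob_norm (S ^+ p) = frob_norm (diag_mx (map_mx (fun x => x ^+ p) d)).
  by rewrite SE spectral_expr // isometryr_norm // isometry_norm.
rewrite -frob_norm_sqr Ud frob_norm_sqr => h.
have dt i : d 0 i ^+ 2 <= t ^+ 2.
  rewrite -(real_normK (num_real (d 0 i))) lerXn2r ?nnegrE //.
  rewrite -(ler_pXn2r p0) ?nnegrE // -(@ler_pXn2r _ 2) ?nnegrE ?exprn_ge0 //.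
  apply: le_trans h; rewrite /frob_dot (bigD1 i) //= (bigD1 i) //= !mxE eqxx mulr1n.
  rewrite -normrX real_normK ?num_real // -expr2 -addrA lerDl.
  rewrite addr_ge0 ?sumr_ge0 // => [j _|j _]; first by rewrite -expr2 sqr_ge0.
  by rewrite sumr_ge0 // => k _; rewrite -expr2 sqr_ge0.
apply: le_trans (frob_CS _ _) _; rewrite -mulrA [leRHS]mulrCA ler_wpM2l ?frob_norm_ge0 //.
rewrite SE -!mulmxA isometry_norm //.
have UtU : (U^T)^T *m U^T = 1%:M by rewrite trmxK (mulmx1C UU).
rewrite -(isometry_norm y UtU); set z := U^T *m y.
rewrite frob_norm_le ?mulr_ge0 ?frob_norm_ge0 // exprMn frob_norm_sqr mul_diag_mx.
rewrite /frob_dot mulr_sumr; apply: ler_sum => i _; rewrite !big_ord1 !mxE.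
by rewrite -expr2 exprMn -expr2 ler_wpM2r ?sqr_ge0.
Qed.

Section Moments.
Context {R : realType} (I : finType) (m d : nat).
Variables (a : I -> 'cV[R]_d) (K B : R) (J : {set 'I_m}).
Hypothesis I0 : (0 < #|I|)%N.
Hypothesis B0 : 0 <= B.
Hypothesis K0 : 0 <= K.
Hypothesis aK : forall x, frob_dot (a x) (a x) <= K.
Hypothesis aB : forall v, \sum_x frob_dot (a x) v ^+ 2 <= B * frob_dot v v.

(** For uniform x the matrix [A x] has mean G, so [S w] is a centred sum. The hypotheses bound the
    norm of [A x] by N K and that of G by B. *)
Let N : R := #|I|%:R.
Let M : R := #|{: m.-tuple I}|%:R.
Let A x : 'M[R]_d := N *: (a x *m (a x)^T).
Let G : 'M[R]_d := \sum_x a x *m (a x)^T.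
Let S (w : m.-tuple I) : 'M[R]_d := \sum_(k in J) (A (tnth w k) - G).

Lemma rank1_tr x : (a x *m (a x)^T)^T = a x *m (a x)^T.
Proof. by rewrite trmx_mul trmxK. Qed.

Let A_tr x : (A x)^T = A x.
Proof. by rewrite /A linearZ /= rank1_tr. Qed.

Let G_tr : G^T = G.
Proof. by rewrite /G linear_sum /=; apply: eq_bigr => x _; rewrite rank1_tr. Qed.

Let S_tr w : (S w)^T = S w.
Proof. by rewrite /S linear_sum /=; apply: eq_bigr => x _; rewrite linearB /= A_tr G_tr. Qed.

Let N_gt0 : 0 < N. Proof. by rewrite ltr0n. Qed.

Let M_gt0 : 0 < M.
Proof. by rewrite ltr0n card_tuple expn_gt0 I0. Qed.

Let sum_A k P : \sum_(w : m.-tuple I) frob_dot (A (tnth w k)) P = M * frob_dot G P.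
Proof.
have := sum_tnth (fun x => frob_dot (A x) P) k; rewrite -/N -/M.
have -> : \sum_x frob_dot (A x) P = N * frob_dot G P.
  by rewrite /G frob_dot_suml mulr_sumr; apply: eq_bigr => x _; rewrite frob_dotZl.
rewrite mulrCA => /(mulfI (lt0r_neq0 N_gt0)) ->.
by [].
Qed.

Lemma rank1_dot_sqr x (T : 'M[R]_d) : T^T = T ->
  frob_dot (a x *m (a x)^T) (T *m T) = frob_dot (T *m a x) (T *m a x).
Proof. by move=> Tt; rewrite frob_dot_mulr trmxK -mulmxA frob_dotC frob_dot_mull Tt. Qed.

Let AA_le x T : T^T = T ->
  frob_dot (A x *m A x) (T *m T) <= N * K * frob_dot (A x) (T *m T).
Proof.
move=> Tt.
have -> : A x *m A x = (N * frob_dot (a x) (a x)) *: A x.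
  rewrite /A -scalemxAl -scalemxAr !scalerA mulmxA -(mulmxA (a x)).
  have -> : (a x)^T *m a x = (frob_dot (a x) (a x))%:M.
    by rewrite frob_dotE [LHS]mx11_scalar /mxtrace big_ord1.
  by rewrite mul_mx_scalar -scalemxAl scalerA; congr (_ *: _); ring.
rewrite frob_dotZl ler_wpM2r //.
  by rewrite /A frob_dotZl rank1_dot_sqr // mulr_ge0 ?(ltW N_gt0) ?frob_dot_ge0.
by rewrite ler_wpM2l // ltW.
Qed.

Let G_le T : T^T = T -> frob_dot G (T *m T) <= B * frob_dot T T.
Proof.
move=> Tt; rewrite /G frob_dot_suml.
under eq_bigr => x _ do rewrite rank1_dot_sqr //.
have E (p : nat) (V : 'M[R]_(d, p)) : frob_dot V V = \sum_j frob_dot (col j V) (col j V).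
  rewrite /frob_dot exchange_big; apply: eq_bigr => j _; apply: eq_bigr => i _.
  by rewrite big_ord1 !mxE.
have TE x : frob_dot (T *m a x) (T *m a x) = \sum_j frob_dot (a x) (col j T) ^+ 2.
  rewrite {1}/frob_dot; apply: eq_bigr => j _; rewrite big_ord1 -expr2; congr (_ ^+ 2).
  rewrite mxE /frob_dot; apply: eq_bigr => i _; rewrite big_ord1 !mxE mulrC.
  by rewrite -[in RHS]Tt mxE.
under eq_bigr => x _ do rewrite TE.
rewrite exchange_big /= E mulr_sumr; apply: ler_sum => j _.
exact: aB.
Qed.

Let Phi q : R := \sum_w frob_dot (S w ^+ q) (S w ^+ q).

Let exprK w q : S w ^+ q.*2 = S w ^+ q *m S w ^+ q.
Proof. by rewrite mulmxE -exprD addnn. Qed.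

(** The gap between 2 A^2 + 2 A'^2 and (A - A')^2 is (A + A')^2, which is nonnegative against T^2.
    The squares then reduce to first powers because each A has rank one. *)
Let CC_le x y T : T^T = T ->
  frob_dot ((A x - A y) *m (A x - A y)) (T *m T)
    <= 2 * (N * K) * (frob_dot (A x) (T *m T) + frob_dot (A y) (T *m T)).
Proof.
move=> Tt.
have P0 : 0 <= frob_dot ((A x + A y) *m (A x + A y)) (T *m T).
  have -> : frob_dot ((A x + A y) *m (A x + A y)) (T *m T) =
            frob_dot ((A x + A y) *m T) ((A x + A y) *m T).
    rewrite frob_dot_mull linearD /= !A_tr mulmxA frob_dotC frob_dot_mulr Tt.
    by [].
  exact: frob_dot_ge0.
have := AA_le x Tt; have := AA_le y Tt.
have -> : (A x - A y) *m (A x - A y)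
   = 2 *: (A x *m A x) + 2 *: (A y *m A y) - (A x + A y) *m (A x + A y).
  rewrite !mulmxBl !mulmxBr !mulmxDl !mulmxDr !scaler_nat !mulr2n.
  by apply/matrixP => i j; rewrite !mxE; ring.
rewrite frob_dotBl frob_dotDl !frob_dotZl; lra.
Qed.

Let mixS k w w' : k \in J ->
  S w - S (mix [set k] w w') = A (tnth w k) - A (tnth w' k).
Proof.
move=> kJ; rewrite /S (bigD1 k) //= [X in _ - X](bigD1 k) //=.
rewrite tnth_mktuple inE eqxx.
have -> : \sum_(i in J | i != k) (A (tnth (mix [set k] w w') i) - G)
        = \sum_(i in J | i != k) (A (tnth w i) - G).
  by apply: eq_bigr => i /andP[_ ik]; rewrite tnth_mktuple inE (negbTE ik).
by rewrite opprD addrACA subrr addr0 opprB addrA subrK.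
Qed.

(** Sample k is replaced by an independent copy. The difference C of the two summands changes sign
    under the exchange, so twice the left side pairs C with a difference of powers of two sums. As C
    is also the difference of these sums, the mean value inequality applies, and by exchange both
    even powers contribute equally. *)
Let moment_term q k : k \in J ->
  \sum_w frob_dot (A (tnth w k) - G) (S w ^+ q.*2.+1)
    <= q.*2.+1%:R * (N * K) * \sum_w frob_dot (A (tnth w k) + G) (S w ^+ q.*2).
Proof.
move=> kJ; rewrite -(ler_pM2l M_gt0).
pose C w w' := A (tnth w k) - A (tnth w' k).
pose v (w w' : m.-tuple I) := mix [set k] w w'.
have vk w w' : tnth (v w w') k = tnth w' k by rewrite tnth_mktuple inE eqxx.
have resample (P : m.-tuple I -> 'M[R]_d) s :
    M * \sum_w frob_dot (A (tnth w k) + s *: G) (P w)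
    = \sum_w \sum_w' (frob_dot (A (tnth w k)) (P w) + s * frob_dot (A (tnth w' k)) (P w)).
  rewrite mulr_sumr; apply: eq_bigr => w _.
  rewrite big_split /= -mulr_sumr sum_A sumr_const.
  rewrite (eq_card (B := {: m.-tuple I})) // -mulr_natl -/M frob_dotDl frob_dotZl; ring.
have -> : M * \sum_w frob_dot (A (tnth w k) - G) (S w ^+ q.*2.+1)
    = \sum_w \sum_w' frob_dot (C w w') (S w ^+ q.*2.+1).
  rewrite -scaleN1r resample; apply: eq_bigr => w _; apply: eq_bigr => w' _.
  by rewrite frob_dotBl mulN1r.
set L := (X in X <= _).
have L2 : 2 * L = \sum_w \sum_w' frob_dot (C w w') (S w ^+ q.*2.+1 - S (v w w') ^+ q.*2.+1).
  rewrite mulr2n mulrDl mul1r {2}/L (sum_mix [set k]) /L -big_split /=.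
  apply: eq_bigr => w _; rewrite -big_split /=; apply: eq_bigr => w' _.
  by rewrite -/(v w w') -/(v w' w) /C !vk frob_dotBr -(opprB (A (tnth w k))) frob_dotNl.
have L3 : 2 * L <= \sum_w \sum_w' (q.*2.+1%:R / 2 *
    (frob_dot (C w w' *m C w w') (S w ^+ q.*2) +
     frob_dot (C w w' *m C w w') (S (v w w') ^+ q.*2))).
  rewrite L2; apply: ler_sum => w _; apply: ler_sum => w' _.
  rewrite -frob_dotDr /C -(mixS w w' kJ); exact: mean_value_trace.
have L4 : \sum_w \sum_w' frob_dot (C w w' *m C w w') (S (v w w') ^+ q.*2)
        = \sum_w \sum_w' frob_dot (C w w' *m C w w') (S w ^+ q.*2).
  rewrite [RHS](sum_mix [set k]); apply: eq_bigr => w _; apply: eq_bigr => w' _.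
  rewrite -/(v w w') -/(v w' w) /C !vk -(opprB (A (tnth w k))).
  by rewrite mulmxN mulNmx opprK.
have L5 : \sum_w \sum_w' frob_dot (C w w' *m C w w') (S w ^+ q.*2) <=
    2 * (N * K) * \sum_w \sum_w' (frob_dot (A (tnth w k)) (S w ^+ q.*2)
           + 1 * frob_dot (A (tnth w' k)) (S w ^+ q.*2)).
  rewrite !mulr_sumr; apply: ler_sum => w _; rewrite mulr_sumr; apply: ler_sum => w' _.
  by rewrite mul1r exprK CC_le // expr_tr.
have -> : \sum_w frob_dot (A (tnth w k) + G) (S w ^+ q.*2) =
   \sum_w frob_dot (A (tnth w k) + 1 *: G) (S w ^+ q.*2).
  by apply: eq_bigr => w _; rewrite scale1r.
rewrite [leRHS]mulrCA resample.
move: L3; under eq_bigr => w _ do rewrite -mulr_sumr big_split /=.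
rewrite -mulr_sumr big_split /= L4.
have q0 : 0 <= q.*2.+1%:R :> R by [].
have := ler_wpM2l q0 L5.
set X := \sum_w \sum_w' frob_dot (C w w' *m C w w') _.
set Y := \sum_w \sum_w' _.
lra.
Qed.

(** Summing over k rebuilds S from its summands. The resulting term x <S^(q+1), S^q> is at most a
    quarter of the next moment plus x^2 times the current one; absorbing the quarter on the left
    gives the factor 4/3. *)
Let moment_step q c : q.*2.+1%:R * (N * K) <= c ->
  Phi q.+1 <= 4 / 3 * (c ^+ 2 + 2 * #|J|%:R * B * c) * Phi q.
Proof.
move=> qc; set x := q.*2.+1%:R * (N * K).
have x0 : 0 <= x by rewrite /x !mulr_ge0 // ltW.
have sumS (T : 'M[R]_d) w : \sum_(k in J) frob_dot (A (tnth w k) - G) T = frob_dot (S w) T.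
  by rewrite -frob_dot_suml.
have h1 : Phi q.+1 = \sum_(k in J) \sum_w frob_dot (A (tnth w k) - G) (S w ^+ q.*2.+1).
  rewrite exchange_big /=; apply: eq_bigr => w _; rewrite sumS.
  have -> : S w ^+ q.*2.+1 = S w ^+ q.+1 *m S w ^+ q by rewrite mulmxE -exprD addSn addnn.
  by rewrite {1}exprS -mulmxE frob_dot_mulr expr_tr.
have h2 : Phi q.+1 <= x * \sum_w frob_dot (S w + (2 * #|J|%:R) *: G) (S w ^+ q.*2).
  rewrite h1; apply: le_trans (ler_sum _ (fun k kJ => moment_term q kJ)) _.
  rewrite -mulr_sumr exchange_big /= ler_wpM2l // le_eqVlt; apply/orP; left; apply/eqP.
  apply: eq_bigr => w _; rewrite frob_dotDl -sumS frob_dotZl.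
  have -> : 2 * #|J|%:R * frob_dot G (S w ^+ q.*2) =
     \sum_(k in J) (2 * frob_dot G (S w ^+ q.*2)).
    by rewrite sumr_const -[RHS]mulr_natl; ring.
  rewrite -big_split /=; apply: eq_bigr => k _.
  by rewrite frob_dotDl frob_dotBl; ring.
have h3 : x * \sum_w frob_dot (S w + (2 * #|J|%:R) *: G) (S w ^+ q.*2)
   <= 4^-1 * Phi q.+1 + (x ^+ 2 + 2 * #|J|%:R * B * x) * Phi q.
  rewrite /Phi !mulr_sumr -big_split /=; apply: ler_sum => w _.
  have Tt := expr_tr q (S_tr w).
  rewrite frob_dotDl frob_dotZl.
  have g := G_le Tt; rewrite -exprK in g.
  have sq : frob_dot (S w) (S w ^+ q.*2) = frob_dot (S w ^+ q.+1) (S w ^+ q).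
    by rewrite [S w ^+ q.+1]exprSr -mulmxE frob_dot_mull Tt exprK.
  have := frob_dot_ge0 (2^-1 *: S w ^+ q.+1 - x *: S w ^+ q).
  rewrite !(frob_dotBl, frob_dotBr, frob_dotZl, frob_dotZr) sq.
  rewrite (frob_dotC (S w ^+ q) (S w ^+ q.+1)).
  have g' : x * (2 * #|J|%:R * frob_dot G (S w ^+ q.*2)) <=
            x * (2 * #|J|%:R * (B * frob_dot (S w ^+ q) (S w ^+ q))).
    by rewrite ler_wpM2l // ler_wpM2l // mulr_ge0.
  lra.
have P0 : 0 <= Phi q by apply: sumr_ge0 => w _; exact: frob_dot_ge0.
have h4 : (x ^+ 2 + 2 * #|J|%:R * B * x) * Phi q <= (c ^+ 2 + 2 * #|J|%:R * B * c) * Phi q.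
  rewrite ler_wpM2r // lerD //.
    by rewrite lerXn2r // nnegrE ?(le_trans x0).
  by rewrite ler_wpM2l // !mulr_ge0.
lra.
Qed.

Let moment_bound p c : p.*2%:R * (N * K) <= c -> 0 <= c ->
  Phi p <= (4 / 3 * (c ^+ 2 + 2 * #|J|%:R * B * c)) ^+ p * (M * d%:R).
Proof.
move=> pc c0; elim: p pc => [|p IH] pc.
  rewrite expr0 mul1r /Phi.
  have E w : frob_dot (S w ^+ 0) (S w ^+ 0) = d%:R.
    by rewrite expr0 frob_dotE trmx1 mulmx1 mxtrace1.
  under eq_bigr => w _ do rewrite E.
  by rewrite sumr_const (eq_card (B := {: m.-tuple I})) // -[_ *+ #|_|]mulr_natl.
have nk : 0 <= N * K by rewrite mulr_ge0 // ltW.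
have h : p.*2.+1%:R * (N * K) <= c.
  by apply: le_trans pc; rewrite ler_wpM2r // ler_nat doubleS.
apply: le_trans (moment_step h) _; rewrite [_ ^+ p.+1]exprS -[leRHS]mulrA ler_wpM2l //.
  by rewrite !mulr_ge0 // addr_ge0 ?sqr_ge0 // !mulr_ge0.
apply: IH; apply: le_trans h; by rewrite ler_wpM2r // ler_nat.
Qed.

(** Markov's inequality for the moment of order 2p. With c = 2 p N K the size condition reads 32 c
    <= delta^2 b, which makes 4/3 (c^2 + 2 b c) at most t^2 / 8. Each order thus contributes a
    factor 1/8, and d is the trace of the identity at order 0. *)
Lemma matrix_chernoff p delta : (0 < p)%N -> 0 < B -> (0 < #|J|)%N ->
  0 < delta -> delta <= 1 -> 64 * p%:R * N * K <= delta ^+ 2 * (#|J|%:R * B) ->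
  \sum_(w : m.-tuple I | `[< ~ forall x y : 'cV[R]_d,
      `|N * \sum_(k in J) (frob_dot (a (tnth w k)) x * frob_dot (a (tnth w k)) y)
        - #|J|%:R * \sum_z (frob_dot (a z) x * frob_dot (a z) y)|
      <= delta * (#|J|%:R * B) * frob_norm x * frob_norm y >]) 1
  <= M * (d%:R * 8^-1 ^+ p).
Proof.
move=> p0 Bp J0 d0 d1 hK; set b := #|J|%:R * B in hK *; set t := delta * b.
have b0 : 0 < b by rewrite mulr_gt0 // ltr0n.
have t0 : 0 < t by rewrite mulr_gt0.
have tp0 : 0 < (t ^+ p) ^+ 2 by rewrite !exprn_gt0.
have SE w x y : frob_dot x (S w *m y) =
   N * \sum_(k in J) (frob_dot (a (tnth w k)) x * frob_dot (a (tnth w k)) y)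
        - #|J|%:R * \sum_z (frob_dot (a z) x * frob_dot (a z) y).
  have r1 z : frob_dot x (a z *m (a z)^T *m y) = frob_dot (a z) x * frob_dot (a z) y.
    have -> : a z *m (a z)^T *m y = frob_dot (a z) y *: a z.
      rewrite -mulmxA frob_dotE [X in _ *m X]mx11_scalar mul_mx_scalar.
      by rewrite /mxtrace big_ord1.
    by rewrite frob_dotZr mulrC (frob_dotC x).
  rewrite /S mulmx_suml frob_dot_sumr.
  under eq_bigr => k _ do rewrite mulmxBl frob_dotBr -scalemxAl frob_dotZr r1.
  rewrite big_split /= mulr_sumr; congr (_ + _).
  rewrite sumrN sumr_const -[_ *+ #|_|]mulr_natl; congr (- (_ * _)).
  by rewrite /G mulmx_suml frob_dot_sumr; apply: eq_bigr => z _; rewrite r1.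
have PhiM : Phi p <= (t ^+ p) ^+ 2 * (M * (d%:R * 8^-1 ^+ p)).
  have c0 : 0 <= p.*2%:R * (N * K) by rewrite !mulr_ge0 // ltW.
  apply: le_trans (moment_bound (lexx _) c0) _.
  have -> : (t ^+ p) ^+ 2 * (M * (d%:R * 8^-1 ^+ p)) = (t ^+ 2 / 8) ^+ p * (M * d%:R).
    by rewrite (exprMn p (t ^+ 2)) (exprAC t p 2); ring.
  rewrite ler_wpM2r ?mulr_ge0 ?(ltW M_gt0) // lerXn2r ?nnegrE //.
  - by rewrite mulr_ge0 // addr_ge0 ?sqr_ge0 // !mulr_ge0 // ltW.
  - by rewrite divr_ge0 // sqr_ge0.
  set c := p.*2%:R * (N * K) in c0 *.
  have cb : 32 * c <= delta ^+ 2 * b.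
    apply: le_trans hK; rewrite /c -muln2 natrM le_eqVlt; apply/orP; left; apply/eqP; ring.
  have d2 : delta ^+ 2 <= 1 by rewrite expr_le1 // ltW.
  have c2 : 1024 * c ^+ 2 <= t ^+ 2.
    have c32 : 0 <= 32 * c by rewrite mulr_ge0.
    have := ler_pM c32 c32 cb cb.
    have : delta ^+ 2 * (delta ^+ 2 * b ^+ 2) <= 1 * (delta ^+ 2 * b ^+ 2).
      by rewrite ler_wpM2r // mulr_ge0 ?sqr_ge0.
    rewrite /t; lra.
  have cbb : 32 * (c * b) <= t ^+ 2.
    have := ler_wpM2r (ltW b0) cb; rewrite /t; lra.
  rewrite -[2 * #|J|%:R * B]mulrA -/b; have := sqr_ge0 t; lra.
rewrite -(ler_pM2l tp0); apply: le_trans PhiM.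
rewrite mulr_sumr /Phi [leRHS](bigID (fun w => `[< ~ forall x y : 'cV[R]_d,
      `|N * \sum_(k in J) (frob_dot (a (tnth w k)) x * frob_dot (a (tnth w k)) y)
        - #|J|%:R * \sum_z (frob_dot (a z) x * frob_dot (a z) y)|
      <= delta * b * frob_norm x * frob_norm y >])) /=.
apply: ler_wpDr; first by apply: sumr_ge0 => w _; exact: frob_dot_ge0.
apply: ler_sum => w /asboolP nw; rewrite mulr1 leNgt; apply/negP => /ltW h.
apply: nw => x y; rewrite -SE -/t; apply: sym_op_le h => //.
exact: ltW.
Qed.

End Moments.

(** * Singular values, tangent spaces and hard thresholding *)

Section SVD.
Context {R : realType}.

(** Two candidates differ by a matrix orthogonal to both of them, hence to itself. *)
Lemma orth_projE p q (S : set 'M[R]_(p, q)) Z W : S W ->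
  (forall V, S V -> frob_dot (Z - W) V = 0) -> orth_proj S Z = W.
Proof.
move=> SW ZW; rewrite /orth_proj; set E := [set W | _].
have [SW' ZW'] : E (xget 0 E) by apply: xgetPex; exists W.
apply/eqP; rewrite -subr_eq0 -frob_dot_eq0; set W' := xget 0 E.
have h V : S V -> frob_dot (W' - W) V = 0.
  move=> SV; have := ZW V SV; have := ZW' V SV.
  rewrite -/W' !frob_dotBl; lra.
by rewrite frob_dotBr !h // subrr.
Qed.

Lemma frob_norm_mul_diag p k (A : 'M[R]_(p, k)) (s : 'rV[R]_k) c : 0 <= c ->
  (forall i, c <= s 0 i) -> c * frob_norm A <= frob_norm (A *m diag_mx s).
Proof.
move=> c0 cs; rewrite -[c]ger0_norm // -frob_normZ frob_norm_ler.
apply: ler_sum => i _; apply: ler_sum => j _; rewrite mul_mx_diag !mxE -!expr2 !exprMn mulrC.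
by rewrite ler_wpM2l ?sqr_ge0 // lerXn2r // nnegrE // (le_trans c0).
Qed.

Lemma frob_norm_mul_diag_le p k (A : 'M[R]_(p, k)) (s : 'rV[R]_k) c : 0 <= c ->
  (forall i, `|s 0 i| <= c) -> frob_norm (A *m diag_mx s) <= c * frob_norm A.
Proof.
move=> c0 cs; rewrite -[c]ger0_norm // -frob_normZ frob_norm_ler.
apply: ler_sum => i _; apply: ler_sum => j _; rewrite mul_mx_diag !mxE -!expr2 !exprMn mulrC.
rewrite ler_wpM2r ?sqr_ge0 // -(real_normK (num_real (s 0 j))).
by rewrite lerXn2r // nnegrE.
Qed.

Lemma frob_norm_isometry p k (U : 'M[R]_(p, k)) : U^T *m U = 1%:M ->
  frob_norm U ^+ 2 = k%:R.
Proof. by move=> UU; rewrite frob_norm_sqr frob_dotE UU mxtrace1. Qed.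

Lemma ker_proj_pythagoras p k q (U : 'M[R]_(p, k)) (A : 'M[R]_(p, q)) :
  U^T *m U = 1%:M ->
  frob_norm (ker_proj U *m A) ^+ 2 = frob_norm A ^+ 2 - frob_norm (U^T *m A) ^+ 2.
Proof.
move=> UU; rewrite !frob_norm_sqr frob_dot_mull ker_proj_tr mulmxA ker_proj_idem //.
rewrite ker_projE mulmxBl mul1mx frob_dotBr; congr (_ - _).
by rewrite [RHS]frob_dot_mull trmxK mulmxA.
Qed.

(* Both squared norms equal a dimension minus the squared norm of [U^T *m V]. *)
Lemma ker_proj_gap p k l (U : 'M[R]_(p, k)) (V : 'M[R]_(p, l)) :
  U^T *m U = 1%:M -> V^T *m V = 1%:M -> (l <= k)%N ->
  frob_norm (ker_proj U *m V) <= frob_norm (ker_proj V *m U).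
Proof.
move=> UU VV lk; rewrite -(@ler_pXn2r _ 2) ?nnegrE ?frob_norm_ge0 //.
rewrite !ker_proj_pythagoras // (frob_norm_isometry UU) (frob_norm_isometry VV).
have -> : V^T *m U = (U^T *m V)^T by rewrite trmx_mul trmxK.
by rewrite frob_norm_tr lerB // ler_nat.
Qed.

Section Reduced.
Variables (n k : nat) (Z : 'M[R]_n) (U V : 'M[R]_(n, k)) (s : 'rV[R]_k).
Hypothesis svdZ : is_reduced_svd Z U s V.

Lemma rsvd_U : U^T *m U = 1%:M. Proof. by case: svdZ => -[]. Qed.
Lemma rsvd_V : V^T *m V = 1%:M. Proof. by case: svdZ => -[]. Qed.
Lemma rsvd_E : Z = U *m diag_mx s *m V^T. Proof. by case: svdZ => -[]. Qed.
Lemma rsvd_gt0 i : 0 < s 0 i. Proof. by case: svdZ. Qed.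

Lemma rsvd_ran : ran_proj U *m Z = Z.
Proof. by rewrite rsvd_E !mulmxA ran_projK // rsvd_U. Qed.

Lemma rsvd_ker : ker_proj U *m Z = 0.
Proof. by rewrite rsvd_E !mulmxA ker_proj0 ?mul0mx // rsvd_U. Qed.

Lemma rsvd_kerr : Z *m ker_proj V = 0.
Proof. by rewrite rsvd_E -!mulmxA tr_ker_proj0 ?mulmx0 // rsvd_V. Qed.

Lemma rsvd_sum : Z = \sum_i s 0 i *: (col i U *m (col i V)^T).
Proof.
rewrite {1}rsvd_E; apply/matrixP => i j; rewrite !mxE summxE.
apply: eq_bigr => a _; rewrite mul_mx_diag !mxE big_ord1 !mxE; ring.
Qed.

Lemma diag_inv : diag_mx s *m diag_mx (map_mx (fun x => x^-1) s) = 1%:M.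
Proof.
rewrite mulmx_diag -diag_const_mx; congr diag_mx; apply/rowP => i.
by rewrite !mxE mulfV // gt_eqF // rsvd_gt0.
Qed.

Lemma rsvd_left : U = Z *m V *m diag_mx (map_mx (fun x => x^-1) s).
Proof. by rewrite rsvd_E -!mulmxA (mulmxA V^T) rsvd_V mul1mx diag_inv mulmx1. Qed.

Lemma rsvd_rank : \rank Z = k.
Proof.
apply/eqP; rewrite eqn_leq; apply/andP; split.
  by rewrite rsvd_E -mulmxA; apply: leq_trans (mxrankM_maxl _ _) (rank_leq_col _).
rewrite -{1}(mxrank1 R k) -rsvd_U {2}rsvd_left mulmxA.
by apply: leq_trans (mxrankM_maxl _ _) _; rewrite mulmxA; apply: leq_trans (mxrankM_maxl _ _) (mxrankM_maxr _ _).
Qed.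

Lemma rsvd_tr : is_reduced_svd Z^T V s U.
Proof.
case: svdZ => -[UU VV s0 sd ZE] s1; split=> //; split=> //.
by rewrite ZE !trmx_mul trmxK tr_diag_mx mulmxA.
Qed.

Lemma rsvd_lower p c (A : 'M[R]_(p, n)) : 0 <= c -> (forall i, c <= s 0 i) ->
  c * frob_norm (A *m U) <= frob_norm (A *m Z).
Proof.
move=> c0 cs; rewrite rsvd_E !mulmxA isometryr_norm ?rsvd_V //.
exact: frob_norm_mul_diag.
Qed.

Lemma rsvd_upper p c (A : 'M[R]_(p, n)) : 0 <= c -> (forall i, s 0 i <= c) ->
  frob_norm (A *m Z) <= c * frob_norm A.
Proof.
move=> c0 cs; rewrite rsvd_E !mulmxA isometryr_norm ?rsvd_V //.
apply: le_trans (frob_norm_mul_diag_le _ c0 _) _.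
  by move=> i; rewrite ger0_norm // ltW ?rsvd_gt0.
by rewrite ler_wpM2l // coisometryr_norm // rsvd_U.
Qed.

End Reduced.

(** Each left factor is Z times a matrix, so each projection fixes the range of the other;
    transposition then identifies the two. *)
Lemma rsvd_ran_proj n k k' (Z : 'M[R]_n) (U V : 'M[R]_(n, k)) s
    (U' V' : 'M[R]_(n, k')) s' :
  is_reduced_svd Z U s V -> is_reduced_svd Z U' s' V' -> ran_proj U = ran_proj U'.
Proof.
move=> h h'.
have e1 : ran_proj U *m ran_proj U' = ran_proj U'.
  by rewrite {2 3}/ran_proj (rsvd_left h') !mulmxA (rsvd_ran h).
have e2 : ran_proj U' *m ran_proj U = ran_proj U.
  by rewrite {2 3}/ran_proj (rsvd_left h) !mulmxA (rsvd_ran h').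
by rewrite -e2 -[RHS]ran_proj_tr -{2}e1 trmx_mul !ran_proj_tr.
Qed.

(** k is the largest number up to min(r, n) whose first k singular values are positive; by
    monotonicity the kept values beyond k vanish. Taking r = n turns any SVD into a reduced one. *)
Lemma svd_reduce n r (Z : 'M[R]_n) (U : 'M[R]_n) s (V : 'M[R]_n) : is_svd Z U s V ->
  exists k (U' : 'M[R]_(n, k)) s' (V' : 'M[R]_(n, k)), (k <= r)%N /\
   is_reduced_svd (U *m diag_mx (\row_i (if (i < r)%N then s 0 i else 0)) *m V^T) U' s' V'.
Proof.
move=> [UU VV s0 sd ZE].
pose pos k := [forall i : 'I_n, (i < k)%N ==> (0 < s 0 i)] && (k <= minn r n)%N.
have pos0 : exists k, pos k.
  by exists 0%N; rewrite /pos leq0n andbT; apply/forallP.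
have posn k : pos k -> (k <= n)%N by move=> /andP[_]; rewrite leq_min => /andP[].
have [k /andP[/forallP kpos kn] kmax] := ex_maxnP pos0 posn.
have {}kpos (i : 'I_n) : (i < k)%N -> 0 < s 0 i by move=> ik; have /implyP := kpos i; apply.
move: (kn); rewrite leq_min => /andP[kr kn'].
have kz (i : 'I_n) : (k <= i)%N -> (i < r)%N -> s 0 i = 0.
  move=> ki ir; apply/eqP; rewrite -[_ == _]negbK; apply/negP => si.
  have si0 : 0 < s 0 i by rewrite lt0r si s0.
  suff : pos k.+1 by move/kmax; rewrite ltnn.
  rewrite /pos leq_min (leq_ltn_trans ki ir) (leq_ltn_trans ki (ltn_ord i)) !andbT.
  apply/forallP => j; apply/implyP; rewrite ltnS => jk.
  by apply: lt_le_trans si0 (sd _ _ (leq_trans jk ki)).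
pose f (j : 'I_k) : 'I_n := widen_ord kn' j.
have fI : injective f by move=> i j /(congr1 val)/= /val_inj.
have sub_iso (Q : 'M[R]_n) : Q^T *m Q = 1%:M -> (colsub f Q)^T *m colsub f Q = 1%:M.
  move=> QQ; apply/matrixP => i j; rewrite mxE.
  have := congr1 (fun M : 'M[R]_n => M (f i) (f j)) QQ; rewrite !mxE (inj_eq fI) => <-.
  by apply: eq_bigr => l _; rewrite !mxE.
exists k, (colsub f U), (colsub f s), (colsub f V); split=> //; split; last first.
  by move=> i; rewrite mxE kpos //=.
split; [exact: sub_iso|exact: sub_iso|by move=> i; rewrite mxE s0| |].
  by move=> i j ij; rewrite !mxE sd.
apply/matrixP => i j; rewrite mxE [RHS]mxE.
have E (l : 'I_n) : (U *m diag_mx (\row_i0 (if (i0 < r)%N then s 0 i0 else 0))) i l * V^T l j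
   = if (l < k)%N then U i l * s 0 l * V j l else 0.
  rewrite mul_mx_diag !mxE; have [lk|lk] := ltnP l k; first by rewrite (leq_trans lk kr).
  case: ifP => lr; last by rewrite mulr0 mul0r.
  by rewrite kz // mulr0 mul0r.
rewrite (eq_bigr _ (fun l _ => E l)) -big_mkcond /=.
have -> : \sum_(j0 < k) (colsub f U *m diag_mx (colsub f s)) i j0 * (colsub f V)^T j0 j
   = \sum_(j0 < k) U i (f j0) * s 0 (f j0) * V j (f j0).
  by apply: eq_bigr => l _; rewrite mul_mx_diag !mxE.
by rewrite (big_ord_narrow kn').
Qed.

End SVD.

(** * Tangent projections and the Eckart-Young inequality *)

Section Tangent.
Context {R : realType}.

(** The complementary form of P_U Z + Z P_V - P_U Z P_V. It makes tangency of W the single equation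
    [ker_proj U *m W *m ker_proj V = 0]. *)
Definition tan_proj n k (U V : 'M[R]_(n, k)) (Z : 'M[R]_n) : 'M[R]_n :=
  Z - ker_proj U *m Z *m ker_proj V.

Section TanProj.
Variables (n k : nat) (U V : 'M[R]_(n, k)).
Hypotheses (UU : U^T *m U = 1%:M) (VV : V^T *m V = 1%:M).

Lemma tan_projE Z : tan_proj U V Z = U *m (U^T *m Z) + ker_proj U *m Z *m V *m V^T.
Proof.
have kZ : ker_proj U *m Z = Z - U *m (U^T *m Z).
  by rewrite ker_projE mulmxBl mul1mx mulmxA.
have -> : tan_proj U V Z = Z - ker_proj U *m Z + ker_proj U *m Z *m V *m V^T.
  by rewrite /tan_proj [ker_proj V]ker_projE mulmxBr mulmx1 mulmxA opprB addrA addrAC.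
by rewrite {1}kZ opprB addrC addrCA addrC -addrA addrC addrNK.
Qed.

Lemma ker_tan_proj Z : ker_proj U *m tan_proj U V Z *m ker_proj V = 0.
Proof.
rewrite /tan_proj mulmxBr mulmxBl !mulmxA.
rewrite ker_proj_idem // -(mulmxA _ (ker_proj V) (ker_proj V)).
by rewrite ker_proj_idem // subrr.
Qed.

Lemma tan_proj_id Z : ker_proj U *m Z *m ker_proj V = 0 -> tan_proj U V Z = Z.
Proof. by rewrite /tan_proj => ->; rewrite subr0. Qed.

Lemma tan_proj_idem Z : tan_proj U V (tan_proj U V Z) = tan_proj U V Z.
Proof. exact/tan_proj_id/ker_tan_proj. Qed.

Lemma tan_proj_adj Z W : frob_dot (tan_proj U V Z) W = frob_dot Z (tan_proj U V W).
Proof.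
rewrite /tan_proj frob_dotBl frob_dotBr; congr (_ - _).
by rewrite frob_dot_mulr ker_proj_tr frob_dot_mull ker_proj_tr mulmxA.
Qed.

Lemma tan_proj_pythagoras Z :
  frob_norm (tan_proj U V Z) ^+ 2 + frob_norm (ker_proj U *m Z *m ker_proj V) ^+ 2
  = frob_norm Z ^+ 2.
Proof.
rewrite !frob_norm_sqr tan_proj_adj tan_proj_idem {1}/tan_proj frob_dotBr.
suff -> : frob_dot (ker_proj U *m Z *m ker_proj V) (ker_proj U *m Z *m ker_proj V)
  = frob_dot Z (ker_proj U *m Z *m ker_proj V) by rewrite subrK.
rewrite frob_dot_mulr ker_proj_tr frob_dot_mull ker_proj_tr -!mulmxA ker_proj_idem //.
by rewrite !mulmxA ker_proj_idem.
Qed.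

Lemma tan_proj_norm Z : frob_norm (tan_proj U V Z) <= frob_norm Z.
Proof.
rewrite -(@ler_pXn2r _ 2) ?nnegrE ?frob_norm_ge0 //.
by rewrite -[leRHS](tan_proj_pythagoras Z) lerDl sqr_ge0.
Qed.

Lemma tan_projD Z W : tan_proj U V (Z + W) = tan_proj U V Z + tan_proj U V W.
Proof. by rewrite /tan_proj mulmxDr mulmxDl opprD addrACA. Qed.

Lemma tan_projZ a Z : tan_proj U V (a *: Z) = a *: tan_proj U V Z.
Proof. by rewrite /tan_proj -scalemxAr -scalemxAl scalerBr. Qed.

Lemma tan_projN Z : tan_proj U V (- Z) = - tan_proj U V Z.
Proof. by rewrite -scaleN1r tan_projZ scaleN1r. Qed.

Lemma tan_projB Z W : tan_proj U V (Z - W) = tan_proj U V Z - tan_proj U V W.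
Proof. by rewrite tan_projD tan_projN. Qed.

(** By Pythagoras the squared norm is 1 - (1 - |U_i|^2)(1 - |V_j|^2), with U_i and V_j the rows of
    the factors. *)
Lemma tan_proj_delta i j c : frob_norm (row i U) <= c -> frob_norm (row j V) <= c ->
  frob_norm (tan_proj U V (delta_mx i j)) ^+ 2 <= 2 * c ^+ 2.
Proof.
move=> ic jc.
have e : delta_mx i j = delta_mx i 0 *m (delta_mx j 0 : 'cV[R]_n)^T :> 'M[R]_n.
  by rewrite trmx_delta mul_delta_mx.
have nrm (x y : 'cV[R]_n) : frob_norm (x *m y^T) ^+ 2 = frob_norm x ^+ 2 * frob_norm y ^+ 2.
  rewrite !frob_norm_sqr frob_dot_mull mulmxA.
  have -> : x^T *m x = (frob_dot x x)%:M by rewrite frob_dotE [LHS]mx11_scalar /mxtrace big_ord1.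
  by rewrite mul_scalar_mx frob_dotZr frob_dot_tr.
have := tan_proj_pythagoras (delta_mx i j).
rewrite {2}e mulmxA -mulmxA -(ker_proj_tr V) -trmx_mul nrm frob_norm_delta.
rewrite !ker_proj_pythagoras // -!frob_norm_row !frob_norm_delta expr1n.
have i2 : frob_norm (row i U) ^+ 2 <= c ^+ 2.
  by rewrite lerXn2r // nnegrE ?frob_norm_ge0 // (le_trans _ ic) ?frob_norm_ge0.
have j2 : frob_norm (row j V) ^+ 2 <= c ^+ 2.
  by rewrite lerXn2r // nnegrE ?frob_norm_ge0 // (le_trans _ jc) ?frob_norm_ge0.
have := sqr_ge0 (frob_norm (row i U)); have := sqr_ge0 (frob_norm (row j V)).
have : 0 <= frob_norm (row i U) ^+ 2 * frob_norm (row j V) ^+ 2 by rewrite mulr_ge0 ?sqr_ge0.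
lra.
Qed.

End TanProj.

Lemma rsvd_ker_proj n k k' (Z : 'M[R]_n) (U V : 'M[R]_(n, k)) s
    (U' V' : 'M[R]_(n, k')) s' :
  is_reduced_svd Z U s V -> is_reduced_svd Z U' s' V' ->
  ker_proj U = ker_proj U' /\ ker_proj V = ker_proj V'.
Proof.
move=> h h'; split; rewrite !ker_projE; congr (1%:M - _); first exact: rsvd_ran_proj h h'.
exact: rsvd_ran_proj (rsvd_tr h) (rsvd_tr h').
Qed.

Section RsvdTangent.
Variables (n k : nat) (Y : 'M[R]_n) (U V : 'M[R]_(n, k)) (s : 'rV[R]_k).
Hypothesis svdY : is_reduced_svd Y U s V.

Lemma tangent_spaceP W : tangent_space Y W <-> ker_proj U *m W *m ker_proj V = 0.
Proof.
split=> [[k' [U' [s' [V' [h' [Z1 [Z2 ->]]]]]]]|W0].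
  have [-> ->] := rsvd_ker_proj svdY h'.
  rewrite mulmxDr mulmxDl !mulmxA ker_proj0 ?(rsvd_U h') // !mul0mx add0r.
  by rewrite -!mulmxA tr_ker_proj0 ?(rsvd_V h') // !mulmx0.
exists k, U, s, V; split => //.
exists (U^T *m W)^T, (ker_proj U *m W *m V).
by rewrite trmxK -tan_projE // tan_proj_id.
Qed.

Lemma proj_tangentE Z : proj_tangent Y Z = tan_proj U V Z.
Proof.
apply: orth_projE => [|W /tangent_spaceP W0].
  by apply/tangent_spaceP; rewrite ker_tan_proj ?(rsvd_U svdY) ?(rsvd_V svdY).
rewrite /tan_proj opprB addrC subrK frob_dot_mulr ker_proj_tr frob_dot_mull.
by rewrite ker_proj_tr mulmxA W0 frob_dot0r.
Qed.

Lemma column_spaceE Z : orth_proj (column_space Y) Z = ran_proj U *m Z.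
Proof.
apply: orth_projE.
  exists (V *m diag_mx (map_mx (fun x => x^-1) s) *m (U^T *m Z)) => //.
  by rewrite !mulmxA -(rsvd_left svdY).
move=> _ [w _ <-].
have -> : Z - ran_proj U *m Z = ker_proj U *m Z by rewrite ker_projE mulmxBl mul1mx.
by rewrite frob_dot_mull ker_proj_tr mulmxA (rsvd_ker svdY) mul0mx frob_dot0r.
Qed.

End RsvdTangent.

Lemma row_spaceE n k (Y : 'M[R]_n) (U V : 'M[R]_(n, k)) s Z :
  is_reduced_svd Y U s V -> orth_proj (row_space Y) Z = ran_proj V *m Z.
Proof. by move=> /rsvd_tr h; exact: (column_spaceE h Z). Qed.

(** Projecting away the row space of Y bounds |Z - Y|^2 below by |Z|^2 - |Z V|^2. In the singular
    basis of Z, |Z V|^2 is the sum of s_i^2 p_i with p_i in [0, 1] of total k <= r, hence at most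
    the sum of the r largest s_i^2. *)
Lemma eckart_young n r k (Z W Y : 'M[R]_n) (U V : 'M[R]_(n, k)) s :
  (0 < r <= n)%N -> is_hard_threshold r Z W -> is_reduced_svd Y U s V -> (k <= r)%N ->
  frob_norm (Z - W) <= frob_norm (Z - Y).
Proof.
move=> /andP[r0 rn] [U0 [s0 [V0 [[UU VV s_ge0 s_dec ZE] WE]]]] hY kr.
have VtV := rsvd_V hY.
apply: le_trans (ker_projr_norm VtV (Z - Y)).
rewrite mulmxBl (rsvd_kerr hY) subr0.
pose t := s0 - \row_i (if (i < r)%N then s0 0 i else 0).
have ZW : Z - W = U0 *m diag_mx t *m V0^T.
  by rewrite /t raddfB /= mulmxBr mulmxBl -ZE -WE.
have V0V0 : (V0^T)^T *m V0^T = 1%:M by rewrite trmxK mulmx1C.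
rewrite -(@ler_pXn2r _ 2) ?nnegrE ?frob_norm_ge0 //.
rewrite -(frob_norm_tr (Z *m _)) trmx_mul ker_proj_tr ker_proj_pythagoras // frob_norm_tr.
rewrite -trmx_mul frob_norm_tr.
pose P := V0^T *m V.
have e1 x : frob_norm (U0 *m diag_mx x *m V0^T) = frob_norm (diag_mx x).
  by rewrite (isometryr_norm _ VV) (isometry_norm _ UU).
have e2 : frob_norm (U0 *m diag_mx s0 *m V0^T *m V) = frob_norm (diag_mx s0 *m P).
  by rewrite -!mulmxA (isometry_norm _ UU).
rewrite ZW ZE !e1 e2.
pose p i : R := frob_norm (row i P) ^+ 2.
have p1 i : p i <= 1.
  rewrite -[leRHS](expr1n _ 2) lerXn2r ?nnegrE ?frob_norm_ge0 //.
  rewrite /P row_mul; apply: le_trans (coisometryr_norm VtV _) _.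
  by rewrite rowE -(frob_norm_delta (0 : 'I_1) i) -{1}(trmxK V0) isometryr_norm // trmxK mulmx1C.
have p0 i : 0 <= p i by rewrite sqr_ge0.
have pk : \sum_i p i = k%:R.
  rewrite -(frob_norm_isometry VtV) -(isometry_norm V V0V0) -/P frob_norm_sqr.
  apply: eq_bigr => i _; rewrite /p frob_norm_sqr /frob_dot big_ord1.
  by apply: eq_bigr => j _; rewrite !mxE.
have diagE (x : 'rV[R]_n) : frob_norm (diag_mx x) ^+ 2 = \sum_i x 0 i ^+ 2.
  rewrite frob_norm_sqr; apply: eq_bigr => i _; rewrite (bigD1 i) //= big1 ?addr0.
    by rewrite !mxE eqxx mulr1n expr2.
  by move=> j ji; rewrite !mxE eq_sym (negbTE ji) mul0r.
have dPE : frob_norm (diag_mx s0 *m P) ^+ 2 = \sum_i s0 0 i ^+ 2 * p i.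
  rewrite frob_norm_sqr; apply: eq_bigr => i _.
  rewrite /p frob_norm_sqr /frob_dot big_ord1 mulr_sumr.
  by apply: eq_bigr => j _; rewrite mul_diag_mx !mxE; ring.
rewrite !diagE dPE.
have tE i : t 0 i ^+ 2 = s0 0 i ^+ 2 - (i < r)%:R * s0 0 i ^+ 2.
  by rewrite !mxE; case: ifP => _ /=; ring.
under eq_bigr => i _ do rewrite tE.
rewrite big_split /= sumrN lerD2l lerN2.
have jn : (r.-1 < n)%N by apply: leq_trans rn; rewrite prednK.
(* The r-th squared singular value separates kept from dropped indices; comparison with it makes the
   inequality hold term by term. *)
pose tau := s0 0 (Ordinal jn) ^+ 2.
have tau0 : 0 <= tau by rewrite sqr_ge0.
have h i : s0 0 i ^+ 2 * p i <= (i < r)%:R * s0 0 i ^+ 2 + tau * (p i - (i < r)%:R).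
  have sq2 (a b : 'I_n) : (a <= b)%N -> s0 0 b ^+ 2 <= s0 0 a ^+ 2.
    by move=> ab; rewrite lerXn2r // ?nnegrE // s_dec.
  have [ir|ir] := ltnP i r; rewrite /= ?mul1r ?mul0r ?add0r ?subr0.
    have st : tau <= s0 0 i ^+ 2 by apply: sq2 => /=; rewrite -ltnS prednK.
    have := mulr_ge0 (_ : 0 <= s0 0 i ^+ 2 - tau) (_ : 0 <= 1 - p i).
    by rewrite !subr_ge0 st p1 => /(_ isT isT); lra.
  by rewrite ler_wpM2r //; apply: sq2 => /=; apply: leq_trans ir; exact: leq_pred.
apply: le_trans (ler_sum _ (fun i _ => h i)) _.
rewrite big_split /= -mulr_sumr sumrB pk.
have -> : \sum_(i < n) (i < r)%:R = r%:R :> R.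
  transitivity (\sum_(i < n | (i < r)%N) (1 : R)).
    by rewrite [RHS]big_mkcond /=; apply: eq_bigr => i _; case: ifP.
  by rewrite (big_ord_narrow rn) sumr_const card_ord.
rewrite gerDl mulr_ge0_le0 // subr_le0 ler_nat //.
Qed.

End Tangent.

(** * Perturbation and trimming *)

Section Trim.
Context {R : realType}.

Lemma row_trim n k c (U : 'M[R]_(n, k)) i :
  row i (trim_rows c U) = (Num.min (frob_norm (row i U)) c / frob_norm (row i U)) *: row i U.
Proof. by apply/rowP => j; rewrite !mxE; ring. Qed.

Lemma trim_rows_norm n k c (U : 'M[R]_(n, k)) i : 0 <= c ->
  frob_norm (row i (trim_rows c U)) <= c.
Proof.
move=> c0; rewrite row_trim frob_normZ.
have [->|u0] := eqVneq (frob_norm (row i U)) 0; first by rewrite mulr0.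
have m0 : 0 <= Num.min (frob_norm (row i U)) c by rewrite le_min frob_norm_ge0.
by rewrite ger0_norm ?divr_ge0 ?frob_norm_ge0 // mulfVK // ge_min lexx orbT.
Qed.

(* Clipping a row is the projection onto a ball, hence nonexpansive towards the points of the ball. *)
Lemma trim_rows_dist n k c (U B : 'M[R]_(n, k)) : 0 <= c ->
  (forall i, frob_norm (row i B) <= c) ->
  frob_norm (trim_rows c U - B) <= frob_norm (U - B).
Proof.
move=> c0 Bc; rewrite frob_norm_ler !(frob_dot_rows (_ - B)); apply: ler_sum => i _.
rewrite !linearB /= row_trim; set u := row i U; set b := row i B; set x := frob_norm u.
have [xc|cx] := lerP x c.
  rewrite ?(min_idPl xc).
  have [x0|x0] := eqVneq x 0; last by rewrite divff // scale1r.
  by have /eqP := x0; rewrite frob_norm_eq0 => /eqP ->; rewrite scaler0.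
set t := c / x.
have x0 : 0 < x by exact: le_lt_trans cx.
have t0 : 0 <= t by rewrite divr_ge0 // ltW.
have t1 : t <= 1 by rewrite ler_pdivrMr // mul1r ltW.
have ub : frob_dot u b <= t * x ^+ 2.
  apply: le_trans (frob_dot_le _ _) _; rewrite /t expr2 mulrA mulfVK ?gt_eqF //.
  by rewrite -/x mulrC ler_wpM2r ?(ltW x0) ?Bc.
rewrite !(frob_dotBl, frob_dotBr, frob_dotZl, frob_dotZr) (frob_dotC b u).
rewrite -(frob_norm_sqr u) -/x.
set y := frob_dot u b in ub *; set z := frob_dot b b.
have x2 : 0 <= x ^+ 2 by rewrite sqr_ge0.
have h1 : 0 <= (1 - t) * (t * x ^+ 2 - y) by rewrite mulr_ge0 // subr_ge0.
have h2 := mulr_ge0 (sqr_ge0 (1 - t)) x2.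
lra.
Qed.

End Trim.

Section Perturbation.
Context {R : realType}.
Variables (n k : nat) (X : 'M[R]_n) (U V : 'M[R]_(n, k)) (s : 'rV[R]_k) (sg : R).
Hypothesis svdX : is_reduced_svd X U s V.
Hypothesis sg0 : 0 < sg.
Hypothesis sgs : forall i, sg <= s 0 i.

Let UU := rsvd_U svdX.
Let VV := rsvd_V svdX.

(** A sin-theta bound: [ker_proj U'] annihilates Y and so sees X only through X - Y, while X is
    bounded below by sg on its singular vectors. *)
Lemma gap_le l (Y : 'M[R]_n) (U' : 'M[R]_(n, l)) : U'^T *m U' = 1%:M ->
  ker_proj U' *m Y = 0 -> sg * frob_norm (ker_proj U' *m U) <= frob_norm (X - Y).
Proof.
move=> UU' UY; apply: le_trans (rsvd_lower svdX _ (ltW sg0) sgs) _.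
have -> : ker_proj U' *m X = ker_proj U' *m (X - Y) by rewrite mulmxBr UY subr0.
exact: ker_proj_norm.
Qed.

Lemma gap_le_sym l (Y : 'M[R]_n) (U' : 'M[R]_(n, l)) : U'^T *m U' = 1%:M -> (l <= k)%N ->
  ker_proj U' *m Y = 0 -> sg * frob_norm (ker_proj U *m U') <= frob_norm (X - Y).
Proof.
move=> UU' lk UY; apply: le_trans (gap_le UU' UY).
by rewrite ler_wpM2l ?(ltW sg0) // ker_proj_gap.
Qed.

(** The normal component of X at Y factors into a subspace gap and a projection of X - Y; its
    quadratic size is the curvature of the rank manifold. *)
Lemma normal_le l (Y : 'M[R]_n) (U' V' : 'M[R]_(n, l)) :
  U'^T *m U' = 1%:M -> V'^T *m V' = 1%:M ->
  ker_proj U' *m Y = 0 -> Y *m ker_proj V' = 0 ->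
  sg * frob_norm (ker_proj U' *m X *m ker_proj V') <= frob_norm (X - Y) ^+ 2.
Proof.
move=> UU' VV' UY YV.
have -> : ker_proj U' *m X *m ker_proj V' = (ker_proj U' *m U) *m (U^T *m (X *m ker_proj V')).
  by rewrite -{1}(rsvd_ran svdX) /ran_proj !mulmxA.
have -> : X *m ker_proj V' = (X - Y) *m ker_proj V' by rewrite mulmxBl YV subr0.
apply: le_trans (ler_wpM2l (ltW sg0) (frob_norm_mul _ _)) _.
rewrite mulrA expr2; apply: ler_pM (gap_le UU' UY) _.
- by rewrite mulr_ge0 ?frob_norm_ge0 // ltW.
- exact: frob_norm_ge0.
- apply: le_trans (coisometry_norm UU _) _; exact: ker_projr_norm.
Qed.

End Perturbation.

Section TrimBounds.
Context {R : realType}.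
Variables (n k l : nat) (X Z : 'M[R]_n) (U V : 'M[R]_(n, k)) (s : 'rV[R]_k).
Variables (U' V' : 'M[R]_(n, l)) (s' : 'rV[R]_l) (sg S c : R).
Hypothesis svdX : is_reduced_svd X U s V.
Hypothesis svdZ : is_reduced_svd Z U' s' V'.
Hypothesis lk : (l <= k)%N.
Hypothesis sg0 : 0 < sg.
Hypothesis sgs : forall i, sg <= s 0 i.
Hypothesis sS : forall i, s 0 i <= S.
Hypothesis sgS : sg <= S.
Hypothesis c0 : 0 <= c.
Hypothesis Uc : forall i, frob_norm (row i U) <= c.
Hypothesis Vc : forall i, frob_norm (row i V) <= c.
Let e := frob_norm (Z - X).
Hypothesis esg : 4 * e <= sg.

Let A := trim_rows c U'.
Let B := trim_rows c V'.
Let W := A *m diag_mx s' *m B^T.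

Let UU := rsvd_U svdX.
Let VV := rsvd_V svdX.
Let UU' := rsvd_U svdZ.
Let VV' := rsvd_V svdZ.

(** The projection of Q onto the range of P has rows of norm at most c, so clipping does not move Q
    away from it, and its distance to Q is a subspace gap. General decompositions are allowed so
    that transposition covers the right factor. *)
Lemma trim_factor_le (Y Y' : 'M[R]_n) (P : 'M[R]_(n, k)) t P' (Q Q' : 'M[R]_(n, l)) t' :
  is_reduced_svd Y P t P' -> is_reduced_svd Y' Q t' Q' ->
  (forall i, sg <= t 0 i) -> (forall i, frob_norm (row i P) <= c) ->
  sg * frob_norm (trim_rows c Q - Q) <= 2 * frob_norm (Y' - Y).
Proof.
move=> hP hQ tsg Pc.
pose D := ran_proj P *m Q.
have PP := rsvd_U hP.
have QQ := rsvd_U hQ.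
have Dc i : frob_norm (row i D) <= c.
  rewrite /D /ran_proj -mulmxA row_mul mulmxA.
  apply: le_trans (coisometryr_norm QQ _) _.
  by rewrite isometryr_norm.
have QD : frob_norm (Q - D) = frob_norm (ker_proj P *m Q).
  by rewrite ker_projE mulmxBl mul1mx.
have h1 := trim_rows_dist Q c0 Dc.
have h2 := gap_le_sym hP sg0 tsg QQ lk (rsvd_ker hQ).
have h3 : frob_norm (trim_rows c Q - Q) <= 2 * frob_norm (Q - D).
  have -> : trim_rows c Q - Q = (trim_rows c Q - D) - (Q - D).
    by rewrite opprB addrA subrK.
  by apply: le_trans (frob_normB _ _) _; lra.
rewrite frob_norm_distC -QD in h2.
have := ler_wpM2l (ltW sg0) h3; lra.
Qed.

Lemma trim_left_le : sg * frob_norm (A - U') <= 2 * e.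
Proof. exact: trim_factor_le svdX svdZ sgs Uc. Qed.

Lemma trim_right_le : sg * frob_norm (B - V') <= 2 * e.
Proof.
have := trim_factor_le (rsvd_tr svdX) (rsvd_tr svdZ) sgs Vc.
by rewrite -linearB /= frob_norm_tr.
Qed.

Let e0 : 0 <= e. Proof. exact: frob_norm_ge0. Qed.
Let S0 : 0 < S. Proof. exact: lt_le_trans sgS. Qed.

Lemma trim_dist : sg * frob_norm (W - X) <= 8 * S * e.
Proof.
have ZE := rsvd_E svdZ.
have DE : diag_mx s' = U'^T *m Z *m V'.
  by rewrite {1}ZE !mulmxA UU' mul1mx -mulmxA VV' mulmx1.
have mulZ p (M : 'M[R]_(p, n)) : frob_norm (M *m Z) <= (S + e) * frob_norm M.
  have -> : M *m Z = M *m X + M *m (Z - X) by rewrite -mulmxDr addrC subrK.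
  apply: le_trans (frob_normD _ _) _; rewrite mulrDl.
  apply: lerD; first by have := rsvd_upper svdX M (ltW S0) sS.
  by rewrite mulrC; exact: frob_norm_mul.
have mulZr p (M : 'M[R]_(n, p)) : frob_norm (Z *m M) <= (S + e) * frob_norm M.
  have -> : Z *m M = X *m M + (Z - X) *m M by rewrite -mulmxDl addrC subrK.
  apply: le_trans (frob_normD _ _) _; rewrite mulrDl.
  apply: lerD; last exact: frob_norm_mul.
  rewrite -frob_norm_tr trmx_mul -(frob_norm_tr M).
  by have := rsvd_upper (rsvd_tr svdX) M^T (ltW S0) sS.
pose dA := A - U'; pose dB := B - V'.
(* With trimmed factors U' + dA and V' + dB, every perturbation term is expressed through Z, whose
   norm is at most S + e, rather than through [diag_mx s']. *)
have WZ : W - Z = dA *m U'^T *m Z + Z *m V' *m dB^T + (dA *m U'^T *m Z) *m (V' *m dB^T).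
  have -> : W = (U' + dA) *m diag_mx s' *m (V' + dB)^T.
    by rewrite /W /dA /dB ![_ + (_ - _)]addrC !subrK.
  have -> : (V' + dB)^T = V'^T + dB^T by rewrite linearD.
  rewrite mulmxDl mulmxDr mulmxDl -ZE mulmxDl.
  have -> : U' *m diag_mx s' *m dB^T = Z *m V' *m dB^T.
    by rewrite ZE -!mulmxA (mulmxA V'^T) VV' mul1mx.
  have -> : dA *m diag_mx s' *m V'^T = dA *m U'^T *m Z.
    by rewrite [in RHS]ZE !mulmxA -(mulmxA _ U'^T U') UU' mulmx1.
  have -> : dA *m diag_mx s' *m dB^T = (dA *m U'^T *m Z) *m (V' *m dB^T).
    by rewrite DE !mulmxA.
  set a1 := dA *m U'^T *m Z; set a2 := Z *m V' *m dB^T; set a3 := a1 *m _.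
  by rewrite -(addrA Z) [Z + _]addrC addrK addrA.
have dAe := trim_left_le; have dBe := trim_right_le.
have n1 : frob_norm (dA *m U'^T *m Z) <= (S + e) * frob_norm dA.
  by have := mulZ _ (dA *m U'^T); rewrite isometryr_norm.
have n2 : frob_norm (Z *m V' *m dB^T) <= (S + e) * frob_norm dB.
  have := mulZr _ (V' *m dB^T); rewrite mulmxA => h.
  by apply: le_trans h _; rewrite isometry_norm // frob_norm_tr.
have n3 : frob_norm (V' *m dB^T) = frob_norm dB by rewrite isometry_norm // frob_norm_tr.
have n4 : frob_norm (W - Z) <= (S + e) * (frob_norm dA + frob_norm dB + frob_norm dA * frob_norm dB).
  rewrite WZ; apply: le_trans (frob_normD _ _) _.
  have := frob_normD (dA *m U'^T *m Z) (Z *m V' *m dB^T).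
  have := frob_norm_mul (dA *m U'^T *m Z) (V' *m dB^T); rewrite n3.
  have := ler_wpM2r (frob_norm_ge0 dB) n1; lra.
have n5 : frob_norm (W - X) <= frob_norm (W - Z) + e.
  have -> : W - X = (W - Z) + (Z - X) by rewrite addrA subrK.
  exact: frob_normD.
have := frob_norm_ge0 dA; have := frob_norm_ge0 dB.
move: dAe dBe n4 n5; rewrite -/dA -/dB.
set x := frob_norm dA; set y := frob_norm dB; set z := frob_norm (W - Z).
set w := frob_norm (W - X) => hx hy hz hw y0 x0.
have y12 : y <= 2^-1.
  rewrite -(ler_pM2l sg0); move: esg hy; lra.
have hxy : sg * (x + y + x * y) <= 5 * e.
  have := ler_wpM2l (mulr_ge0 (ltW sg0) x0) y12; lra.
(* In units of S e / sg, trimming costs (5/4) 5 = 25/4 and the error already present at most 1,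
   which stays below 8. *)
have Se : S + e <= 5 / 4 * S by move: esg sgS; lra.
have h1 : sg * z <= (S + e) * (5 * e).
  apply: le_trans (ler_wpM2l (ltW sg0) hz) _.
  by rewrite mulrCA ler_wpM2l // addr_ge0 // ltW.
have h2 := ler_wpM2r e0 Se.
have h3 := ler_wpM2l (ltW sg0) hw.
have h4 := ler_wpM2r e0 sgS.
have h5 := mulr_ge0 (ltW S0) e0.
lra.
Qed.

(** With x the transposed i-th row of P, |x|^2 is the i-th entry of P x = A z. Row i of A has norm
    at most c, and |z| <= 2 |x| because A is within 1/2 of the isometry U'. The factor 2 is the
    price of re-orthonormalising the trimmed factors. *)
Lemma trim_incoherent p (P Q : 'M[R]_(n, p)) t i : is_reduced_svd W P t Q ->
  frob_norm (row i P) <= 2 * c.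
Proof.
move=> hW; set x := (row i P)^T.
rewrite -frob_norm_tr -/x.
pose z := diag_mx s' *m B^T *m Q *m diag_mx (map_mx (fun x => x^-1) t) *m x.
have Pz : P *m x = A *m z by rewrite {1}(rsvd_left hW) /W /z !mulmxA.
have xE : x = P^T *m delta_mx i 0 by rewrite /x rowE trmx_mul trmx_delta.
have xx : frob_norm x ^+ 2 = frob_dot z (row i A)^T.
  rewrite frob_norm_sqr -(isometry_dot x x (rsvd_U hW)) {2}xE mulmxA.
  rewrite frob_dot_mull !mulmxA (rsvd_U hW) mul1mx -xE.
  have -> : frob_dot x x = frob_dot (P *m x) (delta_mx i 0) by rewrite frob_dot_mull -xE.
  by rewrite Pz frob_dot_mull rowE trmx_mul trmx_delta.
have zx : frob_norm z <= 2 * frob_norm x.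
  rewrite -(isometry_norm x (rsvd_U hW)) Pz.
  have -> : A *m z = U' *m z + (A - U') *m z by rewrite -mulmxDl addrC subrK.
  have h1 : frob_norm z <= frob_norm (U' *m z + (A - U') *m z) + frob_norm ((A - U') *m z).
    rewrite -(isometry_norm z UU') -{1}(addrK ((A - U') *m z) (U' *m z)).
    exact: frob_normB.
  have h2 := frob_norm_mul (A - U') z.
  have h3 : frob_norm (A - U') <= 2^-1.
    rewrite -(ler_pM2l sg0); move: trim_left_le esg; lra.
  have := ler_wpM2r (frob_norm_ge0 z) h3; lra.
have xc : frob_norm x ^+ 2 <= frob_norm x * (2 * c).
  rewrite xx; apply: le_trans (frob_dot_le _ _) _; rewrite frob_norm_tr.
  rewrite mulrCA mulrA; apply: ler_pM; rewrite ?frob_norm_ge0 //.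
  exact: trim_rows_norm.
have [->|x0] := eqVneq (frob_norm x) 0; first by rewrite mulr_ge0.
have xp : 0 < frob_norm x by rewrite lt0r x0 frob_norm_ge0.
by rewrite -(ler_pM2l xp) -expr2.
Qed.

End TrimBounds.

(** * The sampling operator as a bilinear form *)

Section Sampling.
Context {R : realType} (n : nat).
Implicit Types (Om : seq ('I_n * 'I_n)) (A B : 'M[R]_n).

Lemma sampling_dot Om A B :
  frob_dot A (sampling_op Om B) = \sum_(p <- Om) A p.1 p.2 * B p.1 p.2.
Proof.
rewrite /sampling_op; elim: Om => [|p Om IH].
  by rewrite !big_nil /frob_dot big1 // => i _; apply: big1 => j _; rewrite !mxE mulr0 mulr0.
rewrite !big_cons -IH.
have -> : map2_mx *%R B (delta_mx p.1 p.2 + \sum_(j <- Om) delta_mx j.1 j.2) =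
   B p.1 p.2 *: delta_mx p.1 p.2 + map2_mx *%R B (\sum_(j <- Om) delta_mx j.1 j.2).
  apply/matrixP => i j; rewrite !mxE mulrDr; congr (_ + _).
  by case: eqP => [->|_] /=; [case: eqP => [->|_]|]; rewrite ?mulr0.
rewrite frob_dotDr frob_dotZr mulrC; congr (_ * _ + _).
rewrite /frob_dot (bigD1 p.1) //= (bigD1 p.2) //= !mxE !eqxx mulr1 !big1 ?addr0 // => i ip.
  by apply: big1 => j _; rewrite !mxE (negbTE ip) mulr0.
by rewrite !mxE (negbTE ip) andbF mulr0.
Qed.

Lemma sampling_adj Om A B : frob_dot A (sampling_op Om B) = frob_dot B (sampling_op Om A).
Proof. by rewrite !sampling_dot; apply: eq_bigr => p _; rewrite mulrC. Qed.

Lemma sampling_opD Om A B : sampling_op Om (A + B) = sampling_op Om A + sampling_op Om B.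
Proof. by apply/matrixP => i j; rewrite !mxE mulrDl. Qed.

Lemma sampling_opZ Om a A : sampling_op Om (a *: A) = a *: sampling_op Om A.
Proof. by apply/matrixP => i j; rewrite !mxE mulrA. Qed.

Lemma sampling_le Om A B :
  `|frob_dot A (sampling_op Om B)| <= (size Om)%:R * (frob_norm A * frob_norm B).
Proof.
rewrite sampling_dot; elim: Om => [|p Om IH]; first by rewrite big_nil normr0 mul0r.
rewrite big_cons; apply: le_trans (ler_normD _ _) _.
rewrite /= -natr1 mulrDl mul1r addrC lerD // normrM.
by rewrite ler_pM // entry_le.
Qed.

End Sampling.

(** * Thresholded steps near a rank r matrix *)

Section Step.
Context {R : realType}.
Variables (n r k : nat) (X : 'M[R]_n) (U V : 'M[R]_(n, k)) (s : 'rV[R]_k) (sg S : R).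
Variable H : 'M[R]_n -> 'M[R]_n.
Hypothesis kr : k = r.
Hypothesis rn : (0 < r <= n)%N.
Hypothesis HH : forall Z, is_hard_threshold r Z (H Z).
Hypothesis svdX : is_reduced_svd X U s V.
Hypothesis sg0 : 0 < sg.
Hypothesis sgs : forall i, sg <= s 0 i.
Hypothesis sS : forall i, s 0 i <= S.
Hypothesis sgS : sg <= S.

Let UU := rsvd_U svdX.
Let VV := rsvd_V svdX.

Definition low_rank (Z : 'M[R]_n) := exists l (P : 'M[R]_(n, l)) t Q,
  (l <= k)%N /\ is_reduced_svd Z P t Q.

Lemma threshold_low_rank Z : low_rank (H Z).
Proof.
have [P [t [Q [svdZ ->]]]] := HH Z.
have [l [P' [t' [Q' [lr h]]]]] := svd_reduce r svdZ.
by exists l, P', t', Q'; rewrite kr.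
Qed.

(** That [H Z] is a hard threshold of Z already provides an SVD of Z; reducing it at level n
    discards only zero singular values. *)
Lemma rsvd_exists Z : exists l (P : 'M[R]_(n, l)) t Q, is_reduced_svd Z P t Q.
Proof.
have [P [t [Q [svdZ _]]]] := HH Z.
have [l [P' [t' [Q' [_ h]]]]] := svd_reduce n svdZ.
exists l, P', t', Q'.
suff E : Z = P *m diag_mx (\row_i (if (i < n)%N then t 0 i else 0)) *m Q^T by rewrite E.
case: svdZ => _ _ _ _ ->; congr (_ *m diag_mx _ *m _).
by apply/rowP => i; rewrite mxE ltn_ord.
Qed.

Lemma threshold_dist Z Y : (\rank Y <= k)%N -> frob_norm (Z - H Z) <= frob_norm (Z - Y).
Proof.
move=> Yk; have [l [P [t [Q h]]]] := rsvd_exists Y.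
have lr : (l <= r)%N by rewrite -(rsvd_rank h) -kr.
exact: (eckart_young rn (HH Z) h lr).
Qed.

Lemma threshold_near Z : frob_norm (H Z - X) <= 2 * frob_norm (Z - X).
Proof.
have -> : H Z - X = (Z - X) - (Z - H Z) by rewrite opprB [RHS]addrC subrKA.
have := threshold_dist Z (eq_leq (rsvd_rank svdX)).
have := frob_normB (Z - X) (Z - H Z); lra.
Qed.

Section Init.
Variables (mu0 : R).
Let c := Num.sqrt (mu0 * r%:R / n%:R).
Hypothesis Uc : forall i, frob_norm (row i U) <= c.
Hypothesis Vc : forall i, frob_norm (row i V) <= c.

Definition incoherent (Z : 'M[R]_n) := exists l (P : 'M[R]_(n, l)) t Q,
  [/\ is_reduced_svd Z P t Q, forall i, frob_norm (row i P) <= 2 * c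
    & forall i, frob_norm (row i Q) <= 2 * c].

Lemma trim_approx Z : low_rank Z -> 4 * frob_norm (Z - X) <= sg ->
  incoherent (trim r mu0 Z) /\
  sg * frob_norm (trim r mu0 Z - X) <= 8 * S * frob_norm (Z - X).
Proof.
move=> [l [P [t [Q [lk hZ]]]]] eZ.
have c0 : 0 <= c by exact: sqrtr_ge0.
rewrite /trim; set E := [set W | _].
have [l' [P' [t' [Q' [hZ' ->]]]]] : E (xget 0 E).
  apply: xgetPex; exists (trim_rows c P *m diag_mx t *m (trim_rows c Q)^T).
  by exists l, P, t, Q.
have lk' : (l' <= k)%N by rewrite -(rsvd_rank hZ') (rsvd_rank hZ).
split; last exact: (trim_dist svdX hZ' lk' sg0 sgs sS sgS c0 Uc Vc eZ).
have [l2 [P2 [t2 [Q2 h2]]]] := rsvd_exists (trim_rows c P' *m diag_mx t' *m (trim_rows c Q')^T).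
exists l2, P2, t2, Q2; split => // i.
  exact: (trim_incoherent svdX hZ' lk' sg0 sgs c0 Uc eZ i h2).
have h2t := rsvd_tr h2.
rewrite !trmx_mul trmxK tr_diag_mx mulmxA in h2t.
apply: (trim_incoherent (rsvd_tr svdX) (rsvd_tr hZ') lk' sg0 sgs c0 Vc _ i h2t).
by rewrite -linearB /= frob_norm_tr.
Qed.

(** The tangent part is tested against P_T(e_i e_j^T), of norm at most sqrt(8) c <= 3 c. The normal
    part is that of X, so it has the left factor [ker_proj P *m U], whose rows have norm at most c +
    2 c. *)
Lemma incoherent_entry Z i j : incoherent Z ->
  `|(X - Z) i j| <= 6 * c * frob_norm (X - Z).
Proof.
move=> [l [P [t [Q [hZ Pc Qc]]]]]; set E := X - Z.
have c0 : 0 <= c by exact: sqrtr_ge0.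
have PP := rsvd_U hZ; have QQ := rsvd_V hZ.
have e0 := frob_norm_ge0 E.
have EE : E i j = tan_proj P Q E i j + (ker_proj P *m E *m ker_proj Q) i j.
  have addE (A B : 'M[R]_n) : A i j = (A - B) i j + B i j by rewrite !mxE subrK.
  exact: addE.
have h1 : `|tan_proj P Q E i j| <= 3 * c * frob_norm E.
  rewrite -frob_dot_delta tan_proj_adj; apply: le_trans (frob_CS _ _) _.
  rewrite mulrC ler_wpM2r // frob_norm_le ?mulr_ge0 // -frob_norm_sqr.
  have := tan_proj_delta PP QQ (Pc i) (Qc j); have := sqr_ge0 c.
  set x := frob_norm _ ^+ 2; rewrite !exprMn; lra.
have h2 : `|(ker_proj P *m E *m ker_proj Q) i j| <= 3 * c * frob_norm E.
  have -> : ker_proj P *m E *m ker_proj Q = ker_proj P *m U *m (U^T *m (E *m ker_proj Q)).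
    rewrite /E mulmxBl (rsvd_kerr hZ) subr0 mulmxBr (rsvd_ker hZ) subr0.
    by rewrite -{1}(rsvd_ran svdX) /ran_proj !mulmxA.
  rewrite -frob_dot_delta frob_dot_mull trmx_mul ker_proj_tr.
  apply: le_trans (frob_CS _ _) _; rewrite mulrC; apply: ler_pM; rewrite ?frob_norm_ge0 //.
    have -> : delta_mx i j = delta_mx i 0 *m (delta_mx j 0 : 'cV[R]_n)^T :> 'M[R]_n.
      by rewrite trmx_delta mul_delta_mx.
    have nx (x : 'cV[R]_k) : frob_norm (x *m (delta_mx j 0 : 'cV[R]_n)^T) <= frob_norm x.
      apply: le_trans (frob_norm_mul _ _) _.
      by rewrite frob_norm_tr frob_norm_delta mulr1.
    rewrite mulmxA; apply: le_trans (nx _) _.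
    rewrite ker_projE mulmxBr mulmx1 mulmxBl; apply: le_trans (frob_normB _ _) _.
    have := Uc i; rewrite frob_norm_row.
    have : frob_norm (U^T *m ran_proj P *m (delta_mx i 0 : 'cV[R]_n)) <= 2 * c.
      rewrite -!mulmxA; apply: le_trans (coisometry_norm UU _) _.
      by rewrite isometry_norm // -frob_norm_row.
    lra.
  apply: le_trans (coisometry_norm UU _) _; exact: ker_projr_norm.
rewrite EE; apply: le_trans (ler_normD _ _) _; lra.
Qed.

(** Before thresholding, the error is the gradient error in the tangent space minus the normal part
    of X, which is quadratic; thresholding at most doubles it. *)
Lemma init_step Z D delta : incoherent Z ->
  frob_norm (proj_tangent Z D - proj_tangent Z (X - Z)) <= delta * frob_norm (X - Z) ->
  sg * frob_norm (H (Z + proj_tangent Z D) - X) <=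
    2 * (frob_norm (Z - X) ^+ 2 + sg * delta * frob_norm (Z - X)).
Proof.
move=> [l [P [t [Q [hZ Pc Qc]]]]].
have PP := rsvd_U hZ; have QQ := rsvd_V hZ.
rewrite !(proj_tangentE hZ) => hD.
have h1 := threshold_near (Z + tan_proj P Q D).
have h2 := normal_le svdX sg0 sgs PP QQ (rsvd_ker hZ) (rsvd_kerr hZ).
have h3 : Z + tan_proj P Q D - X = (tan_proj P Q D - tan_proj P Q (X - Z))
     - ker_proj P *m X *m ker_proj Q.
  have -> : ker_proj P *m X *m ker_proj Q = ker_proj P *m (X - Z) *m ker_proj Q.
    by rewrite mulmxBr (rsvd_ker hZ) subr0.
  rewrite {2}/tan_proj; set N := ker_proj P *m _ *m _.
  by apply/matrixP => i j; rewrite !mxE; ring.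
have h4 := frob_normB (tan_proj P Q D - tan_proj P Q (X - Z)) (ker_proj P *m X *m ker_proj Q).
rewrite -h3 in h4.
rewrite (frob_norm_distC Z X).
have h5 := ler_wpM2l (ltW sg0) h4.
have h6 := ler_wpM2l (ltW sg0) h1.
have h7 := ler_wpM2l (ltW sg0) hD.
lra.
Qed.

End Init.

Lemma retraction Y xi sg' l (P : 'M[R]_(n, l)) t Q : is_reduced_svd Y P t Q -> (l <= k)%N ->
  0 < sg' -> (forall i, sg' <= t 0 i) -> ker_proj P *m xi *m ker_proj Q = 0 ->
  sg' * frob_norm (Y + xi - H (Y + xi)) <= frob_norm xi ^+ 2.
Proof.
move=> hY lk s0 st xiT.
have PP := rsvd_U hY; have QQ := rsvd_V hY.
pose Z1 := P^T *m xi; pose Z2 := ker_proj P *m xi *m Q.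
pose Di := diag_mx (map_mx (fun x => x^-1) t).
(* The inner dimension is l, so the rank is at most l; the product reproduces Y + xi and leaves only
   the second-order term Z2 Di Z1. *)
pose Y' := (P *m diag_mx t + Z2) *m (Q^T + Di *m Z1).
have Y'E : Y' = Y + xi + Z2 *m Di *m Z1.
  have xiE : xi = P *m Z1 + Z2 *m Q^T by rewrite -[LHS](tan_proj_id xiT) tan_projE.
  rewrite /Y' mulmxDl !mulmxDr -(rsvd_E hY) mulmxA -(mulmxA P) (diag_inv hY) mulmx1.
  by rewrite (mulmxA Z2) [in RHS]xiE !addrA.
have Y'k : (\rank Y' <= k)%N.
  apply: leq_trans lk; apply: leq_trans (mxrankM_maxl _ _) _; exact: rank_leq_col.
have h := threshold_dist (Y + xi) Y'k.
have {}h : frob_norm (Y + xi - H (Y + xi)) <= frob_norm (Z2 *m Di *m Z1).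
  by move: h; rewrite Y'E opprD addrA subrr sub0r frob_normN.
apply: le_trans (ler_wpM2l (ltW s0) h) _.
apply: le_trans (ler_wpM2l (ltW s0) (frob_norm_mul _ _)) _.
rewrite mulrA expr2; apply: ler_pM; rewrite ?mulr_ge0 ?frob_norm_ge0 ?(ltW s0) //.
  have hd : frob_norm (Z2 *m Di) <= sg'^-1 * frob_norm Z2.
    apply: frob_norm_mul_diag_le; first by rewrite invr_ge0 ltW.
    move=> i; rewrite mxE ger0_norm ?invr_ge0 ?(ltW (rsvd_gt0 hY i)) //.
    by rewrite lef_pV2 // posrE // (rsvd_gt0 hY).
  apply: le_trans (ler_wpM2l (ltW s0) hd) _; rewrite mulrA mulfV ?gt_eqF // mul1r.
  apply: le_trans (coisometryr_norm QQ _) _; exact: ker_proj_norm.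
exact: coisometry_norm.
Qed.

(** X is tested on the i-th left singular vector of Y. One |X - Y| pays for replacing Y by X, the
    other for the part of the vector outside the column space of X, where sg is no lower bound. *)
Lemma rsvd_perturb Y l (P : 'M[R]_(n, l)) t Q i : is_reduced_svd Y P t Q -> (l <= k)%N ->
  sg <= t 0 i + 2 * frob_norm (X - Y).
Proof.
move=> hY lk; have PP := rsvd_U hY; have QQ := rsvd_V hY.
pose x : 'rV[R]_l := delta_mx 0 i.
have x1 : frob_norm x = 1 by exact: frob_norm_delta.
have tE : frob_norm (x *m P^T *m Y) = t 0 i.
  rewrite {1}(rsvd_E hY) -!mulmxA (mulmxA P^T) PP mul1mx mulmxA isometryr_norm //.
  have -> : x *m diag_mx t = t 0 i *: x.
    apply/rowP => j; rewrite mul_mx_diag !mxE eqxx /=; case: eqP => [->|_]; by rewrite ?mulr0 ?mul0r ?mulr1 ?mul1r.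
  by rewrite frob_normZ x1 mulr1 ger0_norm // ltW // (rsvd_gt0 hY).
have xP : frob_norm (x *m P^T) = 1 by rewrite isometryr_norm.
have h1 := rsvd_lower svdX (x *m P^T) (ltW sg0) sgs.
have h2 : frob_norm (x *m P^T *m X) <= t 0 i + frob_norm (X - Y).
  have -> : x *m P^T *m X = x *m P^T *m Y + x *m P^T *m (X - Y).
    by rewrite -mulmxDr addrC subrK.
  apply: le_trans (frob_normD _ _) _; rewrite tE lerD2l.
  by apply: le_trans (frob_norm_mul _ _) _; rewrite xP mul1r.
have h3 := gap_le_sym svdX sg0 sgs PP lk (rsvd_ker hY).
have h4 : 1 <= frob_norm (x *m P^T *m U) + frob_norm (ker_proj U *m P).
  rewrite -{1}xP.
  have e : x *m P^T = x *m P^T *m U *m U^T + x *m P^T *m ker_proj U.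
    by rewrite ker_projE mulmxBr mulmx1 /ran_proj !mulmxA addrC subrK.
  rewrite {1}e; apply: le_trans (frob_normD _ _) _.
  rewrite isometryr_norm // lerD2l -mulmxA; apply: le_trans (frob_norm_mul _ _) _.
  by rewrite x1 mul1r -frob_norm_tr trmx_mul trmxK ker_proj_tr.
have := ler_wpM2l (ltW sg0) h4; lra.
Qed.

End Step.

(** * Local convergence *)

Section LocalStep.
Context {R : realType}.
Variables (n r k : nat) (X : 'M[R]_n) (U V : 'M[R]_(n, k)) (s : 'rV[R]_k) (sg : R).
Variable H : 'M[R]_n -> 'M[R]_n.
Hypothesis kr : k = r.
Hypothesis rn : (0 < r <= n)%N.
Hypothesis HH : forall Z, is_hard_threshold r Z (H Z).
Hypothesis svdX : is_reduced_svd X U s V.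
Hypothesis sg0 : 0 < sg.
Hypothesis sgs : forall i, sg <= s 0 i.
Variables (Om : seq ('I_n * 'I_n)) (p n2 eps' : R).
Hypothesis p0 : 0 < p.
Hypothesis n21 : 81 <= n2.
Hypothesis Omp : (size Om)%:R = p * n2.
Hypothesis rip : forall A B : 'M[R]_n,
  `|frob_dot (tan_proj U V A) (sampling_op Om (tan_proj U V B))
     - p * frob_dot (tan_proj U V A) (tan_proj U V B)|
  <= p * eps' * (frob_norm A * frob_norm B).

Let UU := rsvd_U svdX.
Let VV := rsvd_V svdX.
(** p is the sampling rate and n2 will be n^2; the form measures how far the sampling operator is
    from p times the identity. *)
Let defect (A B : 'M[R]_n) := frob_dot A (sampling_op Om B) - p * frob_dot A B.

Let defect_le A B : `|defect A B| <= p * (2 * n2) * (frob_norm A * frob_norm B).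
Proof.
rewrite /defect; apply: le_trans (ler_normB _ _) _.
have := sampling_le Om A B; rewrite Omp => h1.
have h2 := ler_wpM2l (ltW p0) (frob_CS A B).
rewrite normrM (gtr0_norm p0).
have h3 : p * (frob_norm A * frob_norm B) <= n2 * (p * (frob_norm A * frob_norm B)).
  by rewrite ler_peMl ?mulr_ge0 ?frob_norm_ge0 ?(ltW p0) //; move: n21; lra.
lra.
Qed.

Let defectDl A A' B : defect (A + A') B = defect A B + defect A' B.
Proof. by rewrite /defect !frob_dotDl; ring. Qed.

Let defectDr A B B' : defect A (B + B') = defect A B + defect A B'.
Proof. by rewrite /defect sampling_opD !frob_dotDr; ring. Qed.

Section AtPoint.
Variables (Y : 'M[R]_n) (l : nat) (P : 'M[R]_(n, l)) (t : 'rV[R]_l) (Q : 'M[R]_(n, l)).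
Hypothesis svdY : is_reduced_svd Y P t Q.
Hypothesis lk : (l <= k)%N.

Let PP := rsvd_U svdY.
Let QQ := rsvd_V svdY.
Let e := frob_norm (X - Y).
Let e0 : 0 <= e. Proof. exact: frob_norm_ge0. Qed.

(** A tangent matrix at Y is P P^T A + ([ker_proj P] A Q) Q^T; in each term P or Q meets a normal
    projection at X, which produces one subspace gap. *)
Lemma tangent_gap A : ker_proj P *m A *m ker_proj Q = 0 ->
  sg * frob_norm (ker_proj U *m A *m ker_proj V) <= 2 * e * frob_norm A.
Proof.
move=> AT.
have g1 := gap_le_sym svdX sg0 sgs PP lk (rsvd_ker svdY).
have g2 : sg * frob_norm (ker_proj V *m Q) <= e.
  have := gap_le_sym (rsvd_tr svdX) sg0 sgs QQ lk (rsvd_ker (rsvd_tr svdY)).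
  by rewrite -linearB /= frob_norm_tr.
have AE : ker_proj U *m A *m ker_proj V =
   (ker_proj U *m P) *m (P^T *m A *m ker_proj V)
   + (ker_proj U *m (ker_proj P *m A *m Q)) *m (ker_proj V *m Q)^T.
  rewrite trmx_mul ker_proj_tr -{1}(tan_proj_id AT) tan_projE.
  by rewrite mulmxDr mulmxDl !mulmxA.
have a0 := frob_norm_ge0 A.
have h1 : frob_norm (P^T *m A *m ker_proj V) <= frob_norm A.
  by apply: le_trans (ker_projr_norm VV _) _; exact: coisometry_norm.
have h2 : frob_norm (ker_proj U *m (ker_proj P *m A *m Q)) <= frob_norm A.
  apply: le_trans (ker_proj_norm UU _) _; apply: le_trans (coisometryr_norm QQ _) _.
  exact: ker_proj_norm.
rewrite AE; apply: le_trans (ler_wpM2l (ltW sg0) (frob_normD _ _)) _.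
have h3 := frob_norm_mul (ker_proj U *m P) (P^T *m A *m ker_proj V).
have h4 := frob_norm_mul (ker_proj U *m (ker_proj P *m A *m Q)) (ker_proj V *m Q)^T.
rewrite frob_norm_tr in h4.
have h5 : sg * frob_norm (ker_proj U *m P) * frob_norm (P^T *m A *m ker_proj V) <= e * frob_norm A.
  by apply: ler_pM; rewrite ?mulr_ge0 ?frob_norm_ge0 ?(ltW sg0).
have h6 : sg * frob_norm (ker_proj V *m Q) * frob_norm (ker_proj U *m (ker_proj P *m A *m Q)) <= e * frob_norm A.
  by apply: ler_pM; rewrite ?mulr_ge0 ?frob_norm_ge0 ?(ltW sg0).
have h7 := ler_wpM2l (ltW sg0) h3.
have h8 := ler_wpM2l (ltW sg0) h4.
lra.
Qed.

Variables (eps : R).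
Hypothesis eps_gt0 : 0 < eps.
Hypothesis eps_le : eps <= 100^-1.
Hypothesis eps'_le : 2 * eps' <= eps.
Hypothesis e_le : 16 * n2 * e <= eps * sg.

(** A and B are split into tangent and normal parts at X. The tangent pair uses the isometry at X,
    with constant eps' <= eps / 2. The others use the crude bound 2 p n2 against gaps 2 e / sg, and
    16 n2 e <= eps sg pays for both with the other half. *)
Lemma rip_transfer A B : ker_proj P *m A *m ker_proj Q = 0 ->
  ker_proj P *m B *m ker_proj Q = 0 ->
  `|defect A B| <= p * eps * (frob_norm A * frob_norm B).
Proof.
move=> AT BT.
pose a := ker_proj U *m A *m ker_proj V; pose b := ker_proj U *m B *m ker_proj V.
have ga := tangent_gap AT; have gb := tangent_gap BT; rewrite -/a -/b in ga gb.
have defectE : defect A B = defect (tan_proj U V A) (tan_proj U V B)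
   + defect (tan_proj U V A) b + defect a B.
  have AE : A = tan_proj U V A + a by rewrite /tan_proj subrK.
  have BE : B = tan_proj U V B + b by rewrite /tan_proj subrK.
  by rewrite {1}AE defectDl; congr (_ + _); rewrite {1}BE defectDr.
have h1 := rip A B; rewrite -/(defect _ _) in h1.
have h2 := defect_le (tan_proj U V A) b.
have h3 := defect_le a B.
have h4 : `|defect A B| <= p * eps' * (frob_norm A * frob_norm B)
   + p * (2 * n2) * (frob_norm A * frob_norm b + frob_norm a * frob_norm B).
  rewrite defectE; apply: le_trans (ler_normD _ _) _.
  have := ler_normD (defect (tan_proj U V A) (tan_proj U V B)) (defect (tan_proj U V A) b).
  have h5 : frob_norm (tan_proj U V A) * frob_norm b <= frob_norm A * frob_norm b.
    by rewrite ler_wpM2r ?frob_norm_ge0 // tan_proj_norm.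
  have pn : 0 <= p * (2 * n2) by rewrite !mulr_ge0 ?(ltW p0) //; move: n21; lra.
  have := ler_wpM2l pn h5; lra.
have A0 := frob_norm_ge0 A; have B0 := frob_norm_ge0 B.
have AB := mulr_ge0 A0 B0.
rewrite -(ler_pM2l sg0).
have h5 : sg * (frob_norm A * frob_norm b + frob_norm a * frob_norm B)
   <= 4 * e * (frob_norm A * frob_norm B).
  have := ler_wpM2l A0 gb; have := ler_wpM2r B0 ga; lra.
have pn : 0 <= p * (2 * n2) by rewrite !mulr_ge0 ?(ltW p0) //; move: n21; lra.
have h6 := ler_wpM2l pn h5.
have h7 := ler_wpM2l (ltW sg0) h4.
have pAB := mulr_ge0 (ltW p0) AB.
have h8 := ler_wpM2r pAB e_le.
have h9 := ler_wpM2r (mulr_ge0 (ltW sg0) pAB) eps'_le.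
lra.
Qed.

Variables (kappa1 b : R) (Dq : 'M[R]_n).
Let E := X - Y.
Let D := proj_tangent Y (sampling_op Om E).
(** One form serves both algorithms: b = 0 is a gradient step or a restart; otherwise Dq is the
    projected previous direction and b the conjugate gradient weight. *)
Let Dir := D + b *: Dq.
Let alpha := frob_dot D Dir / frob_dot Dir (sampling_op Om Dir).
Hypothesis k0 : 0 <= kappa1.
Hypothesis k1 : kappa1 + 13 * eps <= 1.
Hypothesis Dq_tan : ker_proj P *m Dq *m ker_proj Q = 0.
Hypothesis b_spec : b = 0 \/ [/\ Dq != 0,
  `|frob_dot D Dq| <= kappa1 * (frob_norm D * frob_norm Dq)
  & b = - (frob_dot D (sampling_op Om Dq) / frob_dot Dq (sampling_op Om Dq))].

Let DE : D = tan_proj P Q (sampling_op Om E).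
Proof. exact: proj_tangentE svdY _. Qed.

Let D_tan : ker_proj P *m D *m ker_proj Q = 0.
Proof. by rewrite DE ker_tan_proj. Qed.

Let Dir_tan : ker_proj P *m Dir *m ker_proj Q = 0.
Proof.
by rewrite /Dir mulmxDr mulmxDl D_tan add0r -scalemxAr -scalemxAl Dq_tan scaler0.
Qed.

Let F := tan_proj P Q E.
Let N := ker_proj P *m E *m ker_proj Q.

Let F_tan : ker_proj P *m F *m ker_proj Q = 0.
Proof. exact: ker_tan_proj. Qed.

Let FN : E = F + N.
Proof. by rewrite /F /tan_proj subrK. Qed.

Let F_le : frob_norm F <= e.
Proof. exact: tan_proj_norm. Qed.

(** The normal error is quadratic in e, so it stays small after multiplication by n2. *)
Let N_le : 16 * n2 * frob_norm N <= eps * e.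
Proof.
have h := normal_le svdX sg0 sgs PP QQ (rsvd_ker svdY) (rsvd_kerr svdY).
have NE : ker_proj P *m X *m ker_proj Q = N.
  by rewrite /N /E mulmxBr (rsvd_ker svdY) subr0.
rewrite NE -/e in h; rewrite -(ler_pM2l sg0).
have n20 : 0 <= 16 * n2 by move: n21; lra.
have := ler_wpM2l n20 h; have := ler_wpM2r e0 e_le; rewrite expr2; lra.
Qed.

(** Tested against a tangent matrix, the difference is the isometry defect on F plus the sampled
    normal error, for which the crude bound suffices. *)
Let grad_le : frob_norm (D - p *: F) <= p * (2 * eps * e).
Proof.
have pe : 0 <= p * (2 * eps * e) by rewrite !mulr_ge0 // ltW.
have D_F_tan : ker_proj P *m (D - p *: F) *m ker_proj Q = 0.
  by rewrite mulmxBr mulmxBl D_tan -scalemxAr -scalemxAl F_tan scaler0 subr0.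
apply: frob_norm_dual => // B.
pose B' := tan_proj P Q B.
have B'B : frob_norm B' <= frob_norm B by exact: tan_proj_norm.
have BT : ker_proj P *m B' *m ker_proj Q = 0 by exact: ker_tan_proj.
have -> : frob_dot (D - p *: F) B = frob_dot (D - p *: F) B'.
  by rewrite /B' -tan_proj_adj (tan_proj_id D_F_tan).
have -> : frob_dot (D - p *: F) B' = defect B' F + frob_dot B' (sampling_op Om N).
  rewrite frob_dotBl frob_dotZl (frob_dotC F) DE tan_proj_adj (tan_proj_id BT).
  by rewrite FN sampling_opD frob_dotDl -!(frob_dotC B') /defect; ring.
have h1 := rip_transfer BT F_tan.
have h2 := sampling_le Om B' N; rewrite Omp in h2.
have b0 := frob_norm_ge0 B'.
have h3 := ler_norm (defect B' F).
have h4 := ler_norm (frob_dot B' (sampling_op Om N)).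
have pb := mulr_ge0 (ltW p0) b0.
have h5 := ler_wpM2l (mulr_ge0 pb (ltW eps_gt0)) F_le.
have h6 := ler_wpM2l pb N_le.
have h7 := ler_wpM2l pe B'B.
have h8 : 0 <= p * frob_norm B' * (eps * e) by rewrite !mulr_ge0 // ltW.
lra.
Qed.

(** The numerator of the weight is close to p <D, Dq>, which the restart condition bounds through
    kappa1; the denominator is at least p (1 - eps) |Dq|^2. *)
Let bDq_le : (1 - eps) * frob_norm (b *: Dq) <= (kappa1 + eps) * frob_norm D.
Proof.
have d0 := frob_norm_ge0 D.
case: b_spec => [->|[Dq0 DDq bE]].
  by rewrite scale0r frob_norm0 mulr0 mulr_ge0 // addr_ge0 // ltW.
have q0 : 0 < frob_norm Dq by rewrite frob_norm_gt0.
have h1 := rip_transfer Dq_tan Dq_tan; rewrite /defect -frob_norm_sqr in h1.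
have h2 := rip_transfer D_tan Dq_tan; rewrite /defect in h2.
set y := frob_dot Dq (sampling_op Om Dq) in bE h1.
set x := frob_dot D (sampling_op Om Dq) in bE h2.
set q := frob_norm Dq in q0 h1 h2 DDq *; set d := frob_norm D in d0 h2 DDq *.
have yl : p * (1 - eps) * q ^+ 2 <= y.
  by move: h1; rewrite ler_norml => /andP[+ _]; lra.
have y0 : 0 < y.
  apply: lt_le_trans yl; rewrite !mulr_gt0 ?exprn_gt0 //; move: eps_le; lra.
have xl : `|x| <= p * (kappa1 + eps) * (d * q).
  have -> : x = (x - p * frob_dot D Dq) + p * frob_dot D Dq by rewrite subrK.
  apply: le_trans (ler_normD _ _) _; rewrite normrM (gtr0_norm p0).
  have := ler_wpM2l (ltW p0) DDq; lra.
have be : `|b| * y = `|x|.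
  by rewrite bE normrN normrM normfV (gtr0_norm y0) mulfVK ?gt_eqF.
have h3 := ler_wpM2l (normr_ge0 b) yl.
rewrite frob_normZ -/q -(ler_pM2l (mulr_gt0 p0 q0)); lra.
Qed.

(** The algorithms stall only at the solution: if D and b Dq cancel they have equal norm, which
    kappa1 + eps < 1 - eps forbids unless D = 0, and then F and N are too small for a nonzero
    error. *)
Let Dir0 : Dir = 0 -> X = Y.
Proof.
move=> z; have bD : frob_norm (b *: Dq) = frob_norm D.
  by move/eqP: z; rewrite /Dir addr_eq0 => /eqP ->; rewrite frob_normN.
have := bDq_le; rewrite bD => h.
have D0 : frob_norm D = 0.
  apply/eqP; rewrite eq_le frob_norm_ge0 andbT leNgt; apply/negP => d0.
  move: h; rewrite ler_pM2r //; move: k1 eps_gt0; lra.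
have D0' : D = 0 by apply/eqP; rewrite -frob_norm_eq0 D0.
have := grad_le; rewrite D0' sub0r frob_normN frob_normZ (gtr0_norm p0) ler_pM2l // => fl.
have el : e <= frob_norm F + frob_norm N by rewrite /e -/E FN; exact: frob_normD.
have nn : frob_norm N <= n2 * frob_norm N.
  by rewrite ler_peMl ?frob_norm_ge0 //; move: n21; lra.
have ee : eps * e <= 100^-1 * e by rewrite ler_wpM2r.
have : e <= 0 by move: N_le e0; lra.
rewrite le_eqVlt ltNge frob_norm_ge0 orbF => /eqP e00.
by apply/eqP; rewrite -subr_eq0 -frob_norm_eq0 -/e e00.
Qed.

(** The weight makes Dq conjugate to Dir for the sampling form, so the denominator of alpha is also
    <D, P_Omega Dir>, close to p times the numerator; hence p alpha Dir is close to Dir. What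
    remains is b Dq, of relative size about kappa1, and the gradient error. *)
Let step_le : Dir != 0 ->
  frob_norm (alpha *: Dir - F) <= (kappa1 + 10 * eps) * e.
Proof.
move=> Dir_n0.
have r0 : 0 < frob_norm Dir by rewrite frob_norm_gt0.
have h1 := rip_transfer Dir_tan Dir_tan; rewrite /defect -frob_norm_sqr in h1.
have h2 := rip_transfer D_tan Dir_tan; rewrite /defect in h2.
have yx : frob_dot Dir (sampling_op Om Dir) = frob_dot D (sampling_op Om Dir).
  rewrite {1}/Dir frob_dotDl frob_dotZl.
  case: b_spec => [->|[Dq0 DDq bE]]; first by rewrite mul0r addr0.
  suff -> : frob_dot Dq (sampling_op Om Dir) = 0 by rewrite mulr0 addr0.
  rewrite /Dir sampling_opD sampling_opZ frob_dotDr frob_dotZr bE (sampling_adj _ Dq).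
  rewrite mulNr mulfVK ?subrr //.
  have q0 : 0 < frob_norm Dq by rewrite frob_norm_gt0.
  have := rip_transfer Dq_tan Dq_tan; rewrite /defect -frob_norm_sqr ler_norml => /andP[+ _].
  set y := frob_dot Dq _ => yl; rewrite gt_eqF //.
  have : 0 < p * (1 - eps) * frob_norm Dq ^+ 2.
    by rewrite !mulr_gt0 ?exprn_gt0 //; move: eps_le; lra.
  lra.
rewrite /alpha; set y := frob_dot Dir (sampling_op Om Dir) in yx h1 *.
rewrite -yx in h2.
set z := frob_dot D Dir in h2 *.
have d0 := frob_norm_ge0 D.
set r' := frob_norm Dir in r0 h1 h2; set d := frob_norm D in d0 h2.
have yl : p * (1 - eps) * r' ^+ 2 <= y.
  by move: h1; rewrite ler_norml => /andP[+ _]; lra.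
have y0 : 0 < y.
  by apply: lt_le_trans yl; rewrite !mulr_gt0 ?exprn_gt0 //; move: eps_le; lra.
have a1 : (1 - eps) * (`|p * (z / y) - 1| * r') <= eps * d.
  have e1 : `|p * (z / y) - 1| * y = `|y - p * z|.
    rewrite -{2}(gtr0_norm y0) -normrM mulrBl mul1r -normrN opprB; congr (`| _ |).
    by rewrite -mulrA mulfVK ?gt_eqF.
  have h3 := ler_wpM2l (normr_ge0 (p * (z / y) - 1)) yl.
  by rewrite -(ler_pM2l (mulr_gt0 p0 r0)); lra.
have dl : d <= p * ((1 + 2 * eps) * e).
  have -> : d = frob_norm ((D - p *: F) + p *: F) by rewrite subrK.
  apply: le_trans (frob_normD _ _) _; rewrite frob_normZ (gtr0_norm p0).
  have := ler_wpM2l (ltW p0) F_le; move: grad_le; lra.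
have main : p *: ((z / y) *: Dir - F) = (p * (z / y) - 1) *: Dir + b *: Dq + (D - p *: F).
  have gen u (X1 Y1 D1 F1 : 'M[R]_n) : X1 = D1 + Y1 ->
      p *: (u *: X1 - F1) = (p * u - 1) *: X1 + Y1 + (D1 - p *: F1).
    by move=> ->; apply/matrixP => i j; rewrite !mxE; ring.
  exact: gen.
have h5 : p * frob_norm ((z / y) *: Dir - F) <=
   `|p * (z / y) - 1| * r' + frob_norm (b *: Dq) + p * (2 * eps * e).
  rewrite -{1}(gtr0_norm p0) -frob_normZ main.
  apply: le_trans (frob_normD _ _) _; apply: lerD => //.
  by apply: le_trans (frob_normD _ _) _; rewrite frob_normZ.
rewrite -(ler_pM2l p0) -(@ler_pM2l _ (1 - eps)); last by move: eps_le; lra.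
have e1 : 0 < 1 - eps by move: eps_le; lra.
have h6 := ler_wpM2l (ltW e1) h5.
have h7 : (kappa1 + 2 * eps) * d <= (kappa1 + 2 * eps) * (p * ((1 + 2 * eps) * e)).
  by rewrite ler_wpM2l // addr_ge0 // mulr_ge0 // ltW.
have pe0 : 0 <= p * e by rewrite mulr_ge0 // ltW.
have h8 : (1 - eps) * (2 * eps) + (kappa1 + 2 * eps) * (1 + 2 * eps) <= (1 - eps) * (kappa1 + 10 * eps).
  have kk : kappa1 <= 1 by move: k1 eps_gt0; lra.
  have ke := ler_wpM2l (ltW eps_gt0) kk.
  have ee := ler_wpM2l (ltW eps_gt0) eps_le.
  move: eps_gt0; lra.
have h9 := ler_wpM2r pe0 h8.
have bd := bDq_le; rewrite -/d in bd; lra.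
Qed.

(** To the 10 eps of the steplength estimate, the normal error N adds one eps and thresholding
    another; the latter is quadratic because the singular values of Y stay above sg / 2. *)
Lemma local_step :
  frob_norm ((if Dir == 0 then Y else H (Y + alpha *: Dir)) - X) <=
    (kappa1 + 12 * eps) * frob_norm (Y - X).
Proof.
rewrite (frob_norm_distC Y X) -/e; case: eqP => [/Dir0 <-|/eqP Dir_n0].
  by rewrite subrr frob_norm0 mulr_ge0 // addr_ge0 // mulr_ge0 // ltW.
have sl := step_le Dir_n0.
set xi := alpha *: Dir in sl *.
have xi_tan : ker_proj P *m xi *m ker_proj Q = 0.
  by rewrite /xi -scalemxAr -scalemxAl Dir_tan scaler0.
have ne : frob_norm N <= n2 * frob_norm N.
  by rewrite ler_peMl ?frob_norm_ge0 //; move: n21; lra.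
have ee : 0 <= eps * e by rewrite mulr_ge0 // ltW.
have w1 : frob_norm (Y + xi - X) <= (kappa1 + 11 * eps) * e.
  have -> : Y + xi - X = (xi - F) - N.
    have gen (A B C F1 N1 : 'M[R]_n) : C - A = F1 + N1 -> A + B - C = B - F1 - N1.
      by move=> h; rewrite -[RHS]addrA -opprD -h opprB addrA (addrC B A).
    exact: gen FN.
  apply: le_trans (frob_normB _ _) _; move: N_le; lra.
have e81 : 1296 * e <= eps * sg.
  apply: le_trans e_le; have := ler_wpM2r e0 n21; lra.
have st i : sg / 2 <= t 0 i.
  have := rsvd_perturb svdX sg0 sgs i svdY lk; rewrite -/e.
  have := ler_wpM2r (ltW sg0) eps_le; move: e81 sg0; lra.
have s20 : 0 < sg / 2 by rewrite divr_gt0.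
have ret := retraction kr rn HH svdY lk s20 st xi_tan.
have xil : frob_norm xi <= 3 * e.
  have -> : xi = (xi - F) + F by rewrite subrK.
  apply: le_trans (frob_normD _ _) _.
  have := ler_wpM2r e0 k1; move: F_le sl ee e0; lra.
have ret2 : frob_norm (Y + xi - H (Y + xi)) <= eps * e.
  rewrite -(ler_pM2l s20); apply: le_trans ret _.
  apply: (@le_trans _ _ ((3 * e) ^+ 2)).
    by rewrite lerXn2r // nnegrE ?frob_norm_ge0 // mulr_ge0.
  have := ler_wpM2r e0 e81; have := mulr_ge0 e0 e0; rewrite exprMn expr2; lra.
have -> : H (Y + xi) - X = (Y + xi - X) - (Y + xi - H (Y + xi)).
  by rewrite opprB [RHS]addrC subrKA.
apply: le_trans (frob_normB _ _) _; lra.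
Qed.

End AtPoint.

End LocalStep.

Lemma geometric_cvg (R : realType) n (x : nat -> 'M[R]_n) (X : 'M[R]_n) (q e : R) :
  0 <= q -> q < 1 -> (forall l, frob_norm (x l - X) <= q ^+ l * e) ->
  x @ \oo --> X.
Proof.
move=> q0 q1 h; apply/cvg_ballP => eps eps0.
have /cvgrPdist_lt/(_ _ eps0) hn : (fun l => q ^+ l * e) @ \oo --> (0 : R).
  under eq_fun do rewrite mulrC.
  by apply: cvg_geometric; rewrite ger0_norm.
near=> l; split => // i j; rewrite /ball /=.
have hl : `|0 - q ^+ l * e| < eps by near: l.
have -> : X i j - x l i j = - (x l - X) i j by rewrite !mxE opprB.
rewrite normrN; apply: le_lt_trans (entry_le _ _ _) _.
apply: le_lt_trans (h l) _; apply: le_lt_trans (ler_norm _) _.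
by rewrite -normrN -sub0r.
Unshelve. all: by end_near.
Qed.

(** * Linear convergence of both algorithms *)

Section Convergence.
Context {R : realType}.
Variables (n r k : nat) (X : 'M[R]_n) (U V : 'M[R]_(n, k)) (s : 'rV[R]_k) (sg : R).
Variable H : 'M[R]_n -> 'M[R]_n.
Hypothesis kr : k = r.
Hypothesis rn : (0 < r <= n)%N.
Hypothesis HH : forall Z, is_hard_threshold r Z (H Z).
Hypothesis svdX : is_reduced_svd X U s V.
Hypothesis sg0 : 0 < sg.
Hypothesis sgs : forall i, sg <= s 0 i.
Variables (Om : seq ('I_n * 'I_n)) (p n2 : R).
Hypothesis p0 : 0 < p.
Hypothesis n21 : 81 <= n2.
Hypothesis Omp : (size Om)%:R = p * n2.
Variables (alg : algorithm R) (eps0 : R).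
Hypothesis valid : valid_parameters alg.
Hypothesis adm : admissible alg eps0.
Hypothesis rip : forall A B : 'M[R]_n,
  `|frob_dot (tan_proj U V A) (sampling_op Om (tan_proj U V B))
     - p * frob_dot (tan_proj U V A) (tan_proj U V B)|
  <= p * (eps0 / 80) * (frob_norm A * frob_norm B).
Variable X0 : 'M[R]_n.
Hypothesis X0_low : low_rank k X0.
Hypothesis X0_near : 16 * n2 * frob_norm (X - X0) <= eps0 / 40 * sg.

Let eps := eps0 / 40.
Let near Y := 16 * n2 * frob_norm (X - Y) <= eps * sg.

Lemma admissible_gt0 : 0 < eps0. Proof. by case: alg adm => [[]|? ? []]. Qed.

Let kappa := if alg is RestartedRCG k1 _ then k1 else 0.

Lemma kappa_ge0 : 0 <= kappa.
Proof. by rewrite /kappa; case: alg valid => [|k1 k2 []]. Qed.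

(** This is the room for the error terms: with eps = eps0 / 40 it yields kappa + 13 eps <= 1, and so
    a rate kappa + 12 eps < 1. *)
Lemma admissible_kappa : kappa + 4 * eps0 <= 1.
Proof.
have e0 := admissible_gt0; have k0 := kappa_ge0.
move: k0; rewrite /kappa; case: alg adm => [[_ h _] _|k1 k2 [_ h _] k0]; first by move: h; lra.
have := mulr_ge0 k0 (ltW e0); lra.
Qed.

Let eps_gt0 : 0 < eps. Proof. by rewrite divr_gt0 // admissible_gt0. Qed.
Let eps_le : eps <= 100^-1.
Proof. by rewrite /eps; move: admissible_kappa kappa_ge0; lra. Qed.
Let eps'_le : 2 * (eps0 / 80) <= eps. Proof. by rewrite /eps; lra. Qed.
Let k13 : kappa + 13 * eps <= 1.
Proof. by rewrite /eps; move: admissible_kappa admissible_gt0; lra. Qed.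

Let q := kappa + 12 * eps.
Let q0 : 0 <= q. Proof. by rewrite addr_ge0 ?kappa_ge0 // mulr_ge0 // ltW. Qed.
Let q1 : q < 1. Proof. by rewrite /q; move: k13 eps_gt0; lra. Qed.

Let step_next Y b Dq : low_rank k Y -> near Y -> tangent_space Y Dq ->
  let D := proj_tangent Y (sampling_op Om (X - Y)) in
  (b = 0 \/ [/\ Dq != 0,
    `|frob_dot D Dq| <= kappa * (frob_norm D * frob_norm Dq)
    & b = - (frob_dot D (sampling_op Om Dq) / frob_dot Dq (sampling_op Om Dq))]) ->
  let Dir := D + b *: Dq in
  let alpha := frob_dot D Dir / frob_dot Dir (sampling_op Om Dir) in
  let Y' := if Dir == 0 then Y else H (Y + alpha *: Dir) in
  [/\ low_rank k Y', frob_norm (Y' - X) <= q * frob_norm (Y - X) & near Y'].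
Proof.
move=> [l [P [t [Q [lk svdY]]]]] eY DqT D bE Dir alpha Y'.
have /(tangent_spaceP svdY) DqT' := DqT.
have h := local_step kr rn HH svdX sg0 sgs p0 n21 Omp rip svdY lk eps_gt0
  eps_le eps'_le eY kappa_ge0 k13 DqT' bE.
rewrite -/D -/Dir -/alpha -/Y' -/q in h.
split=> //.
  by rewrite /Y'; case: ifP => _; [exists l, P, t, Q|exact: (threshold_low_rank kr HH)].
rewrite /near frob_norm_distC; apply: le_trans eY.
have n20 : 0 <= 16 * n2 by move: n21; lra.
apply: ler_wpM2l => //; rewrite (frob_norm_distC X Y); apply: le_trans h _.
by rewrite ler_piMl ?frob_norm_ge0 // ltW.
Qed.

Let low_tangent (Y Z : 'M[R]_n) : low_rank k Y -> tangent_space Y (proj_tangent Y Z).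
Proof.
move=> [l [P [t [Q [lk svdY]]]]]; apply/(tangent_spaceP svdY).
by rewrite (proj_tangentE svdY) ker_tan_proj ?(rsvd_U svdY) ?(rsvd_V svdY).
Qed.

Let inv (Y : 'M[R]_n) l := [/\ low_rank k Y, near Y & frob_norm (Y - X) <= q ^+ l * frob_norm (X0 - X)].

Let inv_next Y Y' l : inv Y l ->
  [/\ low_rank k Y', frob_norm (Y' - X) <= q * frob_norm (Y - X) & near Y'] -> inv Y' l.+1.
Proof.
move=> [_ _ h] [l' h' n']; split=> //; rewrite exprS -mulrA.
by apply: le_trans h' _; rewrite ler_wpM2l.
Qed.

Lemma alg_cvg : alg_iter alg H Om X X0 @ \oo --> X.
Proof.
apply: (geometric_cvg (e := frob_norm (X0 - X)) q0 q1) => l.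
suff : inv (alg_iter alg H Om X X0 l) l by case.
have i0 : inv X0 0 by split=> //; rewrite expr0 mul1r.
rewrite /alg_iter; case E: alg => [|k1 k2].
  rewrite /rgrad_iter; elim: l => [//|l IH]; rewrite iterS.
  set Y := iter l _ X0 in IH *; case: (IH) => Yl Yn _.
  apply: (inv_next IH); rewrite /rgrad_step.
  have T0 : tangent_space Y 0.
    case: Yl => l' [P [t [Q [_ svdY]]]]; apply/(tangent_spaceP svdY).
    by rewrite mulmx0 mul0mx.
  have := step_next Yl Yn T0 (or_introl (erefl 0)).
  by rewrite /= scaler0 addr0 frob_norm_sqr.
rewrite /rcg_iter; elim: l => [//|l IH].
have -> : rcg_state H Om X X0 k1 k2 l.+1 = rcg_step H Om X k1 k2 l (rcg_state H Om X X0 k1 k2 l) by [].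
case ES: (rcg_state H Om X X0 k1 k2 l) IH => [Y Pp] /= IH.
case: (IH) => Yl Yn _; apply: (inv_next IH).
set D := proj_tangent Y _; set Q := proj_tangent Y Pp.
set b := (if l == 0%N then 0 else _).
have QT : tangent_space Y Q by exact: low_tangent.
have DT : tangent_space Y D by exact: low_tangent.
have bE : b = 0 \/ [/\ Q != 0,
    `|frob_dot D Q| <= kappa * (frob_norm D * frob_norm Q)
    & b = - (frob_dot D (sampling_op Om Q) / frob_dot Q (sampling_op Om Q))].
  rewrite /b; case: ifP => _; first by left.
  rewrite /rcg_weight; case: ifP => [/and4P[D0 Q0 DQ _]|_]; last by left.
  right; split=> //; rewrite /kappa E.
  by move: DQ; rewrite ler_pdivrMr // mulr_gt0 // frob_norm_gt0.
have := step_next Yl Yn QT bE; rewrite -/D /=.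
(* The new direction is already tangent, so the second projection does not change the steplength. *)
have -> : proj_tangent Y (D + b *: Q) = D + b *: Q.
  case: Yl => l' [P [t [Q' [_ svdY]]]].
  move/(tangent_spaceP svdY): QT => QT; move/(tangent_spaceP svdY): DT => DT.
  rewrite (proj_tangentE svdY) tan_proj_id //.
  by rewrite mulmxDr mulmxDl DT add0r -scalemxAr -scalemxAl QT scaler0.
by [].
Qed.

End Convergence.

(** * Random events *)

Section Vectors.
Context {R : realType}.

(** Flattening is an isometry, which lets matrices serve as the vectors of the Chernoff bound. *)
Lemma frob_dot_mxvec p q (A B : 'M[R]_(p, q)) :
  frob_dot (mxvec A)^T (mxvec B)^T = frob_dot A B.
Proof.
rewrite frob_dot_tr {1}/frob_dot big_ord1 (reindex _ (curry_mxvec_bij p q)) /=.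
rewrite /frob_dot pair_bigA /=; apply: eq_bigr => -[i j] _ /=.
by rewrite !mxvecE.
Qed.

Lemma frob_norm_mxvec p q (A : 'M[R]_(p, q)) : frob_norm (mxvec A)^T = frob_norm A.
Proof. by rewrite /frob_norm frob_dot_mxvec. Qed.

Lemma mxvec_surj p q (v : 'cV[R]_(p * q)) : exists A : 'M[R]_(p, q), v = (mxvec A)^T.
Proof. by exists (vec_mx v^T); rewrite vec_mxK trmxK. Qed.

Lemma frob_dot_col p q (A C : 'M[R]_(p, 1)) (B D : 'M[R]_(q, 1)) :
  frob_dot (col_mx A B) (col_mx C D) = frob_dot A C + frob_dot B D.
Proof. by rewrite !frob_dotE tr_col_mx mul_row_col linearD. Qed.

Lemma frob_dot_scalar a b : frob_dot (a%:M : 'M[R]_1) b%:M = a * b.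
Proof. by rewrite /frob_dot !big_ord1 !mxE eqxx !mulr1n. Qed.

End Vectors.

Section Events.
Context {R : realType} (n m : nat).
Variables (J : {set 'I_m}) (Om : m.-tuple ('I_n * 'I_n) -> seq ('I_n * 'I_n)).
Hypothesis OmJ : forall w (F : 'I_n * 'I_n -> R),
  \sum_(x <- Om w) F x = \sum_(k in J) F (tnth w k).
Hypothesis n0 : (0 < n)%N.
Hypothesis J0 : (0 < #|J|)%N.

Let M : R := #|{: m.-tuple ('I_n * 'I_n)}|%:R.
Let n2 : R := n%:R ^+ 2.

Let cardI : #|{: 'I_n * 'I_n}|%:R = n2.
Proof. by rewrite card_prod card_ord natrM /n2 expr2. Qed.

Let I0 : (0 < #|{: 'I_n * 'I_n}|)%N.
Proof. by rewrite card_prod card_ord muln_gt0 n0. Qed.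

Let n2_gt0 : 0 < n2. Proof. by rewrite -cardI ltr0n. Qed.

Let J_gt0 : 0 < #|J|%:R :> R. Proof. by rewrite ltr0n. Qed.

(** J is one group or the whole sample, and the scaling n^2 / |J| makes the sum unbiased. Q
    abstracts the event, so each application only has to derive it from suitable test vectors x and
    y. *)
Lemma chernoff_sampling d (a : 'I_n * 'I_n -> 'cV[R]_d) K B p delta :
  0 <= K -> (forall x, frob_dot (a x) (a x) <= K) ->
  (forall v, \sum_x frob_dot (a x) v ^+ 2 <= B * frob_dot v v) ->
  (0 < p)%N -> 0 < B -> 0 < delta -> delta <= 1 ->
  64 * p%:R * n2 * K <= delta ^+ 2 * (#|J|%:R * B) ->
  forall Q : m.-tuple ('I_n * 'I_n) -> Prop,
  (forall w, (forall x y : 'cV[R]_d,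
     `|n2 / #|J|%:R * \sum_(z <- Om w) (frob_dot (a z) x * frob_dot (a z) y)
        - \sum_z (frob_dot (a z) x * frob_dot (a z) y)|
      <= delta * B * (frob_norm x * frob_norm y)) -> Q w) ->
  \sum_(w : m.-tuple ('I_n * 'I_n) | `[< ~ Q w >]) 1 <= M * (d%:R * 8^-1 ^+ p).
Proof.
move=> K0 aK aB p0 B0 d0 d1 h Q hQ.
have := @matrix_chernoff R _ m d a K B J I0 (ltW B0) K0 aK aB p delta p0 B0 J0 d0 d1.
rewrite cardI => /(_ h); apply: le_trans.
rewrite [leRHS]big_mkcond [leLHS]big_mkcond /=; apply: ler_sum => w _.
case: asboolP => nQ; case: asboolP => // nn; exfalso; apply: nn => good; apply: nQ.
apply: hQ => x y; have := good x y; rewrite OmJ.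
set s := \sum_(k in J) _; set g := \sum_z _ => hg.
have -> : n2 / #|J|%:R * s - g = #|J|%:R^-1 * (n2 * s - #|J|%:R * g).
  by rewrite mulrBr mulKf ?gt_eqF // mulrA (mulrC n2).
rewrite normrM ger0_norm ?invr_ge0 ?(ltW J_gt0) // mulrC ler_pdivrMr //.
by apply: le_trans hg _; rewrite le_eqVlt; apply/orP; left; apply/eqP; ring.
Qed.

(** The vectors are the flattened P_T(e_i e_j^T). Their squared norms are at most 2 c^2, and their
    squared products with A sum to |P_T A|^2, so B = 1. *)
Lemma rip_event k (U V : 'M[R]_(n, k)) c p delta :
  U^T *m U = 1%:M -> V^T *m V = 1%:M ->
  (forall i, frob_norm (row i U) <= c) -> (forall i, frob_norm (row i V) <= c) ->
  (0 < p)%N -> 0 < delta -> delta <= 1 ->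
  64 * p%:R * n2 * (2 * c ^+ 2) <= delta ^+ 2 * #|J|%:R ->
  \sum_(w : m.-tuple ('I_n * 'I_n) | `[< ~ forall A B : 'M[R]_n,
    `|frob_dot (tan_proj U V A) (sampling_op (Om w) (tan_proj U V B))
       - #|J|%:R / n2 * frob_dot (tan_proj U V A) (tan_proj U V B)|
    <= #|J|%:R / n2 * delta * (frob_norm A * frob_norm B) >]) 1
  <= M * ((n * n)%:R * 8^-1 ^+ p).
Proof.
move=> UU VV Uc Vc p0 d0 d1 h.
pose a (x : 'I_n * 'I_n) : 'cV[R]_(n * n) := (mxvec (tan_proj U V (delta_mx x.1 x.2)))^T.
have aE x A : frob_dot (a x) (mxvec A)^T = tan_proj U V A x.1 x.2.
  by rewrite /a frob_dot_mxvec tan_proj_adj frob_dotC frob_dot_delta.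
have sumE A B : \sum_x (tan_proj U V A x.1 x.2 * tan_proj U V B x.1 x.2)
    = frob_dot (tan_proj U V A) (tan_proj U V B).
  by rewrite /frob_dot pair_bigA.
apply: (@chernoff_sampling _ a (2 * c ^+ 2) 1 p delta) => //; rewrite ?mulr1 //.
- by rewrite mulr_ge0 // sqr_ge0.
- by move=> x; rewrite /a frob_dot_mxvec -frob_norm_sqr tan_proj_delta.
- move=> v; have [A ->] := mxvec_surj v; rewrite mul1r frob_dot_mxvec.
  under eq_bigr => x _ do rewrite aE expr2.
  by rewrite sumE -frob_norm_ler tan_proj_norm.
move=> w good A B; have := good (mxvec A)^T (mxvec B)^T.
rewrite !frob_norm_mxvec.
under eq_bigr => x _ do rewrite !aE.
under [X in _ - X]eq_bigr => x _ do rewrite !aE.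
rewrite sumE -sampling_dot => hg.
have j0 : 0 < #|J|%:R / n2 by rewrite divr_gt0.
move: hg; set u := frob_dot _ (sampling_op _ _); set v := frob_dot _ _ => hg.
have -> : u - #|J|%:R / n2 * v = #|J|%:R / n2 * (n2 / #|J|%:R * u - v).
  by field; rewrite !gt_eqF.
by rewrite normrM (gtr0_norm j0) -[leRHS]mulrA ler_pM2l.
Qed.

(** The scalar E_ij / |E| is appended to P_T(e_i e_j^T). Between the test vectors (A, 0) and (0, 1)
    the form is then <P_T A, E> / |E|, sampled or averaged, and their difference is the gradient
    error. Rows at most 2 c and entries at most 6 c |E| give K = 8 c^2 + 36 c^2, and B = 2. *)
Lemma step_event k (P Q : 'M[R]_(n, k)) (E : 'M[R]_n) c p delta :
  P^T *m P = 1%:M -> Q^T *m Q = 1%:M ->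
  (forall i, frob_norm (row i P) <= 2 * c) -> (forall i, frob_norm (row i Q) <= 2 * c) ->
  (forall i j, `|E i j| <= 6 * c * frob_norm E) ->
  (0 < p)%N -> 0 < delta -> delta <= 1 ->
  64 * p%:R * n2 * (44 * c ^+ 2) <= delta ^+ 2 * (#|J|%:R * 2) ->
  \sum_(w : m.-tuple ('I_n * 'I_n) | `[< ~
    frob_norm (tan_proj P Q ((n2 / #|J|%:R) *: sampling_op (Om w) E) - tan_proj P Q E)
      <= 2 * delta * frob_norm E >]) 1
  <= M * ((n * n).+1%:R * 8^-1 ^+ p).
Proof.
move=> PP QQ Pc Qc Ec p0 d0 d1 h.
have [E0|E0] := eqVneq E 0.
  rewrite big1 ?mulr_ge0 // => w /asboolP; case; rewrite E0.
  have -> : sampling_op (Om w) 0 = 0 :> 'M[R]_n by apply/matrixP => i j; rewrite !mxE mul0r.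
  by rewrite scaler0 subrr frob_norm0 mulr0.
have Ep : 0 < frob_norm E by rewrite frob_norm_gt0.
pose a (x : 'I_n * 'I_n) : 'cV[R]_(n * n + 1) :=
  col_mx (mxvec (tan_proj P Q (delta_mx x.1 x.2)))^T (E x.1 x.2 / frob_norm E)%:M.
have aE x A y : frob_dot (a x) (col_mx (mxvec A)^T y%:M) =
   tan_proj P Q A x.1 x.2 + E x.1 x.2 / frob_norm E * y.
  by rewrite frob_dot_col frob_dot_mxvec tan_proj_adj frob_dotC frob_dot_delta frob_dot_scalar.
have sumE (A B : 'M[R]_n) : \sum_x (A x.1 x.2 * B x.1 x.2) = frob_dot A B.
  by rewrite /frob_dot pair_bigA.
have vE (v : 'cV[R]_(n * n + 1)) : exists A y, v = col_mx (mxvec A)^T y%:M.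
  have [A hA] := mxvec_surj (usubmx v); exists A, (dsubmx v 0 0).
  by rewrite -hA -mx11_scalar vsubmxK.
have -> : (n * n).+1 = (n * n + 1)%N by rewrite addn1.
apply: (@chernoff_sampling _ a (44 * c ^+ 2) 2 p delta) => //.
- by rewrite mulr_ge0 // sqr_ge0.
- move=> x; rewrite frob_dot_col frob_dot_mxvec frob_dot_scalar -frob_norm_sqr -expr2.
  have := tan_proj_delta PP QQ (Pc x.1) (Qc x.2).
  have : (E x.1 x.2 / frob_norm E) ^+ 2 <= 36 * c ^+ 2.
    have -> : 36 * c ^+ 2 = (6 * c) ^+ 2 by rewrite exprMn; ring.
    rewrite -real_normK ?num_real // lerXn2r ?nnegrE //.
      by have := le_trans (normr_ge0 _) (Ec x.1 x.2); rewrite pmulr_lge0.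
    by rewrite normrM normfV (gtr0_norm Ep) ler_pdivrMr.
  set u := frob_norm _ ^+ 2; rewrite exprMn; lra.
- move=> v; have [A [y ->]] := vE v.
  rewrite frob_dot_col frob_dot_mxvec frob_dot_scalar.
  have h1 x : frob_dot (a x) (col_mx (mxvec A)^T y%:M) ^+ 2 <=
    2 * (tan_proj P Q A x.1 x.2 * tan_proj P Q A x.1 x.2)
    + 2 * (y / frob_norm E) ^+ 2 * (E x.1 x.2 * E x.1 x.2).
    rewrite aE -subr_ge0.
    have := sqr_ge0 (tan_proj P Q A x.1 x.2 - E x.1 x.2 / frob_norm E * y); rewrite !expr2; lra.
  apply: le_trans (ler_sum _ (fun x _ => h1 x)) _.
  rewrite big_split /= -!mulr_sumr !sumE -!frob_norm_sqr.
  have -> : 2 * (y / frob_norm E) ^+ 2 * frob_norm E ^+ 2 = 2 * (y * y).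
    by rewrite -mulrA -exprMn mulfVK ?gt_eqF // expr2.
  have : frob_norm (tan_proj P Q A) ^+ 2 <= frob_norm A ^+ 2.
    by rewrite lerXn2r ?nnegrE ?frob_norm_ge0 // tan_proj_norm.
  lra.
move=> w good; set S := _ *: _.
apply: frob_norm_dual => [|A]; first by rewrite !mulr_ge0 ?frob_norm_ge0 // ltW.
have := good (col_mx (mxvec A)^T 0%:M) (col_mx (mxvec 0)^T 1%:M).
have -> : frob_norm (col_mx (mxvec A)^T (0%:M : 'M[R]_1)) = frob_norm A.
  by rewrite /frob_norm frob_dot_col frob_dot_mxvec frob_dot_scalar mulr0 addr0.
have -> : frob_norm (col_mx (mxvec (0 : 'M[R]_n))^T (1%:M : 'M[R]_1)) = 1.
  by rewrite /frob_norm frob_dot_col frob_dot_mxvec frob_dot_scalar frob_dot0l mulr1 add0r sqrtr1.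
have T0 : tan_proj P Q (0 : 'M[R]_n) = 0 by rewrite /tan_proj mulmx0 mul0mx subr0.
have aaE x : frob_dot (a x) (col_mx (mxvec A)^T 0%:M) * frob_dot (a x) (col_mx (mxvec 0)^T 1%:M)
    = (frob_norm E)^-1 * (tan_proj P Q A x.1 x.2 * E x.1 x.2).
  by rewrite !aE T0 mulr0 mulr1 addr0 [X in _ * (X + _)]mxE add0r; ring.
under eq_bigr => x _ do rewrite aaE.
under [X in _ - X]eq_bigr => x _ do rewrite aaE.
rewrite -!mulr_sumr sumE -sampling_dot mulr1 => hg.
have -> : frob_dot (tan_proj P Q S - tan_proj P Q E) A =
   n2 / #|J|%:R * frob_dot (tan_proj P Q A) (sampling_op (Om w) E) - frob_dot (tan_proj P Q A) E.
  rewrite -tan_projB tan_proj_adj frob_dotBl /S frob_dotZl.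
  by rewrite !(frob_dotC _ (tan_proj P Q A)).
apply: le_trans (ler_norm _) _.
move: hg; set u := frob_dot _ (sampling_op _ _); set v := frob_dot _ E => hg.
have e1 : n2 / #|J|%:R * u - v = frob_norm E * (n2 / #|J|%:R * ((frob_norm E)^-1 * u) - (frob_norm E)^-1 * v).
  by field; rewrite !gt_eqF.
rewrite e1 normrM (gtr0_norm Ep) mulrC.
have := ler_wpM2r (ltW Ep) hg; lra.
Qed.

(** With a = sqrt|X_ij| (e_i, sgn(X_ij) e_j) the off-diagonal block of a a^T is X_ij e_i e_j^T,
    which embeds an unsymmetric sum in a positive semidefinite one. Here |a|^2 <= 2 mu and the mean
    form is at most 2 n mu. *)
Lemma spectral_event (X : 'M[R]_n) mu p delta : (forall i j, `|X i j| <= mu) -> 0 < mu ->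
  (0 < p)%N -> 0 < delta -> delta <= 1 ->
  64 * p%:R * n%:R <= delta ^+ 2 * #|J|%:R ->
  \sum_(w : m.-tuple ('I_n * 'I_n) | `[< ~ forall u v : 'cV[R]_n,
    `|frob_dot (u *m v^T) ((n2 / #|J|%:R) *: sampling_op (Om w) X - X)|
      <= 2 * delta * n%:R * mu * (frob_norm u * frob_norm v) >]) 1
  <= M * ((n + n)%:R * 8^-1 ^+ p).
Proof.
move=> Xmu mu0 p0 d0 d1 h.
pose a (x : 'I_n * 'I_n) : 'cV[R]_(n + n) := Num.sqrt `|X x.1 x.2| *:
  col_mx (delta_mx x.1 0) (Num.sg (X x.1 x.2) *: delta_mx x.2 0).
have nR : 0 < n%:R :> R by rewrite ltr0n.
have dotd (u : 'cV[R]_n) i : frob_dot (delta_mx i 0) u = u i 0.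
  rewrite /frob_dot (bigD1 i) //= big_ord1 !mxE !eqxx mul1r big1 ?addr0 // => l li.
  by rewrite big_ord1 !mxE (negbTE li) mul0r.
have aE x u v : frob_dot (a x) (col_mx u v) =
   Num.sqrt `|X x.1 x.2| * (u x.1 0 + Num.sg (X x.1 x.2) * v x.2 0).
  by rewrite /a frob_dotZl frob_dot_col frob_dotZl !dotd.
have sg2 (x : R) : Num.sg x ^+ 2 <= 1 by rewrite sqr_sg; case: eqP => // _; exact: lexx.
have ss (x : R) : Num.sqrt `|x| ^+ 2 = `|x| by rewrite sqr_sqrtr.
apply: (@chernoff_sampling _ a (2 * mu) (2 * n%:R * mu) p delta) => //.
- by rewrite mulr_ge0 // ltW.
- move=> x; rewrite /a frob_dotZl frob_dotZr mulrA -expr2 ss frob_dot_col.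
  rewrite frob_dotZl frob_dotZr !dotd !mxE !eqxx mulr1.
  have := ler_pM (normr_ge0 _) _ (Xmu x.1 x.2) (_ : 1 + Num.sg (X x.1 x.2) ^+ 2 <= 2).
  rewrite expr2 (mulrC 2); apply; first by rewrite addr_ge0 // -expr2 sqr_ge0.
  by have := sg2 (X x.1 x.2); rewrite expr2; lra.
- move=> x; rewrite -[x]vsubmxK; set u := usubmx x; set v := dsubmx x.
  rewrite frob_dot_col.
  have h1 z : frob_dot (a z) (col_mx u v) ^+ 2 <= 2 * mu * (u z.1 0 ^+ 2 + v z.2 0 ^+ 2).
    rewrite aE exprMn ss (mulrC 2) -mulrA; apply: ler_pM; rewrite ?sqr_ge0 //.
    have := sqr_ge0 (u z.1 0 - Num.sg (X z.1 z.2) * v z.2 0).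
    have := ler_wpM2r (sqr_ge0 (v z.2 0)) (sg2 (X z.1 z.2)).
    rewrite !expr2; lra.
  apply: le_trans (ler_sum _ (fun z _ => h1 z)) _; rewrite -mulr_sumr.
  rewrite -(pair_bigA _ (fun i j => u i 0 ^+ 2 + v j 0 ^+ 2)) /=.
  have nrm (y : 'cV[R]_n) : frob_dot y y = \sum_i y i 0 ^+ 2.
    by apply: eq_bigr => i _; rewrite big_ord1 expr2.
  under eq_bigr => i _ do rewrite big_split /= sumr_const card_ord -nrm.
  rewrite big_split /= sumr_const card_ord sumrMnl -nrm.
  rewrite -[_ u u *+ n]mulr_natl -[_ v v *+ n]mulr_natl.
  rewrite le_eqVlt; apply/orP; left; apply/eqP; ring.
- by rewrite !mulr_gt0.
- have := ler_wpM2l (_ : 0 <= n%:R * mu * 2) h; rewrite !mulr_ge0 ?(ltW nR) ?(ltW mu0) // => /(_ isT).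
  rewrite /n2; lra.
move=> w good u v; have := good (col_mx u 0) (col_mx 0 v).
have -> : frob_norm (col_mx u (0 : 'cV[R]_n)) = frob_norm u.
  by rewrite /frob_norm frob_dot_col frob_dot0l addr0.
have -> : frob_norm (col_mx (0 : 'cV[R]_n) v) = frob_norm v.
  by rewrite /frob_norm frob_dot_col frob_dot0l add0r.
have aaE x : frob_dot (a x) (col_mx u 0) * frob_dot (a x) (col_mx 0 v)
    = (u *m v^T) x.1 x.2 * X x.1 x.2.
  rewrite !aE ![(0 : 'cV[R]_n) _ _]mxE mulr0 addr0 add0r.
  rewrite mxE big_ord1 [v^T _ _]mxE.
  have e : X x.1 x.2 = Num.sqrt `|X x.1 x.2| ^+ 2 * Num.sg (X x.1 x.2).
    by rewrite ss mulrC -numEsg.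
  by rewrite [in RHS]e; ring.
under eq_bigr => x _ do rewrite aaE.
under [X in _ - X]eq_bigr => x _ do rewrite aaE.
have -> : \sum_x ((u *m v^T) x.1 x.2 * X x.1 x.2) = frob_dot (u *m v^T) X.
  by rewrite /frob_dot pair_bigA.
rewrite -sampling_dot frob_dotBr frob_dotZr => hg; apply: le_trans hg _.
by rewrite le_eqVlt; apply/orP; left; apply/eqP; ring.
Qed.

End Events.

(** * Extreme singular values of a reduced decomposition *)

Section SingularValues.
Context {R : realType}.
Variables (n k : nat) (X : 'M[R]_n) (U V : 'M[R]_(n, k)) (s : 'rV[R]_k).
Hypothesis svdX : is_reduced_svd X U s V.
Hypothesis k0 : (0 < k)%N.

Let UU := rsvd_U svdX.
Let VV := rsvd_V svdX.

Let gramE : X^T *m X = V *m diag_mx (\row_i s 0 i ^+ 2) *m V^T.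
Proof.
rewrite {1 2}(rsvd_E svdX) !trmx_mul trmxK tr_diag_mx !mulmxA -(mulmxA _ U^T) UU mulmx1.
rewrite -(mulmxA V (diag_mx s)) mulmx_diag.
by congr (_ *m diag_mx _ *m _).
Qed.

Lemma singular_value_rsvd i : singular_value X (s 0 i).
Proof.
split; first exact/ltW/(rsvd_gt0 svdX).
apply/eigenvalueP; exists (row i V^T).
  rewrite gramE -row_mul !mulmxA VV mul1mx row_mul row_diag_mx mxE -scalemxAl.
  by rewrite -rowE.
apply/eqP => h0.
have : frob_norm (delta_mx 0 i : 'rV[R]_k) = 0.
  by rewrite -(isometryr_norm _ VV) -rowE h0 frob_norm0.
by rewrite frob_norm_delta => /eqP; rewrite oner_eq0.
Qed.

(** For t > 0 an eigenvector of X^T X cannot be orthogonal to all columns of V; a nonzero coordinate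
    along them selects the entry of s. *)
Lemma singular_valueP t : singular_value X t -> 0 < t -> exists i, t = s 0 i.
Proof.
move=> [_ /eigenvalueP[v vX v0]] t0.
have vV : v *m V *m diag_mx (\row_i s 0 i ^+ 2) = t ^+ 2 *: (v *m V).
  have := congr1 (mulmx^~ V) vX; rewrite gramE -scalemxAl.
  by rewrite -!mulmxA VV mulmx1.
have : v *m V != 0.
  apply: contra_neq v0 => h.
  have : t ^+ 2 *: v = 0 by rewrite -vX gramE !mulmxA h !mul0mx.
  by move/eqP; rewrite scaler_eq0 sqrf_eq0 gt_eqF //= => /eqP.
case/rV0Pn => i hi; exists i.
have /rowP/(_ i) := vV; rewrite mul_mx_diag !mxE mulrC.
rewrite mxE in hi; move/(mulIf hi)/eqP; rewrite eqrXn2 ?(ltW t0) ?(ltW (rsvd_gt0 svdX i)) // => /eqP ->.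
by [].
Qed.

Let s_le i : s 0 i <= frob_norm X.
Proof.
rewrite (rsvd_E svdX) isometryr_norm // isometry_norm //.
have -> : s 0 i = diag_mx s i i by rewrite mxE eqxx.
exact: le_trans (ler_norm _) (entry_le _ _ _).
Qed.

Let sv_le t : singular_value X t -> t <= frob_norm X.
Proof.
move=> h; have [t0|t0] := lerP t 0; first exact: le_trans (frob_norm_ge0 _).
by have [i ->] := singular_valueP h t0.
Qed.

Lemma sigma_max_ge i : s 0 i <= sigma_max X.
Proof.
apply: ub_le_sup; last exact: singular_value_rsvd.
by exists (frob_norm X) => t /= /sv_le.
Qed.

Lemma sigma_max_le : sigma_max X <= frob_norm X.
Proof.
apply: ge_sup; last by move=> t /= /sv_le.
by exists (s 0 (Ordinal k0)); exact: singular_value_rsvd.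
Qed.

Lemma sigma_min_le i : sigma_min X <= s 0 i.
Proof.
apply: ge_inf; last by split; [exact: singular_value_rsvd|exact: (rsvd_gt0 svdX)].
by exists 0 => t /= [_ /ltW].
Qed.

Lemma sigma_min_gt0 : 0 < sigma_min X.
Proof.
have jk : (k.-1 < k)%N by rewrite prednK.
apply: lt_le_trans (rsvd_gt0 svdX (Ordinal jk)) _.
apply: lb_le_inf.
  exists (s 0 (Ordinal jk)); split; first exact: singular_value_rsvd.
  exact: (rsvd_gt0 svdX).
move=> t /= [ht t0]; have [i ->] := singular_valueP ht t0.
by case: svdX => -[_ _ _ sd _] _; apply: sd; rewrite /= -ltnS prednK.
Qed.

End SingularValues.

(** * Initialization *)

Section Initial.
Context {R : realType}.
Variables (n r k : nat) (X : 'M[R]_n) (U V : 'M[R]_(n, k)) (s : 'rV[R]_k) (sg S : R).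
Variable H : 'M[R]_n -> 'M[R]_n.
Hypothesis kr : k = r.
Hypothesis rn : (0 < r <= n)%N.
Hypothesis HH : forall Z, is_hard_threshold r Z (H Z).
Hypothesis svdX : is_reduced_svd X U s V.
Hypothesis sg0 : 0 < sg.
Hypothesis sgs : forall i, sg <= s 0 i.
Hypothesis sS : forall i, s 0 i <= S.
Hypothesis sgS : sg <= S.

(** Optimality of H M against X gives |G|^2 <= 2 <G, D> for G = H M - X. As G has rank at most 2 k,
    duality of the nuclear and spectral norms bounds <G, D> by tau times the nuclear norm T of G,
    and T <= sqrt(2 k) |G|. *)
Lemma spectral_init M tau : 0 <= tau ->
  (forall u v : 'cV[R]_n, `|frob_dot (u *m v^T) (M - X)| <= tau * (frob_norm u * frob_norm v)) ->
  frob_norm (H M - X) ^+ 2 <= 8 * k%:R * tau ^+ 2.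
Proof.
move=> tau0 hD; set D := M - X in hD *; set G := H M - X.
have h1 : frob_norm G ^+ 2 <= 2 * frob_dot G D.
  have := threshold_dist kr rn HH M (eq_leq (rsvd_rank svdX)).
  have -> : M - H M = D - G by rewrite /D /G opprB addrA subrK.
  have gen (A B : 'M[R]_n) : frob_norm (A - B) <= frob_norm A ->
      frob_norm B ^+ 2 <= 2 * frob_dot B A.
    rewrite frob_norm_ler !(frob_dotBl, frob_dotBr) (frob_dotC A B) frob_norm_sqr; lra.
  exact: gen.
have [g [P [t [Q hG]]]] := rsvd_exists HH G.
have gk : (g <= k + k)%N.
  rewrite -(rsvd_rank hG) /G; apply: leq_trans (mxrank_add _ _) _.
  rewrite mxrank_opp (rsvd_rank svdX) leq_add2r.
  by have [l [P' [t' [Q' [lk h']]]]] := threshold_low_rank kr HH M; rewrite (rsvd_rank h').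
pose T := \sum_i t 0 i.
have h2 : frob_dot G D <= tau * T.
  rewrite {1}(rsvd_sum hG) frob_dot_suml /T mulr_sumr; apply: ler_sum => i _.
  rewrite frob_dotZl mulrC ler_wpM2r ?(ltW (rsvd_gt0 hG i)) //.
  apply: le_trans (ler_norm _) _; apply: le_trans (hD _ _) _.
  have c1 (W : 'M[R]_(n, g)) : W^T *m W = 1%:M -> frob_norm (col i W) = 1.
    by move=> WW; rewrite colE isometry_norm // frob_norm_delta.
  by rewrite !c1 ?mulr1 // ?(rsvd_U hG) ?(rsvd_V hG).
have h3 : T ^+ 2 <= (k + k)%:R * frob_norm G ^+ 2.
  have e1 : frob_norm G ^+ 2 = frob_dot t t.
    rewrite (rsvd_E hG) isometryr_norm ?(rsvd_V hG) // isometry_norm ?(rsvd_U hG) //.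
    rewrite frob_norm_sqr /frob_dot big_ord1; apply: eq_bigr => i _.
    rewrite (bigD1 i) //= big1 ?addr0 ?mxE ?eqxx ?mulr1n // => j ji.
    by rewrite !mxE eq_sym (negbTE ji) mul0r.
  have e2 : T = frob_dot t (const_mx 1).
    by rewrite /frob_dot big_ord1; apply: eq_bigr => i _; rewrite mxE mulr1.
  have e3 : frob_dot (const_mx 1 : 'rV[R]_g) (const_mx 1) = g%:R.
    rewrite /frob_dot big_ord1; under eq_bigr => i _ do rewrite !mxE mulr1.
    by rewrite sumr_const card_ord.
  rewrite e2 -(real_normK (num_real _)).
  apply: (@le_trans _ _ ((frob_norm t * frob_norm (const_mx 1 : 'rV[R]_g)) ^+ 2)).
    by rewrite lerXn2r ?nnegrE ?mulr_ge0 ?frob_norm_ge0 // frob_CS.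
  rewrite e1 exprMn !frob_norm_sqr e3 mulrC ler_wpM2r ?frob_dot_ge0 //.
  by rewrite ler_nat.
have T0 : 0 <= T by apply: sumr_ge0 => i _; exact/ltW/(rsvd_gt0 hG).
set x := frob_norm G ^+ 2 in h1 h3 *.
have x0 : 0 <= x by exact: sqr_ge0.
have h4 : x <= 2 * tau * T by lra.
have h5 : x ^+ 2 <= 4 * tau ^+ 2 * ((k + k)%:R * x).
  apply: (@le_trans _ _ ((2 * tau * T) ^+ 2)).
    by rewrite lerXn2r // nnegrE ?mulr_ge0.
  rewrite !exprMn.
  have -> : 2 ^+ 2 = 4 :> R by ring.
  by rewrite ler_wpM2l // mulr_ge0 ?sqr_ge0.
have [->|xn0] := eqVneq x 0; first by rewrite !mulr_ge0 ?sqr_ge0.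
have xp : 0 < x by rewrite lt0r xn0.
rewrite -(ler_pM2r xp) -expr2; apply: le_trans h5 _.
by rewrite natrD le_eqVlt; apply/orP; left; apply/eqP; ring.
Qed.

Variables (m L : nat) (mu0 kp delta : R) (grp : 'I_m -> 'I_L.+1) (w : m.-tuple ('I_n * 'I_n)).
Let c := Num.sqrt (mu0 * r%:R / n%:R).
Hypothesis Uc : forall i, frob_norm (row i U) <= c.
Hypothesis Vc : forall i, frob_norm (row i V) <= c.
Hypothesis kpE : kp * sg = S.
Hypothesis delta0 : 0 <= delta.
Hypothesis dk : 256 * (kp * delta) <= 1.

Let Z l := init_iter r mu0 H X grp w l.
Let Zh l := trim r mu0 (Z l).
Let scal : R := n%:R ^+ 2 / (m %/ L.+1)%:R.

Hypothesis start : 2048 * kp ^+ 2 * frob_norm (Z 0 - X) <= sg.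
Hypothesis good : forall l, (l < L)%N -> incoherent r mu0 (Zh l) ->
  frob_norm (proj_tangent (Zh l) (scal *: sampling_op (sample_group grp w l.+1) (X - Zh l))
     - proj_tangent (Zh l) (X - Zh l)) <= delta * frob_norm (X - Zh l).

(** Trimming multiplies the error e by at most 8 kp. The constants 2048 and 256 then make the
    quadratic term x^2 / sg and the gradient term delta x at most e / 32 each, and the doubling by
    thresholding leaves e / 8. *)
Lemma init_chain l : (l <= L)%N ->
  low_rank k (Z l) /\ 2048 * kp ^+ 2 * frob_norm (Z l - X) <= 8^-1 ^+ l * sg.
Proof.
elim: l => [_|l IH lL].
  split; last by rewrite expr0 mul1r.
  exact: (threshold_low_rank kr HH).
have [low hl] := IH (ltnW lL); set e := frob_norm (Z l - X) in hl.
have e0 : 0 <= e by exact: frob_norm_ge0.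
have kp1 : 1 <= kp by rewrite -(ler_pM2r sg0) mul1r kpE.
have kp0 : 0 <= kp by exact: le_trans kp1.
have kp2 : kp <= kp ^+ 2 by rewrite expr2 ler_peMl.
have hl' : 2048 * kp ^+ 2 * e <= sg.
  apply: le_trans hl _; rewrite ler_piMl ?(ltW sg0) // exprn_ile1 //.
  by rewrite invf_le1 // ler1n.
have e4 : 4 * e <= sg.
  have : 1 * e <= kp ^+ 2 * e by rewrite ler_wpM2r // (le_trans kp1).
  move: hl'; lra.
have [inc tr] := trim_approx HH svdX sg0 sgs sS sgS Uc Vc low e4.
rewrite -/(Zh l) -/e in inc tr.
set x := frob_norm (Zh l - X) in tr.
have x0 : 0 <= x by exact: frob_norm_ge0.
have xe : x <= 8 * kp * e.
  rewrite -(ler_pM2l sg0); apply: le_trans tr _; rewrite -kpE; lra.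
have st := init_step kr rn HH svdX sg0 sgs inc (good lL inc).
have ZE : Z l.+1 = H (Zh l + proj_tangent (Zh l)
     (scal *: sampling_op (sample_group grp w l.+1) (X - Zh l))).
  rewrite /Z /= -/(Z l) -/(Zh l) -/scal.
  case: (inc) => lt [P [t [Q [hZ _ _]]]].
  by rewrite !(proj_tangentE hZ) tan_projZ.
rewrite -ZE -/x in st.
split; first by rewrite ZE; exact: (threshold_low_rank kr HH).
set e' := frob_norm (Z l.+1 - X) in st *.
have xx : x ^+ 2 <= 64 * kp ^+ 2 * e * e.
  have -> : 64 * kp ^+ 2 * e * e = (8 * kp * e) ^+ 2 by rewrite !exprMn; ring.
  by rewrite lerXn2r // nnegrE // !mulr_ge0.
have d1 : delta * x <= e / 32.
  have := ler_wpM2l delta0 xe; have := ler_wpM2r e0 dk; lra.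
have d2 := ler_wpM2l (ltW sg0) d1.
have d3 := ler_wpM2r e0 hl'.
have e8 : 8 * e' <= e.
  rewrite -(ler_pM2l sg0); lra.
have kk : 0 <= 2048 * kp ^+ 2 by apply: mulr_ge0 (ler0n _ _) (sqr_ge0 _).
have h9 := ler_wpM2l kk e8.
have h10 : 8 * (2048 * kp ^+ 2 * e') <= 8^-1 ^+ l * sg.
  by apply: le_trans hl; rewrite mulrCA.
by rewrite [_ ^+ l.+1]exprS -[leRHS]mulrA ler_pdivlMl.
Qed.

End Initial.

Section Reindexing.
Context {R : realType} (n m L : nat).
Variables (grp : 'I_m -> 'I_L.+1).

Lemma sample_group_sum (w : m.-tuple ('I_n * 'I_n)) (l : nat) (F : 'I_n * 'I_n -> R) :
  \sum_(x <- sample_group grp w l) F x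
  = \sum_(k in [set k | grp k == l :> nat]%SET) F (tnth w k).
Proof.
rewrite /sample_group big_map big_filter big_enum_cond /=.
by apply: eq_bigl => k; rewrite !inE.
Qed.

Lemma tuple_sum (w : m.-tuple ('I_n * 'I_n)) (F : 'I_n * 'I_n -> R) :
  \sum_(x <- w) F x = \sum_(k in [set: 'I_m]%SET) F (tnth w k).
Proof. by rewrite big_tuple; apply: eq_bigl => k; rewrite inE. Qed.

(** Iterate l sees only the groups 0 to l; this is the independence that resampling buys. *)
Lemma init_iter_ext r mu0 (H : 'M[R]_n -> 'M[R]_n) X (w w' : m.-tuple ('I_n * 'I_n)) l :
  (forall j, (j <= l)%N -> sample_group grp w j = sample_group grp w' j) ->
  init_iter r mu0 H X grp w l = init_iter r mu0 H X grp w' l.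
Proof.
elim: l => [|l IH] h /=; first by rewrite h.
by rewrite IH ?h // => j jl; rewrite h // ltnW.
Qed.

End Reindexing.

(** * Union bound over the failure events *)

Section Failure.
Context {R : realType}.
Variables (n r k m L : nat) (X : 'M[R]_n) (U V : 'M[R]_(n, k)) (s : 'rV[R]_k).
Variables (sg S mu0 mu kp eps0 delta1 delta2 : R) (p : nat).
Variables (H : 'M[R]_n -> 'M[R]_n) (grp : 'I_m -> 'I_L.+1) (alg : algorithm R).
Hypothesis kr : k = r.
Hypothesis rn : (0 < r <= n)%N.
Hypothesis n9 : (9 <= n)%N.
Hypothesis HH : forall Z, is_hard_threshold r Z (H Z).
Hypothesis svdX : is_reduced_svd X U s V.
Hypothesis sg0 : 0 < sg.
Hypothesis sgs : forall i, sg <= s 0 i.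
Hypothesis sS : forall i, s 0 i <= S.
Hypothesis kpE : kp * sg = S.
Hypothesis kp1 : 1 <= kp.
Let c := Num.sqrt (mu0 * r%:R / n%:R).
Hypothesis Uc : forall i, frob_norm (row i U) <= c.
Hypothesis Vc : forall i, frob_norm (row i V) <= c.
Hypothesis Xmu : forall i j, `|X i j| <= mu.
Hypothesis mu_gt0 : 0 < mu.
Hypothesis valid : valid_parameters alg.
Hypothesis adm : admissible alg eps0.
Hypothesis grpE : equal_groups grp.
Hypothesis m0 : (0 < m)%N.
Hypothesis Lm : (L.+1 %| m)%N.
Hypothesis p0 : (0 < p)%N.

Let mh : R := (m %/ L.+1)%:R.
Let n2 : R := n%:R ^+ 2.
Let scal : R := n2 / mh.

Hypothesis d1_gt0 : 0 < delta1.
Hypothesis d1_le1 : delta1 <= 1.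
Hypothesis d2_gt0 : 0 < delta2.
Hypothesis d2_le1 : delta2 <= 1.
Hypothesis d2k : 256 * (kp * (2 * delta2)) <= 1.
Hypothesis d1k : forall e : R, 0 <= e ->
  e ^+ 2 <= 8 * k%:R * (2 * delta1 * n%:R * mu) ^+ 2 -> 2048 * kp ^+ 2 * e <= sg.
Hypothesis size1 : 64 * p%:R * n%:R <= delta1 ^+ 2 * mh.
Hypothesis size2 : 64 * p%:R * n2 * (44 * c ^+ 2) <= delta2 ^+ 2 * (mh * 2).
Hypothesis size3 : 64 * p%:R * n2 * (2 * c ^+ 2) <= (eps0 / 80) ^+ 2 * m%:R.
Hypothesis depth : n2 * 8^-1 ^+ L <= 3 * eps0.

Let I : finType := ('I_n * 'I_n)%type.
Let M : R := #|{: m.-tuple I}|%:R.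
Let n0 : (0 < n)%N. Proof. exact: leq_trans n9. Qed.
Let mh0 : (0 < m %/ L.+1)%N.
Proof. by rewrite divn_gt0 // dvdn_leq. Qed.
Let J (l : nat) : {set 'I_m} := [set k | grp k == l :> nat]%SET.

Let card_J l : (l <= L)%N -> #|J l| = (m %/ L.+1)%N.
Proof.
move=> lL; rewrite -(grpE (Ordinal (lL : (l < L.+1)%N))).
by apply: eq_card => i; rewrite !inE.
Qed.

Let sample_mix l l' (w w' : m.-tuple I) : sample_group grp (mix (J l) w w') l' =
  if l' == l then sample_group grp w' l' else sample_group grp w l'.
Proof.
case: eqP => [->|/eqP ll]; apply/eq_in_map => i; rewrite mem_filter => /andP[/eqP il _].
  by rewrite tnth_mktuple inE il eqxx.
by rewrite tnth_mktuple inE il (negbTE ll).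
Qed.

Let Zh (w : m.-tuple I) l := trim r mu0 (init_iter r mu0 H X grp w l).

(** Incoherence is a premise inside the event, so the failure of a step can be counted without
    reference to the success of the earlier steps. *)
Let good_step l (w : m.-tuple I) := incoherent r mu0 (Zh w l) ->
  frob_norm (proj_tangent (Zh w l) (scal *: sampling_op (sample_group grp w l.+1) (X - Zh w l))
     - proj_tangent (Zh w l) (X - Zh w l)) <= 2 * delta2 * frob_norm (X - Zh w l).

Let M_gt0 : 0 < M.
Proof. by rewrite ltr0n card_tuple expn_gt0 card_prod card_ord muln_gt0 n0. Qed.

Let cardT : #|{: m.-tuple I}| = #|[eta xpredT : pred (m.-tuple I)]|.
Proof. exact: eq_card. Qed.

(* Resampling the group l+1 leaves [Zh w l] unchanged, so that the bound for a
   fixed matrix applies conditionally on the other groups. *)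
Let bad_step_le l : (l < L)%N ->
  \sum_(w : m.-tuple I | `[< ~ good_step l w >]) 1 <= M * ((n * n).+1%:R * 8^-1 ^+ p).
Proof.
move=> lL; set q := _ * _ ^+ p.
rewrite -(ler_pM2l M_gt0) big_mkcond /= mulr_sumr.
have -> : \sum_w M * (if `[< ~ good_step l w >] then 1 else 0) =
    \sum_(w : m.-tuple I) \sum_(w' : m.-tuple I)
      (if `[< ~ good_step l (mix (J l.+1) w w') >] then 1 else 0 : R).
  rewrite -(sum_mix (J l.+1) (fun w _ => if `[< ~ good_step l w >] then 1 else 0 : R)).
  by apply: eq_bigr => w _; rewrite sumr_const -cardT -[RHS]mulr_natl.
have -> : M * (M * q) = \sum_(w : m.-tuple I) (M * q).
  by rewrite sumr_const -cardT -[RHS]mulr_natl.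
apply: ler_sum => w _; rewrite -big_mkcond /=.
have ZE w' : Zh (mix (J l.+1) w w') l = Zh w l.
  rewrite /Zh; congr (trim _ _ _); apply: init_iter_ext => j jl.
  by rewrite sample_mix ltn_eqF.
have [inc|ninc] := pselect (incoherent r mu0 (Zh w l)); last first.
  rewrite big1 ?mulr_ge0 ?ler0n ?exprn_ge0 ?invr_ge0 ?ler0n // => w' /asboolP; case.
  by rewrite /good_step ZE.
case: (inc) => d [P [t [Q [hZ Pc Qc]]]].
have sumJ (w' : m.-tuple I) (F : I -> R) :
    \sum_(x <- sample_group grp w' l.+1) F x = \sum_(i in J l.+1) F (tnth w' i).
  exact: sample_group_sum.
have Jp : (0 < #|J l.+1|)%N by rewrite card_J.
have Ec i j := incoherent_entry svdX Uc i j inc.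
have sz : 64 * p%:R * n%:R ^+ 2 * (44 * c ^+ 2) <= delta2 ^+ 2 * (#|J l.+1|%:R * 2).
  by rewrite card_J.
have ev := step_event sumJ n0 Jp (rsvd_U hZ) (rsvd_V hZ) Pc Qc Ec p0 d2_gt0 d2_le1 sz.
apply: le_trans ev; rewrite [leLHS]big_mkcond [leRHS]big_mkcond; apply: ler_sum => w' _.
case: asboolP => nb; case: asboolP => // nn; exfalso; apply: nn => h; apply: nb => _.
rewrite ZE sample_mix eqxx !(proj_tangentE hZ); move: h.
by rewrite card_J.
Qed.

Let good_start (w : m.-tuple I) := forall u v : 'cV[R]_n,
  `|frob_dot (u *m v^T) (scal *: sampling_op (sample_group grp w 0) X - X)|
      <= 2 * delta1 * n%:R * mu * (frob_norm u * frob_norm v).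

Let bad_start_le : \sum_(w : m.-tuple I | `[< ~ good_start w >]) 1 <= M * ((n + n)%:R * 8^-1 ^+ p).
Proof.
have sumJ (w' : m.-tuple I) (F : I -> R) :
    \sum_(x <- sample_group grp w' 0) F x = \sum_(i in J 0) F (tnth w' i).
  exact: sample_group_sum.
have Jp : (0 < #|J 0|)%N by rewrite card_J.
have := spectral_event sumJ n0 Jp Xmu mu_gt0 p0 d1_gt0 d1_le1.
by rewrite card_J //; apply.
Qed.

Let good_rip (w : m.-tuple I) := forall A B : 'M[R]_n,
    `|frob_dot (tan_proj U V A) (sampling_op w (tan_proj U V B))
       - m%:R / n2 * frob_dot (tan_proj U V A) (tan_proj U V B)|
    <= m%:R / n2 * (eps0 / 80) * (frob_norm A * frob_norm B).

Let bad_rip_le : \sum_(w : m.-tuple I | `[< ~ good_rip w >]) 1 <= M * ((n * n)%:R * 8^-1 ^+ p).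
Proof.
have sumJ (w' : m.-tuple I) (F : I -> R) :
    \sum_(x <- w') F x = \sum_(i in [set: 'I_m]%SET) F (tnth w' i).
  exact: tuple_sum.
have Jp : (0 < #|[set: 'I_m]%SET|)%N by rewrite cardsT card_ord.
have e0 := admissible_gt0 adm.
have e80 : 0 < eps0 / 80 by rewrite divr_gt0.
have e81 : eps0 / 80 <= 1.
  have := admissible_kappa valid adm; have := kappa_ge0 valid; lra.
have := rip_event sumJ n0 Jp (rsvd_U svdX) (rsvd_V svdX) Uc Vc p0 e80 e81.
by rewrite cardsT card_ord; apply.
Qed.

Let conv (w : m.-tuple I) := alg_iter alg H w X (initialization r mu0 H X grp w) @ \oo --> X.

Let good_conv (w : m.-tuple I) : good_start w -> (forall l, (l < L)%N -> good_step l w) -> good_rip w -> conv w.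
Proof.
move=> g1 g2 g3.
have sgS : sg <= S by rewrite -kpE ler_peMl // ltW.
have nR : 81 <= n2.
  have -> : 81 = 9 ^+ 2 :> R by ring.
  by rewrite lerXn2r ?nnegrE ?ler0n // ler_nat.
have n2_gt0 : 0 < n2 by exact: lt_le_trans nR.
have tau0 : 0 <= 2 * delta1 * n%:R * mu by rewrite !mulr_ge0 ?ler0n // ltW.
have start := d1k (frob_norm_ge0 _) (spectral_init kr rn HH svdX tau0 g1).
have d20 : 0 <= 2 * delta2 by rewrite mulr_ge0 // ltW.
have [low hL] := init_chain kr rn HH svdX sg0 sgs sS sgS Uc Vc kpE d20 d2k start g2 (leqnn L).
apply: (@alg_cvg R n r k X U V s sg H kr rn HH svdX sg0 sgs w (m%:R / n2) n2) => //.
- by rewrite divr_gt0 // ltr0n.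
- by rewrite size_tuple mulfVK // gt_eqF.
- by [].
rewrite frob_norm_distC -/(initialization r mu0 H X grp w) in hL *.
set e := frob_norm _ in hL *.
have e0 : 0 <= e by exact: frob_norm_ge0.
have kp2 : 1 <= kp ^+ 2 by rewrite exprn_ege1.
have h1 : 2048 * e <= 8^-1 ^+ L * sg.
  by apply: le_trans hL; rewrite -mulrA ler_pM2l ?ltr0n // ler_peMl.
have h2 := ler_wpM2l (ltW n2_gt0) h1.
have h3 := ler_wpM2r (ltW sg0) depth.
(* The constants fit because 128 times 16 is 2048 and 3 eps0 <= 128 eps0 / 40. *)
have h4 : 128 * (16 * n2 * e) <= 128 * (eps0 / 40 * sg).
  have := mulr_gt0 (admissible_gt0 adm) sg0; lra.
by rewrite ler_pM2l ?ltr0n in h4.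
Qed.

Lemma failure_bound : \sum_(w : m.-tuple I | `[< ~ conv w >]) 1 <=
  M * (((n + n)%:R + L%:R * (n * n).+1%:R + (n * n)%:R) * 8^-1 ^+ p).
Proof.
pose b (B : Prop) : R := if `[< B >] then 1 else 0.
have b0 B : 0 <= b B by rewrite /b; case: ifP.
apply: (@le_trans _ _ (\sum_(w : m.-tuple I)
    (b (~ good_start w) + \sum_(l < L) b (~ good_step l w) + b (~ good_rip w)))).
  rewrite big_mkcond /=; apply: ler_sum => w _; case: asboolP => [nc|_]; last first.
    by rewrite !addr_ge0 // sumr_ge0.
  have bT B : B -> b B = 1 by rewrite /b => /asboolT ->.
  have s0 : 0 <= \sum_(l < L) b (~ good_step l w) by rewrite sumr_ge0.
  have [g1|g1] := pselect (good_start w); last by rewrite (bT _ g1) -addrA lerDl addr_ge0.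
  have [g3|g3] := pselect (good_rip w); last by rewrite (bT _ g3) lerDr addr_ge0.
  have [g2|g2] := pselect (forall l, (l < L)%N -> good_step l w).
    by case: nc; exact: good_conv.
  move/existsNP : g2 => [l /not_implyP[lL g2]].
  rewrite (bigD1 (Ordinal lL)) //= (bT _ g2).
  have s1 : 0 <= \sum_(i < L | i != Ordinal lL) b (~ good_step i w) by rewrite sumr_ge0.
  have := b0 (~ good_start w); have := b0 (~ good_rip w); lra.
rewrite !big_split /= exchange_big /= !mulrDl !mulrDr.
have bE (B : m.-tuple I -> Prop) : \sum_w b (B w) = \sum_(w | `[< B w >]) 1.
  by rewrite [RHS]big_mkcond.
apply: lerD; last by rewrite bE bad_rip_le.
apply: lerD; first by rewrite bE bad_start_le.
have -> : M * (L%:R * (n * n).+1%:R * 8^-1 ^+ p) = \sum_(l < L) M * ((n * n).+1%:R * 8^-1 ^+ p).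
  by rewrite sumr_const card_ord -[RHS]mulr_natl; ring.
by apply: ler_sum => l _; rewrite bE bad_step_le.
Qed.

End Failure.

(** * Constants *)

Section Numeric.
Context {R : realType}.

(** From 1 - x <= exp(-x) at x = 1/8 follows exp(1/8) <= 8/7, and (8/7)^8 < 3. *)
Lemma expR1_le3 : expR 1 <= 3 :> R.
Proof.
have h : expR (8^-1) <= 8 / 7 :> R.
  rewrite -[expR _]invrK -expRN.
  have := expR_ge1Dx (- 8^-1 : R) => h.
  have -> : 8 / 7 = (1 + - 8^-1)^-1 :> R by field.
  rewrite lef_pV2 // posrE ?expR_gt0 //; lra.
have -> : 1 = 8^-1 * 8%:R :> R by rewrite mulVf.
rewrite expRM_natr; apply: (@le_trans _ _ ((8 / 7) ^+ 8)); last by lra.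
by rewrite lerXn2r // nnegrE ?expR_ge0 // divr_ge0.
Qed.

Lemma ln_ge2 n : (9 <= n)%N -> 2 <= ln n%:R :> R.
Proof.
move=> n9; rewrite -[leLHS]expRK ler_ln ?posrE ?expR_gt0 ?ltr0n ?(leq_trans _ n9) //.
apply: (@le_trans _ _ 9); last by rewrite ler_nat.
have -> : 2 = 1 * 2%:R :> R by rewrite mul1r.
rewrite expRM_natr.
have -> : 9 = 3 ^+ 2 :> R by ring.
by rewrite lerXn2r // ?nnegrE ?expR_ge0 // expR1_le3.
Qed.

Lemma expr8V_le x p : x <= p%:R -> 8^-1 ^+ p <= expR (- x) :> R.
Proof.
move=> xp; apply: (@le_trans _ _ (expR (- p%:R))); last by rewrite ler_expR lerN2.
have -> : - p%:R = -1 * p%:R :> R by rewrite mulN1r.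
rewrite expRM_natr lerXn2r ?nnegrE ?invr_ge0 ?expR_ge0 //.
rewrite expRN lef_pV2 ?posrE ?expR_gt0 //; apply: le_trans expR1_le3 _; lra.
Qed.

Lemma exponent_exists x : 1 <= x ->
  exists p : nat, [/\ (0 < p)%N, 6 * x <= p%:R & p%:R <= 7 * x :> R].
Proof.
move=> x1; exists (Num.truncn (6 * x)).+1.
have x0 : 0 <= 6 * x by lra.
have /andP[h1 h2] := truncn_itv x0; split=> //; first exact: ltW.
rewrite -natr1; lra.
Qed.

(* The argument of the logarithm is at least n / (12 eps0), so L steps of
   contraction by 1/8 gain a factor (12 eps0 / n)^6. *)
Lemma depth_le n L (beta eps0 Lambda : R) : (9 <= n)%N -> 1 < beta ->
  0 < eps0 -> 4 * eps0 <= 1 ->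
  Lambda = ln (beta * n%:R * ln n%:R / (24 * eps0)) -> 6 * Lambda <= L%:R ->
  n%:R ^+ 2 * 8^-1 ^+ L <= 3 * eps0.
Proof.
move=> n9 b1 e0 e4 LE hL.
have n0 : 0 < n%:R :> R by rewrite ltr0n (leq_trans _ n9).
have nR : 9 <= n%:R :> R by rewrite ler_nat.
have ln2 := ln_ge2 n9.
set a := beta * n%:R * ln n%:R / (24 * eps0) in LE.
have a_ge : n%:R / (12 * eps0) <= a.
  rewrite /a ler_pdivlMr ?mulr_gt0 // -mulrA.
  have -> : n%:R / (12 * eps0) * (24 * eps0) = 1 * (n%:R * 2).
    by field; rewrite gt_eqF.
  by apply: ler_pM; rewrite ?mulr_ge0 ?(ltW b1) ?(ltW n0) // ler_wpM2l // ltW.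
have d0 : 0 < n%:R / (12 * eps0) by rewrite divr_gt0 // mulr_gt0.
have a0 : 0 < a by exact: lt_le_trans a_ge.
have h1 : 8^-1 ^+ L <= a^-1 ^+ 6.
  apply: le_trans (expr8V_le hL) _.
  have -> : - (6 * Lambda) = - Lambda * 6%:R by ring.
  by rewrite expRM_natr expRN LE lnK.
have h2 : a^-1 ^+ 6 <= (12 * eps0 / n%:R) ^+ 6.
  have -> : 12 * eps0 / n%:R = (n%:R / (12 * eps0))^-1 by rewrite invf_div.
  rewrite lerXn2r ?nnegrE ?invr_ge0 ?(ltW a0) ?(ltW d0) //.
  by rewrite lef_pV2 // posrE.
have h3 : n%:R ^+ 2 * 8^-1 ^+ L <= n%:R ^+ 2 * (12 * eps0 / n%:R) ^+ 6.
  by rewrite ler_wpM2l ?sqr_ge0 // (le_trans h1).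
apply: le_trans h3 _.
have -> : n%:R ^+ 2 * (12 * eps0 / n%:R) ^+ 6 = (12 / n%:R) ^+ 4 * (12 * eps0) ^+ 2 * eps0 ^+ 4.
  by field; rewrite gt_eqF.
have g1 : (12 / n%:R) ^+ 4 <= 4 :> R.
  apply: (@le_trans _ _ ((12 / 9) ^+ 4)); last by lra.
  rewrite lerXn2r ?nnegrE ?divr_ge0 ?(ltW n0) // ler_pdivrMr //; lra.
have g2 : (12 * eps0) ^+ 2 <= 9.
  have -> : 9 = 3 ^+ 2 :> R by ring.
  rewrite lerXn2r ?nnegrE ?mulr_ge0 ?(ltW e0) //; lra.
have g3 : eps0 ^+ 4 <= eps0 / 64.
  have -> : eps0 ^+ 4 = eps0 * eps0 ^+ 3 by rewrite exprS.
  rewrite ler_pM2l //; have -> : 64^-1 = 4^-1 ^+ 3 :> R by field.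
  rewrite lerXn2r ?nnegrE ?invr_ge0 ?(ltW e0) //; lra.
have g4 : (12 / n%:R) ^+ 4 * (12 * eps0) ^+ 2 <= 4 * 9.
  by apply: ler_pM; rewrite ?exprn_ge0 ?divr_ge0 ?mulr_ge0 ?(ltW n0) ?(ltW e0).
have := ler_pM (mulr_ge0 (exprn_ge0 4 (divr_ge0 _ (ltW n0))) (sqr_ge0 _)) (exprn_ge0 4 (ltW e0)) g4 g3.
move=> /(_ (ler0n _ 12)); lra.
Qed.

Lemma lambda_ge1 n (beta eps0 : R) : (9 <= n)%N -> 1 < beta -> 0 < eps0 -> 4 * eps0 <= 1 ->
  1 <= ln (beta * n%:R * ln n%:R / (24 * eps0)).
Proof.
move=> n9 b1 e0 e4.
have nR : 9 <= n%:R :> R by rewrite ler_nat.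
have ln2 := ln_ge2 n9.
have b0 : 0 < beta by lra.
have h3 : 3 <= beta * n%:R * ln n%:R / (24 * eps0).
  rewrite ler_pdivlMr ?mulr_gt0 //.
  have : 1 * 9 * 2 <= beta * n%:R * ln n%:R.
    by rewrite !ler_pM ?mulr_ge0 ?(ltW b1) //.
  lra.
rewrite -[leLHS]expRK ler_ln ?posrE ?expR_gt0 //; first exact: le_trans expR1_le3 _.
by apply: lt_le_trans h3.
Qed.

(** p >= 6 beta ln n brings 8^(-p) below n^(-2 beta), while the dimensions 2 n, n^2 + 1 (L times)
    and n^2 of the three kinds of events add up to at most (24 Lambda + 3) n^2. *)
Lemma union_le n L p (beta Lambda : R) : (9 <= n)%N -> 1 < beta -> 1 <= Lambda ->
  L%:R <= 6 * Lambda + 1 -> 6 * (beta * ln n%:R) <= p%:R ->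
  ((n + n)%:R + L%:R * (n * n).+1%:R + (n * n)%:R) * 8^-1 ^+ p
    <= (24 * Lambda + 3) * n%:R `^ (2 - 2 * beta).
Proof.
move=> n9 b1 L1 hL hp.
have n0 : 0 < n%:R :> R by rewrite ltr0n (leq_trans _ n9).
have nR : 9 <= n%:R :> R by rewrite ler_nat.
have ln2 := ln_ge2 n9.
have bl : 0 <= beta * ln n%:R by rewrite mulr_ge0 //; lra.
have h1 : 8^-1 ^+ p <= n%:R `^ (- (2 * beta)) :> R.
  apply: le_trans (expr8V_le hp) _; rewrite /powR gt_eqF // ler_expR; lra.
have -> : n%:R `^ (2 - 2 * beta) = n%:R ^+ 2 * n%:R `^ (- (2 * beta)).
  have -> : n%:R ^+ 2 = n%:R `^ 2%:R :> R by rewrite powR_mulrn // ltW.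
  by rewrite -powRD //; apply/implyP => _; rewrite (gt_eqF n0).
have h2 : (n + n)%:R + L%:R * (n * n).+1%:R + (n * n)%:R <= (24 * Lambda + 3) * n%:R ^+ 2 :> R.
  rewrite -natr1 natrM natrD -expr2.
  have nn : 9 * n%:R <= n%:R ^+ 2 :> R by rewrite expr2 ler_pM2r.
  have n1 : 1 <= n%:R ^+ 2 :> R by move: nn nR; lra.
  have n20 : 0 <= n%:R ^+ 2 + 1 :> R by lra.
  have := ler_wpM2r n20 hL.
  have l0 : 0 <= Lambda by lra.
  have := ler_wpM2l l0 n1; have := ler_wpM2r (sqr_ge0 n%:R) L1; lra.
by rewrite mulrA; apply: ler_pM.
Qed.

End Numeric.

(** * From counts of tuples to probabilities *)

Section Probability.
Context {R : realType} (n m : nat).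

Lemma iid_uniform_prob_ge (E : set (m.-tuple ('I_n * 'I_n))) (q : R) : (0 < n)%N ->
  \sum_(w : m.-tuple ('I_n * 'I_n) | `[< ~ E w >]) 1 <= #|{: m.-tuple ('I_n * 'I_n)}|%:R * q ->
  1 - q <= iid_uniform_prob R E.
Proof.
move=> n0 h; set M : R := #|{: m.-tuple ('I_n * 'I_n)}|%:R in h *.
have M0 : 0 < M by rewrite ltr0n card_tuple expn_gt0 card_prod card_ord muln_gt0 n0.
have -> : iid_uniform_prob R E = M^-1 * \sum_(w | `[< E w >]) 1.
  rewrite /iid_uniform_prob mulr_sumr; apply: eq_bigr => w _.
  by rewrite prodr_const card_ord mulr1 exprVn /M card_tuple natrX.
have MS : M = \sum_(w : m.-tuple ('I_n * 'I_n) | `[< E w >]) 1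
            + \sum_(w : m.-tuple ('I_n * 'I_n) | `[< ~ E w >]) 1.
  have <- : \sum_(w : m.-tuple ('I_n * 'I_n)) 1 = M.
    by rewrite sumr_const /M; congr (_ %:R); apply: eq_card.
  rewrite (bigID (fun w => `[< E w >])) /=; congr (_ + _).
  by apply: eq_bigl => w; rewrite asbool_neg.
rewrite mulrC ler_pdivlMr // mulrBl mul1r mulrC.
move: MS h; lra.
Qed.

End Probability.

(** * Sample sizes and accuracies *)

Section Sizes.
Context {R : realType}.

(** The random events ask for different powers: mu1^2 r^2 kappa^6 for the spectral start, mu0 r
    kappa^2 for a resampled step, mu0 r / eps0^2 for the restricted isometry. The single assumed
    product dominates each of them. *)
Lemma sample_sizes (a T mu0 mu1 eps0 kp r mx Mh : R) : 0 <= a -> 0 <= T -> 0 <= mu0 ->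
  0 < eps0 -> eps0 <= 1 -> 1 <= kp -> 1 <= r -> mu0 / eps0 ^+ 2 <= mx -> mu1 ^+ 2 <= mx ->
  a * (T * mx * kp ^+ 6 * r ^+ 2) <= Mh ->
  [/\ a * (T * (mu1 * r * kp ^+ 3) ^+ 2) <= Mh,
      a * (kp ^+ 2 * (T * mu0 * r)) <= Mh
    & a * (T * mu0 * r) <= eps0 ^+ 2 * Mh].
Proof.
move=> a0 T0 m0 e0 e1 k1 r1 hmu0 hmu1 hM.
have k0 : 0 <= kp by exact: le_trans k1.
have r0 : 0 <= r by exact: le_trans r1.
have rr : r <= r ^+ 2 by rewrite expr2 ler_peMl.
have k62 : kp ^+ 2 <= kp ^+ 6 by rewrite ler_weXn2l.
have e2 : 0 < eps0 ^+ 2 by rewrite exprn_gt0.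
have e21 : eps0 ^+ 2 <= 1 by rewrite exprn_ile1 // ltW.
have hmu0' : mu0 <= eps0 ^+ 2 * mx by rewrite mulrC -ler_pdivrMr.
have mx0 : 0 <= mx by exact: le_trans (sqr_ge0 _) hmu1.
have mm : mu0 <= mx by apply: le_trans hmu0' _; rewrite ler_piMl.
split.
- apply: le_trans hM; rewrite ler_wpM2l //.
  have -> : T * (mu1 * r * kp ^+ 3) ^+ 2 = T * mu1 ^+ 2 * kp ^+ 6 * r ^+ 2 by ring.
  by rewrite !ler_wpM2r ?exprn_ge0 // ler_wpM2l.
- apply: le_trans hM; rewrite ler_wpM2l //.
  have -> : kp ^+ 2 * (T * mu0 * r) = (T * mu0 * kp ^+ 2) * r by ring.
  apply: ler_pM; rewrite ?mulr_ge0 ?exprn_ge0 //.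
  by apply: ler_pM; rewrite ?mulr_ge0 ?exprn_ge0 // ler_wpM2l.
have h := ler_wpM2l (ltW e2) hM; apply: le_trans h.
rewrite [leRHS]mulrCA ler_wpM2l //.
have -> : eps0 ^+ 2 * (T * mx * kp ^+ 6 * r ^+ 2) = T * (eps0 ^+ 2 * mx) * (kp ^+ 6 * r ^+ 2) by ring.
apply: ler_pM; rewrite ?mulr_ge0 //; first by rewrite ler_wpM2l.
apply: le_trans rr _; rewrite ler_peMl ?sqr_ge0 //.
by rewrite exprn_ege1.
Qed.

(** The accuracies are 1 / (2^14 y), 1 / (2^9 kp) and eps0 / 80. The first dictates 2^37: 2^28 comes
    from its square and 2^9 covers 64 times 7. *)
Lemma sampling_rates (T mu0 eps0 kp r n p y c Mh : R) :
  0 < T -> 0 < mu0 -> 0 < kp -> 0 < r -> 0 < n -> 0 <= Mh -> 0 < y ->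
  c ^+ 2 = mu0 * r / n -> p * n <= 7 * T ->
  2 ^+ 37 * (T * y ^+ 2) <= Mh -> 2 ^+ 37 * (kp ^+ 2 * (T * mu0 * r)) <= Mh ->
  2 ^+ 37 * (T * mu0 * r) <= eps0 ^+ 2 * Mh ->
  [/\ 64 * p * n <= (2 ^+ 14 * y)^-1 ^+ 2 * Mh,
      64 * p * n ^+ 2 * (44 * c ^+ 2) <= (2 ^+ 9 * kp)^-1 ^+ 2 * (Mh * 2)
    & 64 * p * n ^+ 2 * (2 * c ^+ 2) <= (eps0 / 80) ^+ 2 * Mh].
Proof.
move=> T0 m0 k0 r0 n0 M0 y0 c2 pn F1 F2 F3.
have sq28 : (2 ^+ 14 * y) ^+ 2 = 2 ^+ 28 * y ^+ 2 by rewrite exprMn -exprM.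
have sq28_gt0 : 0 < (2 ^+ 14 * y) ^+ 2 by rewrite exprn_gt0 // mulr_gt0 ?exprn_gt0.
set q := T * mu0 * r in F2 F3.
have q0 : 0 <= q by rewrite !mulr_ge0 // ltW.
have pnq : p * n * (mu0 * r) <= 7 * q.
  have -> : 7 * q = 7 * T * (mu0 * r) by rewrite /q; ring.
  by rewrite ler_wpM2r // mulr_ge0 // ltW.
have pc2 : p * n ^+ 2 * c ^+ 2 = p * n * (mu0 * r).
  by rewrite c2; field; rewrite gt_eqF.
split.
- rewrite exprVn ler_pdivlMl // sq28; apply: le_trans F1.
  have -> : 2 ^+ 37 = 2 ^+ 28 * 2 ^+ 9 :> R by rewrite -exprD.
  have -> : 2 ^+ 9 = 512 :> R by ring.
  have -> : 2 ^+ 28 * y ^+ 2 * (64 * p * n) = 2 ^+ 28 * (y ^+ 2 * (64 * (p * n))).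
    by set a := 2 ^+ 28; ring.
  have -> : 2 ^+ 28 * 512 * (T * y ^+ 2) = 2 ^+ 28 * (y ^+ 2 * (512 * T)).
    by set a := 2 ^+ 28; ring.
  rewrite ler_pM2l ?exprn_gt0 // ler_pM2l ?exprn_gt0 //; move: pn T0; clear; lra.
- have -> : 64 * p * n ^+ 2 * (44 * c ^+ 2) = 64 * 44 * (p * n ^+ 2 * c ^+ 2) by ring.
  rewrite pc2 exprVn ler_pdivlMl ?exprn_gt0 ?mulr_gt0 ?exprn_gt0 //.
  rewrite exprMn -exprM.
  apply: (@le_trans _ _ Mh); last by rewrite ler_peMr // ler1n.
  apply: le_trans F2.
  have -> : 2 ^+ 37 = 2 ^+ 18 * (2 ^+ 15 * 2 ^+ 4) :> R by rewrite -!exprD.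
  have -> : 2 ^+ 15 = 64 * 512 :> R.
    have -> : 64 = 2 ^+ 6 :> R by ring.
    have -> : 512 = 2 ^+ 9 :> R by ring.
    by rewrite -exprD.
  have -> : 2 ^+ 4 = 16 :> R by ring.
  have h : 64 * 44 * (p * n * (mu0 * r)) <= 64 * 512 * 16 * q.
    by move: pnq q0; clear; lra.
  have h2 : 0 <= 2 ^+ (9 * 2) * kp ^+ 2 by rewrite mulr_ge0 ?exprn_ge0 // ltW.
  apply: le_trans (ler_wpM2l h2 h) _.
  rewrite le_eqVlt; apply/orP; left; apply/eqP.
  by rewrite (_ : (9 * 2)%N = 18%N) //; set a := 2 ^+ 18; ring.
have -> : 64 * p * n ^+ 2 * (2 * c ^+ 2) = 64 * 2 * (p * n ^+ 2 * c ^+ 2) by ring.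
rewrite pc2.
have h : 64 * 2 * 7 * (80 * 80) * q <= 2 ^+ 37 * q.
  rewrite ler_wpM2r //.
  have -> : 2 ^+ 37 = 2 ^+ 10 * (2 ^+ 7 * 2 ^+ 7) * 2 ^+ 13 :> R by rewrite -!exprD.
  have -> : 2 ^+ 10 = 1024 :> R by ring.
  have -> : 2 ^+ 7 = 128 :> R by ring.
  have : 1 <= 2 ^+ 13 :> R by rewrite exprn_ege1 // ler1n.
  by clear; lra.
rewrite expr_div_n [leRHS]mulrAC ler_pdivlMr ?exprn_gt0 //.
apply: le_trans F3; apply: le_trans h; move: pnq; clear; lra.
Qed.

(** Here w is n times the largest entry and sr the root of r. The incoherence factors cancel,
    leaving e^2 <= 32 x^2 with x = sg / (2^14 kp^2); so e <= 8 x, and 8 times 2048 is 2^14. *)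
Lemma init_accuracy (kp sg mu1 sr w e : R) : 0 < kp -> 0 < sg -> 0 < sr -> 0 < mu1 * sr ->
  0 <= w -> w <= mu1 * sr * (kp * sg) -> 0 <= e ->
  e ^+ 2 <= 8 * sr ^+ 2 * (2 * (2 ^+ 14 * (mu1 * sr ^+ 2 * kp ^+ 3))^-1 * w) ^+ 2 ->
  2048 * kp ^+ 2 * e <= sg.
Proof.
move=> k0 sg0 s0 ms0 w0 hw e0 he.
have m0 : 0 < mu1 by rewrite -(pmulr_lgt0 _ s0).
set y := (2 ^+ 14 * (mu1 * sr ^+ 2 * kp ^+ 3))^-1 in he.
have a14 : 0 < 2 ^+ 14 :> R by rewrite exprn_gt0.
have y0 : 0 <= y by rewrite invr_ge0 !mulr_ge0 ?exprn_ge0 // ltW.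
have h1 : (2 * y * w) ^+ 2 <= (2 * y * (mu1 * sr * (kp * sg))) ^+ 2.
  have y20 : 0 <= 2 * y by rewrite mulr_ge0.
  rewrite lerXn2r ?nnegrE ?ler_wpM2l // mulr_ge0 //.
  exact: le_trans hw.
have s8 : 0 <= 8 * sr ^+ 2 by rewrite mulr_ge0 ?sqr_ge0.
have h2 := le_trans he (ler_wpM2l s8 h1).
pose x := sg / (2 ^+ 14 * kp ^+ 2).
have x0 : 0 <= x by rewrite divr_ge0 ?mulr_ge0 ?exprn_ge0 // ltW.
have h3 : 8 * sr ^+ 2 * (2 * y * (mu1 * sr * (kp * sg))) ^+ 2 = 32 * x ^+ 2.
  rewrite /x /y; set a := 2 ^+ 14; field.
  by rewrite !gt_eqF.
rewrite h3 in h2.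
have h4 : e <= 8 * x.
  rewrite -(@ler_pXn2r _ 2) ?nnegrE //; last exact: mulr_ge0 (ler0n R 8) x0.
  apply: le_trans h2 _; rewrite [leRHS]exprMn; apply: ler_wpM2r; first exact: sqr_ge0.
  by rewrite -natrX ler_nat.
have xE : 2 ^+ 14 * kp ^+ 2 * x = sg.
  by rewrite mulrC divfK // mulf_neq0 ?gt_eqF ?exprn_gt0.
have k20 : 0 <= 2048 * kp ^+ 2 by rewrite mulr_ge0 ?exprn_ge0 ?ler0n // ltW.
apply: le_trans (ler_wpM2l k20 h4) _.
rewrite -xE le_eqVlt; apply/orP; left; apply/eqP; ring.
Qed.

End Sizes.

Theorem theorem2p7 (R : realType) :
  exists C : R, 0 < C /\
  forall (n r m L : nat) (X : 'M[R]_n) (mu0 mu1 beta eps0 : R)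
    (alg : algorithm R) (H : 'M[R]_n -> 'M[R]_n) (grp : 'I_m -> 'I_L.+1),
  (9 <= n)%N -> (1 <= r <= n)%N -> (m <= n ^ 2)%N -> (L.+1 %| m)%N ->
  \rank X = r -> assumption_A0 r mu0 X -> assumption_A1 r mu1 X ->
  valid_parameters alg -> admissible alg eps0 ->
  (forall Z, is_hard_threshold r Z (H Z)) ->
  equal_groups grp ->
  1 < beta ->
  let Lambda : R := ln (beta * n%:R * ln n%:R / (24 * eps0)) in
  L%:Z = Num.ceil (6 * Lambda) ->
  m%:R >= C * beta * Num.max (mu0 / eps0 ^+ 2) (mu1 ^+ 2)
            * condition_number X ^+ 6 * n%:R * r%:R ^+ 2 * ln n%:R * Lambda ->
  iid_uniform_prob R
      [set w : m.-tuple ('I_n * 'I_n) |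
         alg_iter alg H w X (initialization r mu0 H X grp w) @ \oo --> X]
    >= 1 - 2 * n%:R `^ (1 - beta) - (24 * Lambda + 3) * n%:R `^ (2 - 2 * beta).
Proof.
(* 2^37 serves the accuracies, and L + 1 <= 8 Lambda contributes 8 when m is converted into the size
   of a group. *)
exists (2 ^+ 40); split; first exact: exprn_gt0.
move=> n r m L X mu0 mu1 beta eps0 alg H grp n9 rn mn Lm rX A0 A1 valid adm HH grpE b1.
move=> Lambda LE hm.
have n0 : (0 < n)%N by exact: leq_trans n9.
have /andP[r1 rn'] := rn.
have [k [U [s [V svdX]]]] := rsvd_exists HH X.
have kr : k = r by rewrite -rX (rsvd_rank svdX).
have k0 : (0 < k)%N by rewrite kr.
have UU := rsvd_U svdX; have VV := rsvd_V svdX.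
set kp := condition_number X in hm.
pose sg := sigma_min X; pose S := sigma_max X.
have sg0 : 0 < sg := sigma_min_gt0 svdX k0.
have sgs i : sg <= s 0 i := sigma_min_le svdX i.
have sS i : s 0 i <= S := sigma_max_ge svdX i.
have kpE : kp * sg = S by rewrite mulfVK ?gt_eqF.
have sgS : sg <= S by exact: le_trans (sgs (Ordinal k0)) (sS _).
have kp1 : 1 <= kp by rewrite -(ler_pM2r sg0) mul1r kpE.
have S0 : 0 < S by exact: lt_le_trans sgS.
have nR : 0 < n%:R :> R by rewrite ltr0n.
have rR : 1 <= r%:R :> R by rewrite ler1n.
have rR0 : 0 < r%:R :> R by rewrite ltr0n.
pose c := Num.sqrt (mu0 * r%:R / n%:R).
have Uc i : frob_norm (row i U) <= c.
  have [h _] := A0 i; move: h; rewrite (column_spaceE svdX) /ran_proj -mulmxA.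
  by rewrite isometry_norm // frob_norm_row.
have Vc i : frob_norm (row i V) <= c.
  have [_ h] := A0 i; move: h; rewrite (row_spaceE _ svdX) /ran_proj -mulmxA.
  by rewrite isometry_norm // frob_norm_row.
(* c = 0 would force U = 0 although its k > 0 columns are orthonormal; positivity of mu0 follows. *)
have c0 : 0 < c.
  rewrite lt0r sqrtr_ge0 andbT; apply/eqP => c0.
  have := frob_norm_isometry UU; rewrite frob_norm_sqr frob_dot_rows big1.
    by move/esym/eqP; rewrite pnatr_eq0 (gtn_eqF k0).
  move=> i _; rewrite -frob_norm_sqr.
  have := Uc i; rewrite c0 => h.
  have -> : frob_norm (row i U) = 0 by apply/eqP; rewrite eq_le h frob_norm_ge0.
  by rewrite expr0n.
have c2 : c ^+ 2 = mu0 * r%:R / n%:R.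
  by rewrite sqr_sqrtr // ltW // -sqrtr_gt0.
have mu0_gt0 : 0 < mu0.
  by move: c0; rewrite sqrtr_gt0 pmulr_lgt0 ?invr_gt0 // pmulr_lgt0.
pose mu := mx_norm X.
have Xmu i j : `|X i j| <= mu.
  rewrite /mu mx_normrE; exact: (le_bigmax _ (fun ij : 'I_n * 'I_n => `|X ij.1 ij.2|) (i, j)).
have XF : frob_norm X <= n%:R * mu.
  have mu_ge0 : 0 <= mu by exact: le_trans (normr_ge0 _) (Xmu (Ordinal n0) (Ordinal n0)).
  rewrite frob_norm_le ?mulr_ge0 //.
  apply: (@le_trans _ _ (\sum_(i < n) \sum_(j < n) mu ^+ 2)).
    apply: ler_sum => i _; apply: ler_sum => j _.
    by rewrite -expr2 -(real_normK (num_real _)) lerXn2r ?nnegrE.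
  by rewrite !sumr_const !card_ord -[_ *+ n *+ n]mulr_natl -[mu ^+ 2 *+ n]mulr_natl exprMn (expr2 n%:R) mulrA.
have SF : S <= n%:R * mu by exact: le_trans (sigma_max_le svdX k0) XF.
have mu_gt0 : 0 < mu by rewrite -(pmulr_rgt0 _ nR); exact: lt_le_trans SF.
pose sr := Num.sqrt r%:R : R.
have sr2 : sr ^+ 2 = r%:R by rewrite sqr_sqrtr // ler0n.
have sr0 : 0 <= sr by exact: sqrtr_ge0.
have nmu : n%:R * mu <= mu1 * sr * S.
  have := A1; rewrite /assumption_A1 -/mu /spectral_norm -/S sqrtrM ?ler0n // -/sr sqrtrV ?exprn_ge0 ?ler0n //.
  rewrite sqrtr_sqr ger0_norm ?ler0n // => h.
  have := ler_wpM2l (ltW nR) h; congr (_ <= _).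
  by field; rewrite gt_eqF.
have kp0 : 0 < kp by exact: lt_le_trans kp1.
clearbody kp sg S.
(* S is at most |X|_F <= n mu <= mu1 sqrt(r) S, and S cancels. *)
have nu1 : 1 <= mu1 * sr.
  by rewrite -(ler_pM2r S0) mul1r (le_trans SF).
have sr1 : 1 <= sr by rewrite -[leLHS]sqrtr1 ler_sqrt // ltr01.
have y1 : 1 <= mu1 * r%:R.
  rewrite -sr2 expr2 mulrA; apply: (le_trans nu1).
  by rewrite ler_peMr // (le_trans _ nu1).
pose y := mu1 * r%:R * kp ^+ 3.
have yy1 : 1 <= y.
  by apply: (le_trans y1); rewrite ler_peMr ?exprn_ege1 // (le_trans _ y1).
have y0 : 0 < y by exact: lt_le_trans yy1.
have e0 := admissible_gt0 adm.
have e4 : 4 * eps0 <= 1.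
  have := admissible_kappa valid adm; have := kappa_ge0 valid; lra.
have L1 : 1 <= Lambda := lambda_ge1 n9 b1 e0 e4.
have hL1 : 6 * Lambda <= L%:R.
  by have := ceil_ge (6 * Lambda); rewrite -LE.
have hL2 : L%:R <= 6 * Lambda + 1.
  by have := ceilB1_lt (6 * Lambda); rewrite -LE intrB => /ltW; rewrite lerBlDr.
have ln2 : 2 <= ln n%:R :> R := ln_ge2 n9.
pose T := beta * n%:R * ln n%:R.
have b0 : 0 < beta by exact: lt_trans b1.
have T0 : 0 < T by rewrite !mulr_gt0 // (lt_le_trans _ ln2).
pose mx := Num.max (mu0 / eps0 ^+ 2) (mu1 ^+ 2).
pose Mh : R := (m %/ L.+1)%:R.
have mE : m%:R = L.+1%:R * Mh :> R by rewrite /Mh -natrM mulnC divnK.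
have Mh0 : 0 <= Mh by exact: ler0n.
have hMh : 2 ^+ 37 * (T * mx * kp ^+ 6 * r%:R ^+ 2) <= Mh.
  have L8 : L.+1%:R <= 8 * Lambda by rewrite -natr1; lra.
  have h := le_trans hm (_ : m%:R <= 8 * Lambda * Mh).
  rewrite -(ler_pM2l (_ : 0 < 8 * Lambda)); last by rewrite mulr_gt0 // (lt_le_trans _ L1).
  apply: le_trans (h _); last by rewrite mE ler_wpM2r.
  have -> : 2 ^+ 40 = 8 * 2 ^+ 37 :> R.
    have -> : 8 = 2 ^+ 3 :> R by ring.
    by rewrite -exprD.
  rewrite -/mx /T le_eqVlt; apply/orP; left; apply/eqP.
  by set a := 2 ^+ 37; ring.
have mu0mx : mu0 / eps0 ^+ 2 <= mx by rewrite le_max lexx.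
have mu1mx : mu1 ^+ 2 <= mx by rewrite le_max lexx orbT.
have mx0 : 0 < mx by apply: lt_le_trans mu0mx; rewrite divr_gt0 // exprn_gt0.
have m0 : (0 < m)%N.
  rewrite -(ltr0n R); apply: lt_le_trans hm.
  by rewrite -/mx !mulr_gt0 ?exprn_gt0 ?(lt_le_trans _ ln2) // (lt_le_trans _ L1).
have e1 : eps0 <= 1 by lra.
have a37 : 0 <= 2 ^+ 37 :> R by rewrite exprn_ge0.
have [F1 F2 F3] := sample_sizes a37 (ltW T0) (ltW mu0_gt0) e0 e1 kp1 rR mu0mx mu1mx hMh.
rewrite -/y in F1.
have bl1 : 1 <= beta * ln n%:R.
  by apply: mulr_ege1; rewrite ?(ltW b1) // (le_trans _ ln2) // ler1n.
(* Half the moment order: at least 6 beta ln n for the failure probability, at most 7 beta ln n for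
   the sample size. *)
have [p [p0 hp1 hp2]] := exponent_exists bl1.
have pn : p%:R * n%:R <= 7 * T.
  have := ler_wpM2r (ltW nR) hp2; rewrite /T; lra.
(* [delta1] makes the starting error at most sigma_min / (2048 kappa^2), and
   [delta2] makes every resampled step contract the error by 1/8. *)
pose delta1 := (2 ^+ 14 * y)^-1.
pose delta2 := (2 ^+ 9 * kp)^-1.
have d1_gt0 : 0 < delta1 by rewrite invr_gt0 mulr_gt0 ?exprn_gt0.
have d2_gt0 : 0 < delta2 by rewrite invr_gt0 mulr_gt0 ?exprn_gt0.
have two1 q : 1 <= 2 ^+ q :> R by rewrite exprn_ege1 // ler1n.
have d1_le1 : delta1 <= 1.
  by rewrite invf_le1; [apply: mulr_ege1 | rewrite -invr_gt0].
have d2_le1 : delta2 <= 1.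
  by rewrite invf_le1; [apply: mulr_ege1 | rewrite -invr_gt0].
have d2k : 256 * (kp * (2 * delta2)) <= 1.
  rewrite /delta2 le_eqVlt; apply/orP; left; apply/eqP; field.
  by rewrite gt_eqF.
have MhM : Mh <= m%:R by rewrite ler_nat leq_div.
have [size1 size2 size3'] := sampling_rates T0 mu0_gt0 kp0 rR0 nR Mh0 y0 c2 pn F1 F2 F3.
have size3 : 64 * p%:R * n%:R ^+ 2 * (2 * c ^+ 2) <= (eps0 / 80) ^+ 2 * m%:R.
  by apply: le_trans size3' _; rewrite ler_wpM2l ?sqr_ge0.
have d1k e : 0 <= e -> e ^+ 2 <= 8 * k%:R * (2 * delta1 * n%:R * mu) ^+ 2 ->
    2048 * kp ^+ 2 * e <= sg.
  move=> ee h.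
  apply: (init_accuracy kp0 sg0 (lt_le_trans ltr01 sr1) (lt_le_trans ltr01 nu1) _ _ ee).
  - exact: mulr_ge0 (ltW nR) (ltW mu_gt0).
  - by rewrite kpE; exact: nmu.
  by rewrite sr2 [_ * (n%:R * mu)]mulrA -[X in 8 * X%:R]kr; exact: h.
have dep := depth_le n9 b1 e0 e4 (erefl Lambda) hL1.
have fail := failure_bound kr rn n9 HH svdX sg0 sgs sS kpE kp1 Uc Vc Xmu mu_gt0 valid adm
  grpE m0 Lm p0 d1_gt0 d1_le1 d2_gt0 d2_le1 d2k d1k size1 size2 size3 dep.
have un := union_le n9 b1 L1 hL2 hp1.
apply: le_trans (iid_uniform_prob_ge n0 fail).
have := powR_ge0 (n%:R : R) (1 - beta); lra.
Qed.
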